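(* Let $A,B$ be finite-dimensional vector spaces over a field $\Bbbk$ with symmetric non-degenerate bilinear forms $\beta_A,\beta_B$. An algebra for the Kaufmann–Penner modular hybrid $\mathcal Q\underline{\mathcal O}\mathcal C_{\mathrm{KP}}$ on the pair $A,B$ is the same as (i) a Frobenius algebra $(A,\mu_A,\beta_A)$, (ii) a commutative Frobenius algebra $(B,\omega_B,\beta_B)$, and (iii) an associative algebra morphism $f:B\to A$ with values in the center of $A$, satisfying the Cardy condition $$\beta_A(\mu_A\otimes\mu_A)(\mathrm{id}\otimes\tau\otimes\mathrm{id})(\mathrm{id}\otimes\mathrm{id}\otimes\beta_A^{-1})=(\beta_A\otimes\beta_A)\bigl(\mathrm{id}\otimes(f\otimes f)\beta_B^{-1}\otimes\mathrm{id}\bigr)$$ of linear maps $A\otimes A\to\Bbbk$, where $\tau$ is the standard symmetry in the monoidal category of graded vector spaces.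
   Context: Cycles and multicycles. A cycle on a finite set $O=\{o_1,\dots,o_n\}$ is an equivalence class of total orders on $O$ modulo $(o_1,o_2,\dots,o_n)\equiv(o_2,\dots,o_n,o_1)$; it is written $((o_1,\dots,o_n))$ (commas may be omitted). The empty set has a unique cycle $(())$. A multicycle $\mathsf O=\mathsf o_1\cdots\mathsf o_b$ on a finite set $O$ is a disjoint unordered decomposition $O=o_1\sqcup\cdots\sqcup o_b$ into $b\ge0$ possibly empty sets together with a cycle $\mathsf o_i$ on each $o_i$; $b=0$ is possible only for $O=\emptyset$ and gives the trivial multicycle $\varnothing$. An isomorphism $\mathsf o'_1\cdots\mathsf o'_{b'}\to\mathsf o''_1\cdots\mathsf o''_{b''}$ is a bijection $u:\{1,\dots,b'\}\to\{1,\dots,b''\}$ with cyclic-order-preserving bijections $\mathsf o'_i\to\mathsf o''_{u(i)}$; $\mathtt{MultCyc}$ is the resulting groupoid. $\mathsf O'\mathsf O''$ denotes the union of multicycles on disjoint sets. Merging of cycles: $((o'_1,\dots,o'_m))\,{}_{o'_m}\circ_{o''_1}((o''_1,\dots,o''_n))=((o'_1,\dots,o'_{m-1},o''_2,\dots,o''_n))$, extended to all pairs of elements by rotation. Cutting of a cycle: $\circ_{o_1o_i}((o_1,\dots,o_n))=((o_2,\dots,o_{i-1}))((o_{i+1},\dots,o_n))$ for $1<i\le n$, extended by rotation. For multicycles, $\mathsf O'\,{}_a\circ_b\mathsf O''$ merges the cycle of $\mathsf O'$ containing $a$ with the cycle of $\mathsf O''$ containing $b$ and keeps all other cycles; $\circ_{uv}\mathsf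 O$ cuts the cycle containing both $u,v$ if they lie in the same cycle, and merges the two cycles containing $u$ and $v$ if they lie in different cycles, keeping all other cycles. Hybrids. $\mathtt{Fin}$ is the category of finite sets (and bijections), $\frac12\mathbb N=\{n/2: n\in\mathbb N\}$, $0\in\mathbb N$. A cyclic hybrid $\mathcal H$ is a functor $\mathtt{MultCyc}\times\mathtt{Fin}\times\frac12\mathbb N\to\mathtt{Set}$ ($\frac12\mathbb N$ discrete), $(\mathsf O,C,G)\mapsto\mathcal H(\mathsf O,C;G)$; elements of the underlying set $O$ of $\mathsf O$ are open inputs, those of $C$ closed inputs, $G$ is the operadic genus. It carries operations (for disjoint input sets) - open: ${}_u\circ_v:\mathcal H(\mathsf O',C';G')\times\mathcal H(\mathsf O'',C'';G'')\to\mathcal H(\mathsf O'\,{}_u\circ_v\mathsf O'',C'\sqcup C'';G'+G'')$ for $u\in O'$, $v\in O''$; - closed: ${}_u\circ_v:\mathcal H(\mathsf O',C'\sqcup\{u\};G')\times\mathcal H(\mathsf O'',C''\sqcup\{v\};G'')\to\mathcal H(\mathsf O'\mathsf O'',C'\sqcup C'';G'+G'')$, equivariant under isomorphisms and satisfying $x\,{}_u\circ_v y=y\,{}_v\circ_u x$ and $(x\,{}_a\circ_by)\,{}_c\circ_dz=x\,{}_a\circ_b(y\,{}_c\circ_dz)$ for $c\neq b$ an input of $y$. No units are required. A modular hybrid is a cyclic hybrid with in addition contractions $\circ_{uv}=\circ_{vu}$: - open: $\mathcal H(\mathsf O,C;G)\to\mathcal H(\circ_{uv}\mathsf O,C;G+1)$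 for distinct $u,v\in O$; - closed: $\mathcal H(\mathsf O,C\sqcup\{u,v\};G)\to\mathcal H(\mathsf O,C;G+1)$, equivariant and satisfying $\circ_{uv}\circ_{cd}=\circ_{cd}\circ_{uv}$; $\circ_{uv}(x\,{}_a\circ_by)=(\circ_{uv}x)\,{}_a\circ_by$ for $u,v$ inputs of $x$; and $\circ_{ab}(x\,{}_c\circ_dy)=\circ_{cd}(x\,{}_a\circ_by)$ for $a,c$ inputs of $x$ and $b,d$ inputs of $y$. Morphisms are natural transformations commuting with all operations. The hybrids $\mathcal Q\underline{\mathcal O}\mathcal C$ and $\underline{\mathcal O}\mathcal C$. For $\mathsf O=\mathsf o_1\cdots\mathsf o_b$, $b\ge0$, and $G\in\frac12\mathbb N$, $\mathcal Q\underline{\mathcal O}\mathcal C(\mathsf O,C;G)=\{[\mathsf O;g;C]\mid g\in\mathbb N,\ G=2g+b-1+|C|/2\}$. Operations: $[\mathsf O';g';C']\,{}_a\circ_b[\mathsf O'';g'';C'']=[\mathsf O'\,{}_a\circ_b\mathsf O'';g'+g'';C'\sqcup C'']$ for open $a,b$, and $=[\mathsf O'\mathsf O'';g'+g'';(C'\sqcup C'')\setminus\{a,b\}]$ for closed $a,b$; $\circ_{uv}[\mathsf O;g;C]=[\circ_{uv}\mathsf O;g;C]$ for open $u,v$ in the same cycle, $=[\circ_{uv}\mathsf O;g+1;C]$ for open $u,v$ in different cycles, and $\circ_{uv}[\mathsf O;g;C]=[\mathsf O;g+1;C\setminus\{u,v\}]$ for closed $u,v$. Isomorphisms relabel. This is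 a modular hybrid. $\underline{\mathcal O}\mathcal C\subset\mathcal Q\underline{\mathcal O}\mathcal C$ is the cyclic subhybrid of elements with $g=0$. The stable parts $\mathcal Q\underline{\mathcal O}\mathcal C_{\mathrm{st}}$ and $\underline{\mathcal O}\mathcal C_{\mathrm{st}}$ consist of the elements with $2(G-1)+|O|+|C|>0$. The Kaufmann–Penner cyclic hybrid $\underline{\mathcal O}\mathcal C_{\mathrm{KP}}$ is the cyclic subhybrid of $\underline{\mathcal O}\mathcal C_{\mathrm{st}}$ obtained by discarding the elements $[(())\cdots(());0;\emptyset]$ with $b\ge3$; $[(())\cdots(())\,\mathsf o;0;\emptyset]$ with $b\ge2$, $|\mathsf o|\ge1$; and $[(())\cdots(());0;\{d\}]$ with $b\ge2$. The Kaufmann–Penner modular hybrid $\mathcal Q\underline{\mathcal O}\mathcal C_{\mathrm{KP}}$ is the modular subhybrid of $\mathcal Q\underline{\mathcal O}\mathcal C_{\mathrm{st}}$ generated by $\underline{\mathcal O}\mathcal C_{\mathrm{KP}}$, i.e. the set of all iterated contractions $\circ_{p'_1p''_1}\cdots\circ_{p'_np''_n}(x)$, $n\ge0$, of elements $x\in\underline{\mathcal O}\mathcal C_{\mathrm{KP}}$. Algebras. Vector spaces are over a field $\Bbbk$ of any characteristic (possibly graded, with degree-preserving maps and the Koszul sign rule). $\beta_A^{-1}:\Bbbk\to A\otimes A$ is the unique linear map with $(\beta_A\otimes\mathrm{id})(\mathrm{id}\otimes\beta_A^{-1})=(\mathrm{id}\otimes\beta_A)(\beta_A^{-1}\otimes\mathrm{id})=\mathrm{id}_A$;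 $\beta_B^{-1}$ is defined similarly. The endomorphism modular hybrid $\mathcal End_{A,B}$ has components (independent of $G$ and of the cyclic orders) $\mathcal End_{A,B}(\mathsf O,C;G)=\mathrm{Lin}\bigl(\bigotimes_{o\in O}A_o\otimes\bigotimes_{c\in C}B_c,\Bbbk\bigr)$ with $A_o=A$, $B_c=B$ and unordered tensor products; $x\,{}_u\circ_vy$ and $\circ_{uv}x$ are obtained from $x\otimes y$, resp. $x$, by inserting $\beta_A^{-1}$ (open $u,v$) or $\beta_B^{-1}$ (closed $u,v$) into the slots $u,v$. An algebra over a modular hybrid $\mathcal H$ on $A,B$ is a morphism of modular hybrids $\alpha:\mathcal H\to\mathcal End_{A,B}$. A Frobenius algebra on $(A,\beta_A)$ is an associative (not necessarily unital) multiplication $\mu_A:A\otimes A\to A$ such that $\beta_A(\mu_A(a_1,a_2),a_3)$ is cyclically invariant in $a_1,a_2,a_3$; it is commutative if this expression is invariant under all permutations of $a_1,a_2,a_3$. ''Is the same as'' refers to the one-to-one correspondence in which $\beta_A(\mu_A(a_1,a_2),a_3)=\alpha([((pqr));0;\emptyset])(a_1\otimes a_2\otimes a_3)$, $\beta_B(\omega_B(c_1,c_2),c_3)=\alpha([\varnothing;0;\{d,e,f\}])(c_1\otimes c_2\otimes c_3)$, and $f$ corresponds to $\alpha([((p));0;\{d\}])\in\mathrm{Lin}(A\otimes B,\Bbbk)$ via $\beta_A$. *)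

(* Defs.v *)
From HB Require Import structures.
From mathcomp Require Import all_boot all_order all_algebra.
From mathcomp Require Import zify.

Set Implicit Arguments.
Unset Strict Implicit.
Unset Printing Implicit Defensive.

Import GRing.Theory.
Local Open Scope ring_scope.

Definition oddz (d : int) : bool := odd `|d|%N.

(* A finite-dimensional Z-graded space: V is the direct sum of its homogeneous
   parts [hom d], which vanish outside the finite set [supp].  An ungraded space
   is one concentrated in degree 0. *)
Record graded_space (K : fieldType) := GradedSpace {
  gsort :> vectType K;
  supp : seq int;
  hom : int -> {vspace gsort};
  _ : uniq supp;
  _ : forall d, d \notin supp -> hom d = 0%VS;
  _ : directv (\sum_(i < size supp) hom supp`_i);
  _ : (\sum_(i < size supp) hom supp`_i)%VS = fullv }.

Section Graded.
Variables (K : fieldType) (V : graded_space K).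

(* Projection onto the sum of the homogeneous parts whose degree has parity b. *)
Definition parity_part (b : bool) : 'End(V) :=
  \sum_(i < size (supp V) | oddz (supp V)`_i == b)
     sumv_pi (\sum_(i < size (supp V)) hom V (supp V)`_i)%VS i.

(* v |-> (-1)^(d |v|) v *)
Definition koszul_scale (d : int) : 'End(V) :=
  parity_part false + (-1) ^+ oddz d *: parity_part true.

Lemma hom_sum_dec (v : V) :
  v = \sum_i sumv_pi (\sum_(i < size (supp V)) hom V (supp V)`_i)%VS i v.
Proof.
rewrite sumv_pi_sum //; case: V v => /= gs su ho _ _ _ -> v; exact: memvf.
Qed.

Lemma hom_pi d (v : V) (i : 'I_(size (supp V))) : v \in hom V d ->
  sumv_pi (\sum_(i < size (supp V)) hom V (supp V)`_i)%VS i v =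
  if (supp V)`_i == d then v else 0.
Proof.
move=> vd.
have [us nz dx] : [/\ uniq (supp V), forall d, d \notin supp V -> hom V d = 0%VS
  & directv (\sum_(i < size (supp V)) hom V (supp V)`_i)] by case: (V).
have [dS|dNS] := boolP (d \in supp V); last first.
  move: vd; rewrite nz // memv0 => /eqP->; by rewrite linear0 if_same.
have lt_d : (index d (supp V) < size (supp V))%N by rewrite index_mem.
pose j := Ordinal lt_d.
have Ej : (supp V)`_j = d by rewrite nth_index.
have E : \sum_i sumv_pi (\sum_(i < size (supp V)) hom V (supp V)`_i)%VS i v
   = \sum_(i < size (supp V)) (if (supp V)`_i == d then v else 0).
  rewrite -hom_sum_dec (bigD1 j) //= Ej eqxx big1 ?addr0 // => k kj.
  case: eqP => // Ek; case/eqP: kj; apply/val_inj => /=.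
  by rewrite -Ek index_uniq.
move/eqP: E; rewrite (directv_sum_unique dx) => [/forall_inP/(_ i isT)/eqP->//|k _|k _].
  exact: memv_sum_pi.
by case: eqP => [->//|_]; rewrite mem0v.
Qed.

Lemma parity_part_hom b d (v : V) : v \in hom V d ->
  parity_part b v = if oddz d == b then v else 0.
Proof.
move=> vd; rewrite /parity_part sum_lfunE.
rewrite (eq_bigr (fun i : 'I__ => if (supp V)`_i == d then v else 0)); last first.
  by move=> i _; apply: hom_pi.
case: ifP => ob.
  rewrite [RHS](hom_sum_dec v) [LHS]big_mkcond; apply: eq_bigr => i _.
  rewrite (hom_pi i vd); case: (_ =P d) => [->|]; first by rewrite ob.
  by rewrite if_same.
rewrite big1 // => i /eqP oi; case: eqP => // E.
by rewrite -oi E eqxx in ob.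
Qed.

Lemma koszul_scale_hom d e (v : V) : v \in hom V e ->
  koszul_scale d v = (-1) ^+ (oddz d && oddz e) *: v.
Proof.
move=> ve; rewrite add_lfunE scale_lfunE !(parity_part_hom _ ve).
by case: (oddz e); rewrite ?andbT ?andbF ?scaler0 ?add0r ?addr0 ?scale1r.
Qed.

End Graded.

(* A symmetric non-degenerate bilinear form of degree 0; symmetry follows the
   Koszul rule. *)
Record form_space (K : fieldType) := FormSpace {
  fspace :> graded_space K;
  form : 'Hom(fspace, 'Hom(fspace, K^o));
  _ : forall d e a b, a \in hom fspace d -> b \in hom fspace e ->
        d + e != 0 -> form a b = 0;
  _ : forall d e a b, a \in hom fspace d -> b \in hom fspace e ->
        form a b = (-1) ^+ (oddz d && oddz e) * form b a;
  _ : forall a, (forall b, form a b = 0) -> a = 0 }.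

Section FormSpace.
Variables (K : fieldType) (V : form_space K).

Definition hom_basis : seq V :=
  \big[cat/[::]]_(i < size (supp V)) vbasis (hom V (supp V)`_i).

Definition gram : 'M[K]_(size hom_basis) :=
  \matrix_(i, j) form V hom_basis`_i hom_basis`_j.

(* [form V]^{-1} in V (x) V, as the list of elementary tensors e_i (x) e^i,
   where (e_i) is a homogeneous basis and form V e^i e_j = delta_ij. *)
Definition copairing : seq (V * V) :=
  [seq (hom_basis`_i, \sum_(j < size hom_basis) invmx gram i j *: hom_basis`_j)
  | i : 'I_(size hom_basis) <- enum 'I_(size hom_basis)].

Lemma hom_basisP : basis_of fullv (in_tuple hom_basis).
Proof.
rewrite /hom_basis.
have [dx <-] : directv (\sum_(i < size (supp V)) hom V (supp V)`_i) /\
  (\sum_(i < size (supp V)) hom V (supp V)`_i)%VS = fullv by case: (V) => -[].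
by apply: bigcat_basis => // i _; apply: vbasisP.
Qed.

Lemma hom_basis_hom (i : 'I_(size hom_basis)) :
  exists d, hom_basis`_i \in hom V d.
Proof.
have := mem_nth 0 (ltn_ord i); move: (hom_basis`_i) => x.
rewrite /hom_basis; elim/big_ind: _ => //= [s1 s2 IH1 IH2|j _].
  by rewrite mem_cat => /orP[].
by move/vbasis_mem; exists (supp V)`_j.
Qed.

Lemma formDl a b c : form V (a + b) c = form V a c + form V b c.
Proof. by rewrite linearD add_lfunE. Qed.
Lemma formZl k a c : form V (k *: a) c = k * form V a c.
Proof. by rewrite linearZ scale_lfunE. Qed.
Lemma form_suml I (r : seq I) P F c :
  form V (\sum_(i <- r | P i) F i) c = \sum_(i <- r | P i) form V (F i) c.
Proof. by rewrite linear_sum sum_lfunE. Qed.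

Lemma form_basis_inj a :
  (forall i : 'I_(size hom_basis), form V a hom_basis`_i = 0) -> a = 0.
Proof.
have ndg : forall a, (forall b, form V a b = 0) -> a = 0 by case: (V).
move=> a0; apply: ndg => b.
rewrite (coord_basis hom_basisP (memvf b)) linear_sum big1 // => i _.
by rewrite linearZ /= a0 scaler0.
Qed.

Lemma gram_unit : gram \in unitmx.
Proof.
rewrite -row_free_unit -kermx_eq0; apply/eqP/row_matrixP => k; rewrite row0.
set v := row k _.
have : v *m gram = 0 by apply/sub_kermxP/row_sub.
move/rowP => v0.
have /freeP fr := basis_free hom_basisP.
have /fr : \sum_i v 0 i *: (in_tuple hom_basis)`_i = 0.
  apply: form_basis_inj => j; rewrite form_suml.
  have := v0 j; rewrite !mxE => {2}<-; apply: eq_bigr => i _.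
  by rewrite formZl !mxE.
by move=> vi; apply/rowP => i; rewrite vi mxE.
Qed.

Definition dual_basis (i : 'I_(size hom_basis)) : V := \sum_(j < size hom_basis) invmx gram i j *: hom_basis`_j.

Lemma dual_basisP (i j : 'I_(size hom_basis)) : form V (dual_basis i) hom_basis`_j = (i == j)%:R.
Proof.
have := mulVmx gram_unit => /matrixP/(_ i j); rewrite !mxE => <-.
by rewrite form_suml; apply: eq_bigr => k _; rewrite formZl !mxE.
Qed.

Lemma big_copairing (W : zmodType) (F : V * V -> W) :
  \sum_(e <- copairing) F e =
  \sum_(i < size hom_basis) F (hom_basis`_i, dual_basis i).
Proof. by rewrite big_map big_enum. Qed.

(* (id (x) form)(form^{-1} (x) id) = id *)
Lemma copairing_snakel a : \sum_(e <- copairing) form V e.2 a *: e.1 = a.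
Proof.
rewrite big_copairing /= [RHS](coord_basis hom_basisP (memvf a)).
apply: eq_bigr => i _; congr (_ *: _).
rewrite {1}(coord_basis hom_basisP (memvf a)) linear_sum (bigD1 i) //=.
rewrite big1 => [|j ji]; rewrite linearZ /= dual_basisP.
  by rewrite eqxx addr0 /GRing.scale /= mulr1.
by rewrite eq_sym (negPf ji) scaler0.
Qed.

(* (form (x) id)(id (x) form^{-1}) = id *)
Lemma copairing_snaker a : \sum_(e <- copairing) form V a e.1 *: e.2 = a.
Proof.
apply/eqP; rewrite -subr_eq0; apply/eqP/form_basis_inj => j.
rewrite formDl big_copairing form_suml (bigD1 j) //= big1 => [|i ij].
  rewrite formZl dual_basisP eqxx mulr1 addr0 -scaleN1r formZl mulN1r; exact: subrr.
by rewrite formZl dual_basisP (negPf ij) mulr0.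
Qed.

Lemma copairing_hom e : e \in copairing ->
  exists d, e.1 \in hom V d /\ e.2 \in hom V (- d).
Proof.
case/mapP => i _ -> /=; have [d id] := hom_basis_hom i.
exists d; split=> //; rewrite -/(dual_basis i).
have dg : forall d e a b, a \in hom V d -> b \in hom V e ->
        d + e != 0 -> form V a b = 0 by case: (V).
pose c k := sumv_pi (\sum_(i < size (supp V)) hom V (supp V)`_i)%VS k (dual_basis i).
have ch (k : 'I__) : c k \in hom V (supp V)`_k by apply: memv_sum_pi.
pose y : V := \sum_(k : 'I_(size (supp V)) | (supp V)`_k == - d) c k.
have yh : y \in hom V (- d) by apply: rpred_sum => k /eqP <-.
suff -> : dual_basis i = y by [].
apply/eqP; rewrite -subr_eq0; apply/eqP/form_basis_inj => j.
have [f jf] := hom_basis_hom j.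
have [Efd|nfd] := eqVneq f d.
  rewrite [dual_basis i]hom_sum_dec (bigID (fun k : 'I__ => (supp V)`_k == - d)) /=.
  rewrite -/y addrAC subrr add0r form_suml big1 // => k kd.
  by apply: dg (ch k) jf _; rewrite Efd addr_eq0.
rewrite formDl dual_basisP -scaleN1r formZl (dg _ _ _ _ yh jf) ?mulr0 ?addr0.
  case: eqP => // Eij; rewrite -Eij in jf.
  have nz : dual_basis i != 0.
    by apply/eqP => E; have := dual_basisP i i; rewrite E linear0 lfunE eqxx => /esym/eqP; rewrite oner_eq0.
  have bz : hom_basis`_i != 0.
    by apply/eqP => E; have := dual_basisP i i; rewrite E linear0 eqxx => /esym/eqP; rewrite oner_eq0.
  have := hom_sum_dec hom_basis`_i; rewrite big1 => [E|k _]; first by rewrite E eqxx in bz.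
  rewrite (hom_pi k id); case: eqP => // Ek; have := hom_pi k jf; rewrite (hom_pi k id).
  by rewrite Ek eqxx eq_sym (negPf nfd) => E; rewrite E eqxx in bz.
by rewrite addrC subr_eq0.
Qed.

End FormSpace.

Section Koszul.
Variable I : finType.
Implicit Types (p : pred I) (s t r : seq I).

Definition ordering := {s : seq I | perm_eq s (enum I)}.

Definition mk_ordering s (h : perm_eq s (enum I)) : ordering :=
  exist (fun s => is_true (perm_eq s (enum I))) s h.

Definition before s (i j : I) : bool := (index i s < index j s)%N.

(* Parity of the number of pairs of odd factors whose order differs in s and
   t: permuting a tensor product from order s to order t multiplies it by
   (-1) ^+ koszul p s t, where p selects the factors of odd degree. *)
Definition koszul p s t : bool :=
  odd #|[set ij : I * I | [&& p ij.1, p ij.2, before s ij.1 ij.2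
                            & before t ij.2 ij.1]]|.

Lemma orderingP s : uniq s -> (forall i, i \in s) -> perm_eq s (enum I).
Proof.
by move=> us ms; apply: uniq_perm; rewrite ?enum_uniq // => i; rewrite ms mem_enum.
Qed.

Lemma ordering_uniq (s : ordering) : uniq (val s).
Proof. by rewrite (perm_uniq (valP s)) enum_uniq. Qed.

Lemma mem_ordering (s : ordering) i : i \in val s.
Proof. by rewrite (perm_mem (valP s)) mem_enum. Qed.

Lemma before_neg (s : ordering) i j : i != j -> before (val s) j i = ~~ before (val s) i j.
Proof.
move=> ij; rewrite /before -leqNgt [RHS]leq_eqVlt; case: eqP => //= E.
case/eqP: ij; by rewrite -[LHS](nth_index i (mem_ordering s i)) -E nth_index ?mem_ordering.
Qed.

Lemma odd_card_big (T : finType) (P : pred T) : odd #|P| = \big[addb/false]_x P x.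
Proof.
rewrite -sum1_card big_mkcond /= (big_morph odd oddD (erefl : odd 0 = false)).
by apply: eq_bigr => x _; rewrite unfold_in; case: (P x).
Qed.

Lemma koszulE p s t : koszul p s t =
  \big[addb/false]_i \big[addb/false]_j [&& p i, p j, before s i j & before t j i].
Proof.
rewrite /koszul cardsE odd_card_big.
by rewrite (pair_big predT predT (fun i j => [&& p i, p j, before s i j & before t j i])).
Qed.

Lemma koszul_id p s : koszul p s s = false.
Proof.
rewrite koszulE big1 // => i _; rewrite big1 // => j _.
by rewrite /before; case: ltngtP; rewrite ?andbF.
Qed.

Lemma koszul_cocycle p (s t r : ordering) :
  koszul p (val s) (val t) (+) koszul p (val t) (val r) = koszul p (val s) (val r).
Proof.
have K a b : koszul p a b = \big[addb/false]_(ij : I * I | (enum_rank ij.1 < enum_rank ij.2)%N)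
   ([&& p ij.1, p ij.2, before a ij.1 ij.2 & before b ij.2 ij.1] (+)
    [&& p ij.1, p ij.2, before a ij.2 ij.1 & before b ij.1 ij.2]).
  rewrite koszulE (pair_big predT predT
    (fun i j => [&& p i, p j, before a i j & before b j i])) /=.
  rewrite (bigID (fun ij : I * I => (enum_rank ij.1 < enum_rank ij.2)%N)) /=.
  rewrite big_split /=; congr addb.
  rewrite (bigID (fun ij : I * I => (enum_rank ij.2 < enum_rank ij.1)%N)) /=.
  rewrite [X in _ (+) X]big1 ?addbF; last first.
    move=> [i j] /= /andP[]; rewrite -!leqNgt => h1 h2.
    have /val_inj/enum_rank_inj -> : val (enum_rank i) = val (enum_rank j).
      by apply/eqP; rewrite eqn_leq h1 h2.
    by rewrite /before ltnn !andbF.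
  rewrite (reindex_inj (inv_inj (_ : involutive (fun ij : I * I => (ij.2, ij.1))))) /=;
    last by case.
  apply: eq_big => [[i j]|[i j] _] /=; last by do 2!case: (p _).
  by case: ltngtP.
rewrite !K -big_split; apply: eq_bigr => -[i j] /= ij.
have nij : i != j by apply: contraTneq ij => ->; rewrite ltnn.
rewrite !(before_neg _ nij); case: (p i); case: (p j) => //=.
by do 3!case: (before _ i j).
Qed.

End Koszul.

Lemma koszul_cat (I1 I2 I : finType) (l : I1 -> I) (r : I2 -> I) (p : pred I)
    (s1 t1 : ordering I1) (s2 t2 : ordering I2) :
  bijective (fun z : I1 + I2 => match z with inl a => l a | inr b => r b end) ->
  koszul p (map l (val s1) ++ map r (val s2)) (map l (val t1) ++ map r (val t2)) =
  koszul (fun a => p (l a)) (val s1) (val t1) (+) koszul (fun a => p (r a)) (val s2) (val t2).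
Proof.
set h := fun z => _; move=> bh; have ih := bij_inj bh.
have il : injective l by move=> a b E; have /ih[] : h (inl a) = h (inl b) by [].
have ir : injective r by move=> a b E; have /ih[] : h (inr a) = h (inr b) by [].
have ixl a (s1' : ordering I1) (s2' : ordering I2) :
    index (l a) (map l (val s1') ++ map r (val s2')) = index a (val s1').
  by rewrite index_cat map_f ?mem_ordering // index_map.
have ixr a (s1' : ordering I1) (s2' : ordering I2) :
    index (r a) (map l (val s1') ++ map r (val s2')) = (size (val s1') + index a (val s2'))%N.
  rewrite index_cat ifN ?index_map ?size_map //.
  by apply/mapP => -[b _ E]; have /ih : h (inr a) = h (inl b) by [].
have ge1 a (s1' : ordering I1) (k : nat) : (size (val s1') + k < index a (val s1'))%N = false.
  by apply/negbTE; rewrite -leqNgt ltnW // ltn_addr // index_mem mem_ordering.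
rewrite !koszulE (reindex h); last exact: onW_bij.
rewrite big_sumType /=; congr addb; apply: eq_bigr => a _;
  rewrite (reindex h) ?big_sumType /=; try exact: onW_bij.
  rewrite [X in _ (+) X]big1 ?addbF; last first.
    by move=> b _; rewrite /before !ixl !ixr ge1 !andbF.
  by apply: eq_bigr => b _; rewrite /before !ixl.
rewrite big1 => [|b _] /=; last first.
  by rewrite /before !ixl !ixr ge1 !andbF.
by apply: eq_bigr => b _; rewrite /before !ixr !ltn_add2l.
Qed.

Lemma koszul_map (I J : finType) (f : I -> J) (p : pred J) (s t : seq I) :
  bijective f -> koszul p (map f s) (map f t) = koszul (fun i => p (f i)) s t.
Proof.
move=> bf; rewrite !koszulE (reindex f); last exact: onW_bij.
apply: eq_bigr => i _; rewrite (reindex f); last exact: onW_bij.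
by apply: eq_bigr => j _; rewrite /before !index_map //; apply: bij_inj.
Qed.

Section Endo.
Variables (K : fieldType) (A B : form_space K).

Definition upd (T : finType) (W : Type) (x : {ffun T -> W}) (t : T) (a : W) :
  {ffun T -> W} := [ffun z => if z == t then a else x z].

Definition homog (O C : finType) (d : O + C -> int)
    (x : {ffun O -> A}) (y : {ffun C -> B}) : Prop :=
  (forall o, x o \in hom A (d (inl o))) /\ (forall c, y c \in hom B (d (inr c))).

(* A degree-preserving linear form on the unordered tensor product of a copy
   A_o of A for each o in O and a copy B_c of B for each c in C, as a multilinear
   map: [ev s x y] is its value on the tensor product of the x o and the y c
   listed in the order s. *)
Record endo (O C : finType) := Endo {
  ev :> ordering (O + C)%type -> {ffun O -> A} -> {ffun C -> B} -> K;
  _ : forall s x y o k a a',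
        ev s (upd x o (k *: a + a')) y = k * ev s (upd x o a) y + ev s (upd x o a') y;
  _ : forall s x y c k b b',
        ev s x (upd y c (k *: b + b')) = k * ev s x (upd y c b) + ev s x (upd y c b');
  _ : forall s t d x y, homog d x y ->
        ev s x y = (-1) ^+ koszul (fun i => oddz (d i)) (val s) (val t) * ev t x y;
  _ : forall s d x y, homog d x y -> \sum_i d i != 0 -> ev s x y = 0 }.

Section Theory.
Variables (O C : finType) (phi : endo O C).

Lemma ev_linO s x y o k a a' :
  phi s (upd x o (k *: a + a')) y = k * phi s (upd x o a) y + phi s (upd x o a') y.
Proof. by case: phi s x y o k a a'. Qed.
Lemma ev_linC s x y c k b b' :
  phi s x (upd y c (k *: b + b')) = k * phi s x (upd y c b) + phi s x (upd y c b').
Proof. by case: phi s x y c k b b'. Qed.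
Lemma ev_sign s t d x y : homog d x y ->
  phi s x y = (-1) ^+ koszul (fun i => oddz (d i)) (val s) (val t) * phi t x y.
Proof. by case: phi s t d x y. Qed.
Lemma ev_deg s d x y : homog d x y -> \sum_i d i != 0 -> phi s x y = 0.
Proof. by case: phi s d x y. Qed.

Lemma upd_id (T : finType) (W : Type) (x : {ffun T -> W}) t : upd x t (x t) = x.
Proof. by apply/ffunP => z; rewrite ffunE; case: eqP => [->|]. Qed.

Lemma ev_zeroO s (x : {ffun O -> A}) y o : x o = 0 -> phi s x y = 0.
Proof.
move=> xo; rewrite -[x](upd_id _ o) xo.
have := ev_linO s x y o (-1) 0 0; rewrite scaler0 addr0 => {1}->.
by rewrite mulN1r addNr.
Qed.

Lemma ev_zeroC s x (y : {ffun C -> B}) c : y c = 0 -> phi s x y = 0.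
Proof.
move=> yc; rewrite -[y](upd_id _ c) yc.
have := ev_linC s x y c (-1) 0 0; rewrite scaler0 addr0 => {1}->.
by rewrite mulN1r addNr.
Qed.

End Theory.

Section Relabel.
Variables (O O' C C' : finType) (f : O -> O') (f' : O' -> O) (g : C -> C') (g' : C' -> C).
Hypotheses (fK : cancel f f') (f'K : cancel f' f) (gK : cancel g g') (g'K : cancel g' g).

Definition sum_map (T T' U U' : Type) (h : T -> T') (k : U -> U') (z : T + U) : T' + U' :=
  match z with inl t => inl (h t) | inr u => inr (k u) end.

Lemma sum_mapK : cancel (sum_map f g) (sum_map f' g').
Proof. by case=> a /=; rewrite ?fK ?gK. Qed.
Lemma sum_map'K : cancel (sum_map f' g') (sum_map f g).
Proof. by case=> a /=; rewrite ?f'K ?g'K. Qed.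

Lemma sum_map_bij : bijective (sum_map f g).
Proof. by exists (sum_map f' g'); [apply: sum_mapK|apply: sum_map'K]. Qed.

Lemma relabel_ordP (s : ordering (O' + C')%type) :
  perm_eq (map (sum_map f' g') (val s)) (enum {: O + C}).
Proof.
apply: orderingP => [|i].
  by rewrite map_inj_uniq ?ordering_uniq //; apply: can_inj sum_map'K.
by rewrite -[i]sum_mapK map_f // mem_ordering.
Qed.

Definition relabel_ord s : ordering (O + C)%type := mk_ordering (relabel_ordP s).

Definition endo_relabel_ev (phi : endo O C) (s : ordering (O' + C')%type)
    (x : {ffun O' -> A}) (y : {ffun C' -> B}) : K :=
  phi (relabel_ord s) [ffun o => x (f o)] [ffun c => y (g c)].

Variable phi : endo O C.

Lemma endo_relabel_linO s x y o k a a' :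
  endo_relabel_ev phi s (upd x o (k *: a + a')) y =
  k * endo_relabel_ev phi s (upd x o a) y + endo_relabel_ev phi s (upd x o a') y.
Proof. rewrite /endo_relabel_ev.
have E c : [ffun z => upd x o c (f z)] = upd [ffun z => x (f z)] (f' o) c.
  by apply/ffunP => z; rewrite !ffunE -(can2_eq fK f'K).
by rewrite !E ev_linO.
Qed.

Lemma endo_relabel_linC s x y o k b b' :
  endo_relabel_ev phi s x (upd y o (k *: b + b')) =
  k * endo_relabel_ev phi s x (upd y o b) + endo_relabel_ev phi s x (upd y o b').
Proof. rewrite /endo_relabel_ev.
have E c : [ffun z => upd y o c (g z)] = upd [ffun z => y (g z)] (g' o) c.
  by apply/ffunP => z; rewrite !ffunE -(can2_eq gK g'K).
by rewrite !E ev_linC.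
Qed.

Lemma homog_relabel d x y : homog d x y ->
  homog (fun i => d (sum_map f g i)) [ffun o => x (f o)] [ffun c => y (g c)].
Proof. by case=> hx hy; split=> z; rewrite ffunE ?hx ?hy. Qed.

Lemma endo_relabel_sign s t d x y : homog d x y ->
  endo_relabel_ev phi s x y =
  (-1) ^+ koszul (fun i => oddz (d i)) (val s) (val t) * endo_relabel_ev phi t x y.
Proof.
move/homog_relabel => h; rewrite /endo_relabel_ev (ev_sign _ _ (relabel_ord t) h) /=.
rewrite -(koszul_map (fun i => oddz (d i)) _ _ sum_map_bij) !(mapK sum_map'K).
by [].
Qed.

Lemma endo_relabel_deg s d x y : homog d x y -> \sum_i d i != 0 ->
  endo_relabel_ev phi s x y = 0.
Proof.
move/homog_relabel => h d0; apply: ev_deg h _.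
by move: d0; rewrite (reindex (sum_map f g)) //; apply: onW_bij sum_map_bij.
Qed.

Definition endo_relabel : endo O' C' :=
  Endo endo_relabel_linO endo_relabel_linC endo_relabel_sign endo_relabel_deg.

End Relabel.

Section Tensor.
Variables (O1 C1 O2 C2 : finType).
Let I := ((O1 + O2) + (C1 + C2))%type.

Definition left_input (z : I) : option (O1 + C1) :=
  match z with
  | inl (inl o) => Some (inl o) | inr (inl c) => Some (inr c) | _ => None
  end.

Definition right_input (z : I) : option (O2 + C2) :=
  match z with
  | inl (inr o) => Some (inl o) | inr (inr c) => Some (inr c) | _ => None
  end.

Lemma left_ordP (s : ordering I) : perm_eq (pmap left_input (val s)) (enum {: O1 + C1}).
Proof.
have oc : ocancel left_input (sum_map inl inl) by case=> -[].
apply: orderingP; first exact: (pmap_uniq oc) (ordering_uniq s).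
move=> i; rewrite mem_pmap; apply/mapP; exists (sum_map inl inl i) => //.
  exact: mem_ordering.
by case: i.
Qed.

Lemma right_ordP (s : ordering I) : perm_eq (pmap right_input (val s)) (enum {: O2 + C2}).
Proof.
have oc : ocancel right_input (sum_map inr inr) by case=> -[].
apply: orderingP; first exact: (pmap_uniq oc) (ordering_uniq s).
move=> i; rewrite mem_pmap; apply/mapP; exists (sum_map inr inr i) => //.
  exact: mem_ordering.
by case: i.
Qed.

Definition left_ord (s : ordering I) : ordering (O1 + C1)%type := mk_ordering (left_ordP s).
Definition right_ord (s : ordering I) : ordering (O2 + C2)%type := mk_ordering (right_ordP s).

Definition unshuffle (s : ordering I) : seq I :=
  map (sum_map inl inl) (val (left_ord s)) ++ map (sum_map inr inr) (val (right_ord s)).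

Lemma inLR_bij : bijective (fun z : (O1 + C1) + (O2 + C2) =>
   match z with inl a => sum_map inl inl a | inr b => sum_map inr inr b end : I).
Proof.
exists (fun z : I => match z with
  | inl (inl o) => inl (inl o) | inl (inr o) => inr (inl o)
  | inr (inl c) => inl (inr c) | inr (inr c) => inr (inr c) end).
  by do 2!case.
by do 2!case.
Qed.

Lemma unshuffle_ordP s : perm_eq (unshuffle s) (enum {: I}).
Proof.
have [h hK Kh] := inLR_bij.
apply: orderingP => [|i].
  rewrite cat_uniq !map_inj_uniq ?ordering_uniq ?andbT /=.
  - by apply/hasPn => _ /mapP[z _ ->]; apply/mapP => -[[] ? _]; case: z.
  - by move=> [] ? [] ? //= [->].
  - by move=> [] ? [] ? //= [->].
rewrite -[i]Kh; case: (h i) => a; rewrite mem_cat map_f ?orbT //; exact: mem_ordering.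
Qed.

(* phi1 (x) phi2, evaluated in the order s: the Koszul sign for moving the
   inputs of phi1 in front of those of phi2 is computed on each parity
   component of the arguments. *)
Definition endo_tensor_ev (phi1 : endo O1 C1) (phi2 : endo O2 C2) (s : ordering I)
    (x : {ffun O1 + O2 -> A}) (y : {ffun C1 + C2 -> B}) : K :=
  \sum_(p : {ffun I -> bool}) (-1) ^+ koszul p (val s) (unshuffle s) *
    (phi1 (left_ord s)
       [ffun o => parity_part A (p (inl (inl o))) (x (inl o))]
       [ffun c => parity_part B (p (inr (inl c))) (y (inl c))] *
     phi2 (right_ord s)
       [ffun o => parity_part A (p (inl (inr o))) (x (inr o))]
       [ffun c => parity_part B (p (inr (inr c))) (y (inr c))]).

Variables (phi1 : endo O1 C1) (phi2 : endo O2 C2).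

Lemma endo_tensor_linO s x y o k a a' :
  endo_tensor_ev phi1 phi2 s (upd x o (k *: a + a')) y =
  k * endo_tensor_ev phi1 phi2 s (upd x o a) y + endo_tensor_ev phi1 phi2 s (upd x o a') y.
Proof. rewrite /endo_tensor_ev mulr_sumr -big_split /=; apply: eq_bigr => p _.
rewrite [X in _ = X + _]mulrCA -mulrDr; congr (_ * _); case: o => o.
  have E1 c : [ffun z => parity_part A (p (inl (inl z))) (upd x (inl o) c (inl z))]
    = upd [ffun z => parity_part A (p (inl (inl z))) (x (inl z))] o
          (parity_part A (p (inl (inl o))) c).
    apply/ffunP => z; rewrite !ffunE (inj_eq (@inl_inj _ _)).
    by case: eqP => // ->.
  have E2 c : [ffun z => parity_part A (p (inl (inr z))) (upd x (inl o) c (inr z))]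
    = [ffun z => parity_part A (p (inl (inr z))) (x (inr z))].
    by apply/ffunP => z; rewrite !ffunE.
  by rewrite !E1 !E2 linearP ev_linO /= mulrDl mulrA.
have E1 c : [ffun z => parity_part A (p (inl (inr z))) (upd x (inr o) c (inr z))]
  = upd [ffun z => parity_part A (p (inl (inr z))) (x (inr z))] o
        (parity_part A (p (inl (inr o))) c).
  apply/ffunP => z; rewrite !ffunE (inj_eq (@inr_inj _ _)).
  by case: eqP => // ->.
have E2 c : [ffun z => parity_part A (p (inl (inl z))) (upd x (inr o) c (inl z))]
  = [ffun z => parity_part A (p (inl (inl z))) (x (inl z))].
  by apply/ffunP => z; rewrite !ffunE.
by rewrite !E1 !E2 linearP ev_linO /= mulrDr [X in X + _ = _]mulrCA.
Qed.

Lemma endo_tensor_linC s x y o k b b' :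
  endo_tensor_ev phi1 phi2 s x (upd y o (k *: b + b')) =
  k * endo_tensor_ev phi1 phi2 s x (upd y o b) + endo_tensor_ev phi1 phi2 s x (upd y o b').
Proof. rewrite /endo_tensor_ev mulr_sumr -big_split /=; apply: eq_bigr => p _.
rewrite [X in _ = X + _]mulrCA -mulrDr; congr (_ * _); case: o => o.
  have E1 c : [ffun z => parity_part B (p (inr (inl z))) (upd y (inl o) c (inl z))]
    = upd [ffun z => parity_part B (p (inr (inl z))) (y (inl z))] o
          (parity_part B (p (inr (inl o))) c).
    apply/ffunP => z; rewrite !ffunE (inj_eq (@inl_inj _ _)).
    by case: eqP => // ->.
  have E2 c : [ffun z => parity_part B (p (inr (inr z))) (upd y (inl o) c (inr z))]
    = [ffun z => parity_part B (p (inr (inr z))) (y (inr z))].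
    by apply/ffunP => z; rewrite !ffunE.
  by rewrite !E1 !E2 linearP ev_linC /= mulrDl mulrA.
have E1 c : [ffun z => parity_part B (p (inr (inr z))) (upd y (inr o) c (inr z))]
  = upd [ffun z => parity_part B (p (inr (inr z))) (y (inr z))] o
        (parity_part B (p (inr (inr o))) c).
  apply/ffunP => z; rewrite !ffunE (inj_eq (@inr_inj _ _)).
  by case: eqP => // ->.
have E2 c : [ffun z => parity_part B (p (inr (inl z))) (upd y (inr o) c (inl z))]
  = [ffun z => parity_part B (p (inr (inl z))) (y (inl z))].
  by apply/ffunP => z; rewrite !ffunE.
by rewrite !E1 !E2 linearP ev_linC /= mulrDr [X in X + _ = _]mulrCA.
Qed.

Lemma endo_tensor_hom s d x y : homog d x y ->
  endo_tensor_ev phi1 phi2 s x y =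
  (-1) ^+ koszul (fun i => oddz (d i)) (val s) (unshuffle s) *
    (phi1 (left_ord s) [ffun o => x (inl o)] [ffun c => y (inl c)] *
     phi2 (right_ord s) [ffun o => x (inr o)] [ffun c => y (inr c)]).
Proof.
case=> hx hy; pose p0 : {ffun I -> bool} := [ffun i => oddz (d i)].
rewrite /endo_tensor_ev (bigD1 p0) //= big1 ?addr0 => [|p pp0]; last first.
  have [i pi] : exists i, p i != oddz (d i).
    apply/existsP; apply: contraNT pp0; rewrite negb_exists => /forallP h.
    by apply/eqP/ffunP => i; rewrite ffunE; apply/eqP; rewrite -[_ == _]negbK.
  case: i pi => -[] i pi.
  - rewrite (@ev_zeroO _ _ phi1 _ _ _ i) ?mul0r ?mulr0 //.
    by rewrite ffunE (parity_part_hom _ (hx _)) eq_sym (negPf pi).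
  - rewrite (@ev_zeroO _ _ phi2 _ _ _ i) ?mulr0 //.
    by rewrite ffunE (parity_part_hom _ (hx _)) eq_sym (negPf pi).
  - rewrite (@ev_zeroC _ _ phi1 _ _ _ i) ?mul0r ?mulr0 //.
    by rewrite ffunE (parity_part_hom _ (hy _)) eq_sym (negPf pi).
  - rewrite (@ev_zeroC _ _ phi2 _ _ _ i) ?mulr0 //.
    by rewrite ffunE (parity_part_hom _ (hy _)) eq_sym (negPf pi).
congr (_ ^+ _ * (phi1 _ _ _ * phi2 _ _ _)).
- by rewrite !koszulE; do 2!(congr nat_of_bool || apply: eq_bigr => ? _); rewrite ?ffunE //;
    apply: eq_bigr => ? _; rewrite !ffunE.
- by apply/ffunP => o; rewrite !ffunE (parity_part_hom _ (hx _)) eqxx.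
- by apply/ffunP => o; rewrite !ffunE (parity_part_hom _ (hy _)) eqxx.
- by apply/ffunP => o; rewrite !ffunE (parity_part_hom _ (hx _)) eqxx.
- by apply/ffunP => o; rewrite !ffunE (parity_part_hom _ (hy _)) eqxx.
Qed.

Lemma homog_left (d : I -> int) (x : {ffun O1 + O2 -> A}) (y : {ffun C1 + C2 -> B}) :
  homog d x y ->
  homog (fun i => d (sum_map inl inl i)) [ffun o => x (inl o)] [ffun c => y (inl c)].
Proof. by case=> hx hy; split=> z; rewrite ffunE ?hx ?hy. Qed.

Lemma homog_right (d : I -> int) (x : {ffun O1 + O2 -> A}) (y : {ffun C1 + C2 -> B}) :
  homog d x y ->
  homog (fun i => d (sum_map inr inr i)) [ffun o => x (inr o)] [ffun c => y (inr c)].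
Proof. by case=> hx hy; split=> z; rewrite ffunE ?hx ?hy. Qed.

Lemma endo_tensor_sign s t d x y : homog d x y ->
  endo_tensor_ev phi1 phi2 s x y =
  (-1) ^+ koszul (fun i => oddz (d i)) (val s) (val t) * endo_tensor_ev phi1 phi2 t x y.
Proof.
move=> h; rewrite !(endo_tensor_hom _ h).
rewrite (ev_sign _ _ (left_ord t) (homog_left h)) (ev_sign _ _ (right_ord t) (homog_right h)).
set a := phi1 _ _ _; set b := phi2 _ _ _.
rewrite mulrACA !mulrA; congr (_ * _ * _); rewrite -!signr_addb.
congr (_ ^+ _).
have := koszul_cat (fun i => oddz (d i)) (left_ord s) (left_ord t) (right_ord s) (right_ord t) inLR_bij.
rewrite -/(unshuffle s) -/(unshuffle t) -addbA => <-.
have := koszul_cocycle (fun i => oddz (d i)) s (mk_ordering (unshuffle_ordP s)) (mk_ordering (unshuffle_ordP t)).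
have := koszul_cocycle (fun i => oddz (d i)) s t (mk_ordering (unshuffle_ordP t)).
by move=> /= -> ->.
Qed.

Lemma endo_tensor_deg s d x y : homog d x y -> \sum_i d i != 0 ->
  endo_tensor_ev phi1 phi2 s x y = 0.
Proof.
move=> h; rewrite (endo_tensor_hom _ h).
rewrite (reindex _ (onW_bij _ inLR_bij)) big_sumType /=.
have [E1|n1] := eqVneq (\sum_i d (sum_map inl inl i)) 0; last first.
  by move=> _; rewrite (ev_deg _ _ (homog_left h)) // mul0r mulr0.
rewrite E1 add0r => n2.
by rewrite (ev_deg _ _ (homog_right h)) // !mulr0.
Qed.

Definition endo_tensor : endo (O1 + O2)%type (C1 + C2)%type :=
  Endo endo_tensor_linO endo_tensor_linC endo_tensor_sign endo_tensor_deg.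

End Tensor.

Definition without2 (T : finType) (u v : T) : finType := {x : T | (x != u) && (x != v)}.

(* The family with values e at u, e' at v, and w elsewhere. *)
Definition ext2 (T : finType) (W : zmodType) (u v : T) (w : {ffun without2 u v -> W})
    (e e' : W) : {ffun T -> W} :=
  [ffun z => if z == u then e else if z == v then e' else oapp w 0 (insub z)].

Lemma ext2_upd (T : finType) (W : zmodType) (u v : T) (w : {ffun without2 u v -> W})
    e e' z a : ext2 (upd w z a) e e' = upd (ext2 w e e') (val z) a.
Proof.
apply/ffunP => t; rewrite !ffunE.
have /andP[zu zv] := valP z.
case: (t =P u) => [->|tu]; first by rewrite eq_sym (negPf zu).
case: (t =P v) => [->|tv]; first by rewrite eq_sym (negPf zv).
by case: insubP => [t' _ <- /=|]; [rewrite ffunE | rewrite negb_and; move/eqP: tu => ->; move/eqP: tv => ->].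
Qed.

Lemma ext2_in (T : finType) (W : vectType K) (u v : T) (w : {ffun without2 u v -> W})
    e e' (U : T -> {vspace W}) :
  u != v -> (forall z, w z \in U (val z)) -> e \in U u -> e' \in U v ->
  forall t, ext2 w e e' t \in U t.
Proof.
move=> uv wU eU e'U t; rewrite ffunE; case: eqP => [->//|_]; case: eqP => [->//|_].
by case: insubP => [t' _ <- /=|_] //=; rewrite mem0v.
Qed.

Lemma without2_bij (T : finType) (u v : T) : u != v ->
  bijective (fun z : without2 u v + bool =>
    match z with inl a => val a | inr b => if b then v else u end).
Proof.
move=> uv; apply: inj_card_bij.
  case=> [a|a] [b|b].
  - by move=> /val_inj->.
  - by have /andP[au av] := valP a; case: b => E; rewrite E eqxx in au av.
  - by have /andP[au av] := valP b; case: a => E; rewrite -E eqxx in au av.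
  - by case: a b => -[] // E; rewrite E eqxx in uv.
rewrite card_sum card_bool card_sig -(cardC (pred2 u v)) card2 uv addn2 add2n !ltnS.
by apply/eq_leq/eq_card => x; rewrite !inE negb_or.
Qed.

Lemma bool_ordP : perm_eq [:: false; true] (enum {: bool}).
Proof. by apply: orderingP => // -[]. Qed.

Section Contract.
Variables (O C : finType).

Section Open.
Variables (u v : O) (uv : u != v).

Let l : without2 u v + C -> O + C := sum_map val id.
Let r (b : bool) : O + C := inl (if b then v else u).

Lemma octr_bij : bijective (fun z : (without2 u v + C) + bool =>
  match z with inl a => sum_map val id a | inr b => inl (if b then v else u) end : O + C).
Proof.
have [h hK Kh] := without2_bij uv.
exists (fun z : O + C => match z with
  | inl o => match h o with inl a => inl (inl a) | inr b => inr b end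
  | inr c => inl (inr c) end).
  case=> [[a|c]|b] //=.
    by rewrite (hK (inl a)).
  by rewrite (hK (inr b)).
case=> [o|c] //=.
by rewrite -[in RHS](Kh o); case: (h o).
Qed.

Lemma octr_ordP (s : ordering (without2 u v + C)%type) :
  perm_eq (map l (val s) ++ [:: inl u; inl v]) (enum {: O + C}).
Proof.
have [h hK Kh] := octr_bij.
have il : injective l by move=> a b E; have [] := @can_inj _ _ _ _ hK (inl a) (inl b) E.
apply: orderingP => [|i].
  rewrite cat_uniq map_inj_uniq // ordering_uniq /= !inE orbF.
  rewrite (inj_eq (@inl_inj _ _)) uv negb_or ?andbT; apply/andP.
  split; apply/negP => /mapP[[a|a] _ //= [E]]; have /= := valP a; rewrite -E eqxx //.
  by rewrite andbF.
rewrite -[i]Kh; case: (h i) => [a|[]]; rewrite mem_cat ?map_f ?mem_ordering //=;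
  by rewrite !inE eqxx ?orbT.
Qed.

Definition octr_ord s : ordering (O + C)%type := mk_ordering (octr_ordP s).

Definition endo_octr_ev (phi : endo O C) (s : ordering (without2 u v + C)%type)
    (x : {ffun without2 u v -> A}) (y : {ffun C -> B}) : K :=
  \sum_(e <- copairing A) phi (octr_ord s) (ext2 x e.1 e.2) y.

Variable phi : endo O C.

Lemma endo_octr_linO s x y o k a a' :
  endo_octr_ev phi s (upd x o (k *: a + a')) y =
  k * endo_octr_ev phi s (upd x o a) y + endo_octr_ev phi s (upd x o a') y.
Proof.
rewrite /endo_octr_ev mulr_sumr -big_split; apply: eq_bigr => e _ /=.
by rewrite !ext2_upd ev_linO.
Qed.

Lemma endo_octr_linC s x y o k b b' :
  endo_octr_ev phi s x (upd y o (k *: b + b')) =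
  k * endo_octr_ev phi s x (upd y o b) + endo_octr_ev phi s x (upd y o b').
Proof.
rewrite /endo_octr_ev mulr_sumr -big_split; apply: eq_bigr => e _ /=.
by rewrite ev_linC.
Qed.

Lemma endo_octr_hom d x y e : homog d x y -> e \in copairing A ->
  exists D : O + C -> int, [/\ homog D (ext2 x e.1 e.2) y,
    forall i, D (l i) = d i & \sum_i D i = \sum_i d i].
Proof.
move=> [hx hy] /copairing_hom[f [e1 e2]].
have [h hK Kh] := octr_bij.
pose D (i : O + C) := match h i with inl a => d a | inr b => if b then - f else f end.
have Dl i : D (l i) = d i by rewrite /D (hK (inl i)).
have Dr b : D (r b) = if b then - f else f by rewrite /D (hK (inr b)).
exists D; split=> //; last first.
  rewrite (reindex _ (onW_bij _ octr_bij)) big_sumType /=.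
  rewrite [X in _ + X](_ : _ = 0) ?addr0; first by apply: eq_bigr => i _; apply: Dl.
  rewrite big_bool /=.
  by rewrite (Dr true) (Dr false) addNr.
split=> [|c]; last by rewrite (Dl (inr c)).
apply: (ext2_in (U := fun o => hom A (D (inl o))) uv).
- by move=> z; rewrite (Dl (inl z)).
- by rewrite (Dr false).
- by rewrite (Dr true).
Qed.

Lemma endo_octr_sign s t d x y : homog d x y ->
  endo_octr_ev phi s x y =
  (-1) ^+ koszul (fun i => oddz (d i)) (val s) (val t) * endo_octr_ev phi t x y.
Proof.
move=> h; rewrite /endo_octr_ev mulr_sumr !big_seq; apply: eq_bigr => e ein.
have [D [hD Dl _]] := endo_octr_hom h ein.
rewrite (ev_sign _ _ (octr_ord t) hD); congr (_ ^+ nat_of_bool _ * _).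
have := koszul_cat (fun i => oddz (D i)) s t (mk_ordering bool_ordP) (mk_ordering bool_ordP) octr_bij.
rewrite koszul_id addbF /= => ->.
by rewrite !koszulE; apply: eq_bigr => i _; apply: eq_bigr => j _; rewrite !Dl.
Qed.

Lemma endo_octr_deg s d x y : homog d x y -> \sum_i d i != 0 ->
  endo_octr_ev phi s x y = 0.
Proof.
move=> h d0; rewrite /endo_octr_ev big_seq big1 // => e ein.
have [D [hD _ E]] := endo_octr_hom h ein.
by apply: ev_deg hD _; rewrite E.
Qed.

Definition endo_octr : endo (without2 u v) C :=
  Endo endo_octr_linO endo_octr_linC endo_octr_sign endo_octr_deg.

End Open.

Section Closed.
Variables (u v : C) (uv : u != v).

Let l : O + without2 u v -> O + C := sum_map id val.
Let r (b : bool) : O + C := inr (if b then v else u).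

Lemma cctr_bij : bijective (fun z : (O + without2 u v) + bool =>
  match z with inl a => sum_map id val a | inr b => inr (if b then v else u) end : O + C).
Proof.
have [h hK Kh] := without2_bij uv.
exists (fun z : O + C => match z with
  | inr o => match h o with inl a => inl (inr a) | inr b => inr b end
  | inl c => inl (inl c) end).
  case=> [[c|a]|b] //=.
    by rewrite (hK (inl a)).
  by rewrite (hK (inr b)).
case=> [c|o] //=.
by rewrite -[in RHS](Kh o); case: (h o).
Qed.

Lemma cctr_ordP (s : ordering (O + without2 u v)%type) :
  perm_eq (map l (val s) ++ [:: inr u; inr v]) (enum {: O + C}).
Proof.
have [h hK Kh] := cctr_bij.
have il : injective l by move=> a b E; have [] := @can_inj _ _ _ _ hK (inl a) (inl b) E.
apply: orderingP => [|i].
  rewrite cat_uniq map_inj_uniq // ordering_uniq /= !inE orbF.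
  rewrite (inj_eq (@inr_inj _ _)) uv negb_or ?andbT; apply/andP.
  split; apply/negP => /mapP[[a|a] _ //= [E]]; have /= := valP a; rewrite -E eqxx //.
  by rewrite andbF.
rewrite -[i]Kh; case: (h i) => [a|[]]; rewrite mem_cat ?map_f ?mem_ordering //=;
  by rewrite !inE eqxx ?orbT.
Qed.

Definition cctr_ord s : ordering (O + C)%type := mk_ordering (cctr_ordP s).

Definition endo_cctr_ev (phi : endo O C) (s : ordering (O + without2 u v)%type)
    (x : {ffun O -> A}) (y : {ffun without2 u v -> B}) : K :=
  \sum_(e <- copairing B) phi (cctr_ord s) x (ext2 y e.1 e.2).

Variable phi : endo O C.

Lemma endo_cctr_linO s x y o k a a' :
  endo_cctr_ev phi s (upd x o (k *: a + a')) y =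
  k * endo_cctr_ev phi s (upd x o a) y + endo_cctr_ev phi s (upd x o a') y.
Proof.
rewrite /endo_cctr_ev mulr_sumr -big_split; apply: eq_bigr => e _ /=.
by rewrite ev_linO.
Qed.

Lemma endo_cctr_linC s x y o k b b' :
  endo_cctr_ev phi s x (upd y o (k *: b + b')) =
  k * endo_cctr_ev phi s x (upd y o b) + endo_cctr_ev phi s x (upd y o b').
Proof.
rewrite /endo_cctr_ev mulr_sumr -big_split; apply: eq_bigr => e _ /=.
by rewrite !ext2_upd ev_linC.
Qed.

Lemma endo_cctr_hom d x y e : homog d x y -> e \in copairing B ->
  exists D : O + C -> int, [/\ homog D x (ext2 y e.1 e.2),
    forall i, D (l i) = d i & \sum_i D i = \sum_i d i].
Proof.
move=> [hx hy] /copairing_hom[f [e1 e2]].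
have [h hK Kh] := cctr_bij.
pose D (i : O + C) := match h i with inl a => d a | inr b => if b then - f else f end.
have Dl i : D (l i) = d i by rewrite /D (hK (inl i)).
have Dr b : D (r b) = if b then - f else f by rewrite /D (hK (inr b)).
exists D; split=> //; last first.
  rewrite (reindex _ (onW_bij _ cctr_bij)) big_sumType /=.
  rewrite [X in _ + X](_ : _ = 0) ?addr0; first by apply: eq_bigr => i _; apply: Dl.
  rewrite big_bool /=.
  by rewrite (Dr true) (Dr false) addNr.
split=> [o|]; first by rewrite (Dl (inl o)).
apply: (ext2_in (U := fun c => hom B (D (inr c))) uv).
- by move=> z; rewrite (Dl (inr z)).
- by rewrite (Dr false).
- by rewrite (Dr true).
Qed.

Lemma endo_cctr_sign s t d x y : homog d x y ->
  endo_cctr_ev phi s x y =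
  (-1) ^+ koszul (fun i => oddz (d i)) (val s) (val t) * endo_cctr_ev phi t x y.
Proof.
move=> h; rewrite /endo_cctr_ev mulr_sumr !big_seq; apply: eq_bigr => e ein.
have [D [hD Dl _]] := endo_cctr_hom h ein.
rewrite (ev_sign _ _ (cctr_ord t) hD); congr (_ ^+ nat_of_bool _ * _).
have := koszul_cat (fun i => oddz (D i)) s t (mk_ordering bool_ordP) (mk_ordering bool_ordP) cctr_bij.
rewrite koszul_id addbF /= => ->.
by rewrite !koszulE; apply: eq_bigr => i _; apply: eq_bigr => j _; rewrite !Dl.
Qed.

Lemma endo_cctr_deg s d x y : homog d x y -> \sum_i d i != 0 ->
  endo_cctr_ev phi s x y = 0.
Proof.
move=> h d0; rewrite /endo_cctr_ev big_seq big1 // => e ein.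
have [D [hD _ E]] := endo_cctr_hom h ein.
by apply: ev_deg hD _; rewrite E.
Qed.

Definition endo_cctr : endo O (without2 u v) :=
  Endo endo_cctr_linO endo_cctr_linC endo_cctr_sign endo_cctr_deg.

End Closed.
End Contract.
End Endo.

Section CycleSurgery.
Variable T : eqType.
Implicit Types (cs : seq (seq T)) (c : seq T) (u v : T).

Definition cycle_of cs u : seq T := nth [::] cs (find (fun c => u \in c) cs).

(* ((u, o_2, ..., o_n)) |-> (o_2, ..., o_n) *)
Definition open_at c u : seq T := behead (rot (index u c) c).

Definition same_cycle cs u v : bool := has (fun c => (u \in c) && (v \in c)) cs.

(* Cuts the cycle through u and v if there is one, else merges the cycle through
   u with the cycle through v. *)
Definition contract_cycles cs u v : seq (seq T) :=
  let p := open_at (cycle_of cs u) u in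
  let others := [seq c <- cs | (u \notin c) && (v \notin c)] in
  if same_cycle cs u v
  then take (index v p) p :: drop (index v p).+1 p :: others
  else (p ++ open_at (cycle_of cs v) v) :: others.

Lemma perm_open_at c u : u \in c -> perm_eq c (u :: open_at c u).
Proof.
move=> uc; rewrite -(perm_rot (index u c)) /open_at /rot.
by rewrite (drop_nth u) ?index_mem // nth_index.
Qed.

Lemma cycle_ofP cs u : u \in flatten cs -> u \in cycle_of cs u /\ cycle_of cs u \in cs.
Proof.
move=> /flattenP[c cin uc].
have h : has (fun c => u \in c) cs by apply/hasP; exists c.
by split; [apply: (nth_find [::] h)|apply: mem_nth; rewrite -has_find].
Qed.

Lemma filter_notin cs u : u \notin flatten cs -> [seq c <- cs | u \notin c] = cs.
Proof.
move=> nu; apply/all_filterP/allP => c cin; apply: contra nu => uc.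
by apply/flattenP; exists c.
Qed.

Lemma perm_cycle_of cs u : uniq (flatten cs) -> u \in flatten cs ->
  perm_eq cs (cycle_of cs u :: [seq c <- cs | u \notin c]).
Proof.
elim: cs => //= c cs IH; rewrite cat_uniq mem_cat => /and3P[_ /hasPn dis ucs].
rewrite /cycle_of /=; case: ifP => [uc _|nuc /= ufl].
  rewrite /= filter_notin //; apply/negP => ucs'.
  by have := dis _ ucs'; rewrite /= uc.
have := IH ucs ufl; rewrite -(perm_cons c) => /perm_trans; apply.
exact/permPl/(perm_catCA [:: c] [:: _]).
Qed.

Lemma same_cycleE cs u v : uniq (flatten cs) -> u \in flatten cs ->
  same_cycle cs u v = (v \in cycle_of cs u).
Proof.
move=> ucs uin; have [h1 h2] := cycle_ofP uin.
apply/hasP/idP => [[c cin /andP[uc vc]]|vc]; last by exists (cycle_of cs u); rewrite ?h1.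
have := perm_cycle_of ucs uin => /perm_mem/(_ c).
by rewrite cin inE mem_filter uc /= orbF => /esym/eqP <-.
Qed.

Lemma contract_perm cs u v (X := contract_cycles cs u v) :
    u != v -> uniq (flatten cs) -> u \in flatten cs -> v \in flatten cs ->
  perm_eq (flatten cs) (u :: v :: flatten X) /\
  (size X = if same_cycle cs u v then (size cs).+1 else (size cs).-1).
Proof.
move=> uv ucs uin vin; have [uc cin] := cycle_ofP uin; have [vc din] := cycle_ofP vin.
have P1 := perm_cycle_of ucs uin.
have E2 : [seq c <- cs | (u \notin c) && (v \notin c)] =
          [seq c <- [seq c <- cs | u \notin c] | v \notin c].
  by rewrite -filter_predI; apply: eq_filter => c /=; rewrite andbC.
have U1 : uniq (cycle_of cs u ++ flatten [seq c <- cs | u \notin c]).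
  by rewrite -(perm_uniq (perm_flatten P1)).
rewrite /X /contract_cycles same_cycleE //; case: ifPn => vcu.
  have E3 : [seq c <- cs | (u \notin c) && (v \notin c)] = [seq c <- cs | u \notin c].
    rewrite E2 filter_notin //; move: U1; rewrite cat_uniq => /and3P[_ /hasPn dis _].
    by apply/negP => /dis; rewrite /= vcu.
  rewrite E3 (perm_size P1) /=; split=> //.
  apply: (perm_trans (perm_flatten P1)) => /=; rewrite catA -!cat_cons perm_cat2r.
  apply: (perm_trans (perm_open_at uc)); rewrite perm_cons.
  set p := open_at _ _.
  have vp : v \in p.
    by move: vcu; rewrite (perm_mem (perm_open_at uc)) inE eq_sym (negPf uv).
  rewrite -{1}(cat_take_drop (index v p) p) (drop_nth v) ?index_mem // nth_index //.
  exact/permPl/(perm_catCA _ [:: v]).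
have v1 : v \in flatten [seq c <- cs | u \notin c].
  by move: vin; rewrite (perm_mem (perm_flatten P1)) /= mem_cat (negPf vcu).
have uni1 : uniq (flatten [seq c <- cs | u \notin c]).
  by move: U1; rewrite cat_uniq => /and3P[].
have [vc1 din1] := cycle_ofP v1.
have P2 := perm_cycle_of uni1 v1.
have Ec : cycle_of [seq c <- cs | u \notin c] v = cycle_of cs v.
  move: din1; rewrite mem_filter => /andP[_ d1].
  have /perm_mem/(_ (cycle_of [seq c <- cs | u \notin c] v)) := perm_cycle_of ucs vin.
  by rewrite d1 inE mem_filter vc1 /= orbF => /esym/eqP.
rewrite E2 (perm_size P1) /= (perm_size P2) /=; split=> //.
apply: (perm_trans (perm_flatten P1)) => /=.
have := perm_flatten P2; rewrite /= Ec => {}P2.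
apply: (@perm_trans _ (cycle_of cs u ++ cycle_of cs v ++
   flatten [seq c <- [seq c <- cs | u \notin c] | v \notin c])).
  by rewrite perm_cat2l.
rewrite catA -!cat_cons perm_cat2r.
apply: (@perm_trans _ ((u :: open_at (cycle_of cs u) u) ++ (v :: open_at (cycle_of cs v) v))).
  by apply: perm_cat; apply: perm_open_at.
by rewrite cat_cons perm_cons; apply/permPl/(perm_catCA _ [:: v]).
Qed.

End CycleSurgery.

(* A multicycle, presented by a list of its cycles, each presented by one of
   its total orders.  Two presentations of the same multicycle are related by
   an isomorphism over the identity of O, so functors on presentations and
   their natural transformations are those on multicycles. *)
Record multicycle (O : finType) := Multicycle {
  cycles :> seq (seq O);
  _ : perm_eq (flatten cycles) (enum O) }.

Lemma multicycleP (O : finType) (M : multicycle O) : perm_eq (flatten M) (enum O).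
Proof. by case: M. Qed.

Record bijection (T T' : Type) := Bijection {
  bfun :> T -> T';
  binv : T' -> T;
  bfunK : cancel bfun binv;
  binvK : cancel binv bfun }.

Record mc_iso (O O' : finType) (M : multicycle O) (M' : multicycle O') := McIso {
  iso_elt :> bijection O O';
  iso_cyc : bijection 'I_(size M) 'I_(size M');
  _ : forall i, exists k,
        nth [::] M' (iso_cyc i) = rot k (map iso_elt (nth [::] M i)) }.

Section McOps.

Lemma mc_union_subproof (O1 O2 : finType) (M1 : multicycle O1) (M2 : multicycle O2) :
  perm_eq (flatten (map (map inl) M1 ++ map (map inr) M2)) (enum {: O1 + O2}).
Proof.
rewrite flatten_cat -!map_flatten; apply: orderingP => [|[z|z]].
- rewrite cat_uniq !map_inj_uniq; try by move=> ? ? [].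
  rewrite (perm_uniq (multicycleP M1)) (perm_uniq (multicycleP M2)) !enum_uniq andbT /=.
  by apply/hasPn => _ /mapP[z _ ->]; apply/negP => /mapP[].
- by rewrite mem_cat map_f // (perm_mem (multicycleP M1)) mem_enum.
- by rewrite mem_cat orbC map_f // (perm_mem (multicycleP M2)) mem_enum.
Qed.

Definition mc_union (O1 O2 : finType) (M1 : multicycle O1) (M2 : multicycle O2) :
  multicycle (O1 + O2)%type := Multicycle (mc_union_subproof M1 M2).

Variables (O : finType) (u v : O) (uv : u != v) (M : multicycle O).

Lemma mc_contractP :
  perm_eq (flatten M) (u :: v :: flatten (contract_cycles M u v)) /\
  (size (contract_cycles M u v) =
     if same_cycle M u v then (size M).+1 else (size M).-1).
Proof.
by apply: contract_perm; rewrite ?(perm_mem (multicycleP M)) ?mem_enum //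
  (perm_uniq (multicycleP M)) enum_uniq.
Qed.

Lemma mc_contract_subproof :
  perm_eq (flatten (map (pmap insub) (contract_cycles M u v))) (enum (without2 u v)).
Proof.
have -> cs : flatten (map (pmap insub) cs) = pmap insub (flatten cs) :> seq (without2 u v).
  by elim: cs => //= c cs ->; rewrite pmap_cat.
have [P _] := mc_contractP.
have : uniq (u :: v :: flatten (contract_cycles M u v)).
  by rewrite -(perm_uniq P) (perm_uniq (multicycleP M)) enum_uniq.
move=> /= /and3P[_ _ U].
apply: orderingP => [|z]; first exact: pmap_sub_uniq.
rewrite mem_pmap_sub; have := mem_enum O (val z).
rewrite -(perm_mem (multicycleP M)) (perm_mem P) !inE.
by have /andP[/negPf-> /negPf->] := valP z.
Qed.

Definition mc_contract : multicycle (without2 u v) := Multicycle mc_contract_subproof.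

End McOps.

Lemma inl_neq_inr (O1 O2 : finType) (u : O1) (v : O2) : inl u != inr v.
Proof. by []. Qed.

(* Merging at u, v is the contraction of the disjoint union: u and v lie there in
   different cycles. *)
Definition mc_merge (O1 O2 : finType) (M1 : multicycle O1) (M2 : multicycle O2)
    (u : O1) (v : O2) : multicycle (without2 (inl u) (inr v)) :=
  mc_contract (inl_neq_inr u v) (mc_union M1 M2).

(* The data of a modular hybrid; the axioms relating the operations play no
   role in the notion of morphism.  The operadic genus G in (1/2)N is
   represented by n = 2G.  The sets of inputs remaining after u and v are used up
   are disjoint sums with u and v removed. *)
Record modular_hybrid_data := ModularHybrid {
  hcomp :> forall O : finType, multicycle O -> finType -> nat -> Type;
  hrelabel : forall (O O' : finType) (M : multicycle O) (M' : multicycle O')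
    (C C' : finType) n,
    mc_iso M M' -> bijection C C' -> hcomp M C n -> hcomp M' C' n;
  ocomp : forall (O1 O2 : finType) (M1 : multicycle O1) (M2 : multicycle O2)
    (C1 C2 : finType) n1 n2 (u : O1) (v : O2),
    hcomp M1 C1 n1 -> hcomp M2 C2 n2 ->
    hcomp (mc_merge M1 M2 u v) (C1 + C2)%type (n1 + n2)%N;
  ccomp : forall (O1 O2 : finType) (M1 : multicycle O1) (M2 : multicycle O2)
    (C1 C2 : finType) n1 n2 (u : C1) (v : C2),
    hcomp M1 C1 n1 -> hcomp M2 C2 n2 ->
    hcomp (mc_union M1 M2) (without2 (inl u : C1 + C2) (inr v)) (n1 + n2)%N;
  octr : forall (O : finType) (M : multicycle O) (C : finType) n
    (u v : O) (uv : u != v),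
    hcomp M C n -> hcomp (mc_contract uv M) C (n + 2)%N;
  cctr : forall (O : finType) (M : multicycle O) (C : finType) n
    (u v : C) (uv : u != v),
    hcomp M C n -> hcomp M (without2 u v) (n + 2)%N }.

Record hybrid_morphism (H H' : modular_hybrid_data) := HybridMorphism {
  hmap :> forall (O : finType) (M : multicycle O) (C : finType) n,
    H O M C n -> H' O M C n;
  _ : forall (O O' : finType) (M : multicycle O) (M' : multicycle O') (C C' : finType) n (f : mc_iso M M') (g : bijection C C')
        (x : H O M C n),
      hmap (hrelabel f g x) = hrelabel f g (hmap x);
  _ : forall (O1 O2 : finType) (M1 : multicycle O1) (M2 : multicycle O2)
        (C1 C2 : finType) n1 n2 (u : O1) (v : O2)
        (x : H O1 M1 C1 n1) (y : H O2 M2 C2 n2),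
      hmap (ocomp u v x y) = ocomp u v (hmap x) (hmap y);
  _ : forall (O1 O2 : finType) (M1 : multicycle O1) (M2 : multicycle O2)
        (C1 C2 : finType) n1 n2 (u : C1) (v : C2)
        (x : H O1 M1 C1 n1) (y : H O2 M2 C2 n2),
      hmap (ccomp u v x y) = ccomp u v (hmap x) (hmap y);
  _ : forall (O : finType) (M : multicycle O) (C : finType) n (u v : O) (uv : u != v) (x : H O M C n),
      hmap (octr uv x) = octr uv (hmap x);
  _ : forall (O : finType) (M : multicycle O) (C : finType) n (u v : C) (uv : u != v) (x : H O M C n),
      hmap (cctr uv x) = cctr uv (hmap x) }.

Section Generated.
Variables (H : modular_hybrid_data)
  (P : forall (O : finType) (M : multicycle O) (C : finType) n, H O M C n -> Prop).

(* The smallest subhybrid containing P. *)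
Inductive generated :
  forall (O : finType) (M : multicycle O) (C : finType) n, H O M C n -> Prop :=
| gen_base (O : finType) (M : multicycle O) (C : finType) n (x : H O M C n) : P x -> generated x
| gen_relabel (O O' : finType) (M : multicycle O) (M' : multicycle O') (C C' : finType) n (f : mc_iso M M') (g : bijection C C')
    (x : H O M C n) : generated x -> generated (hrelabel f g x)
| gen_ocomp (O1 O2 : finType) (M1 : multicycle O1) (M2 : multicycle O2)
    (C1 C2 : finType) n1 n2 (u : O1) (v : O2)
    (x : H O1 M1 C1 n1) (y : H O2 M2 C2 n2) :
    generated x -> generated y -> generated (ocomp u v x y)
| gen_ccomp (O1 O2 : finType) (M1 : multicycle O1) (M2 : multicycle O2)
    (C1 C2 : finType) n1 n2 (u : C1) (v : C2)
    (x : H O1 M1 C1 n1) (y : H O2 M2 C2 n2) :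
    generated x -> generated y -> generated (ccomp u v x y)
| gen_octr (O : finType) (M : multicycle O) (C : finType) n (u v : O) (uv : u != v) (x : H O M C n) :
    generated x -> generated (octr uv x)
| gen_cctr (O : finType) (M : multicycle O) (C : finType) n (u v : C) (uv : u != v) (x : H O M C n) :
    generated x -> generated (cctr uv x).

Definition generated_subhybrid : modular_hybrid_data :=
  @ModularHybrid (fun O M C n => {x : H O M C n | generated x})
    (fun O O' M M' C C' n f g x =>
       exist _ (hrelabel f g (sval x)) (gen_relabel f g (svalP x)))
    (fun O1 O2 M1 M2 C1 C2 n1 n2 u v x y =>
       exist _ (ocomp u v (sval x) (sval y)) (gen_ocomp u v (svalP x) (svalP y)))
    (fun O1 O2 M1 M2 C1 C2 n1 n2 u v x y =>
       exist _ (ccomp u v (sval x) (sval y)) (gen_ccomp u v (svalP x) (svalP y)))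
    (fun O M C n u v uv x => exist _ (octr uv (sval x)) (gen_octr uv (svalP x)))
    (fun O M C n u v uv x => exist _ (cctr uv (sval x)) (gen_cctr uv (svalP x))).

End Generated.

(* G = 2g + b - 1 + |C|/2, in terms of n = 2G *)
Definition genus_eq (b c n g : nat) : bool := (n + 2 == 4 * g + 2 * b + c)%N.

(* The element [M; g; C] is represented by g. *)
Definition qoc (O : finType) (M : multicycle O) (C : finType) (n : nat) : Type :=
  {g : nat | genus_eq (size M) #|C| n g}.

Section Qoc.

Lemma genus_merge b1 b2 c1 c2 n1 n2 g1 g2 : (0 < b1)%N ->
  genus_eq b1 c1 n1 g1 -> genus_eq b2 c2 n2 g2 ->
  genus_eq (b1 + b2).-1 (c1 + c2) (n1 + n2) (g1 + g2).
Proof. by rewrite /genus_eq => b0 /eqP E1 /eqP E2; apply/eqP; lia. Qed.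

Lemma genus_union b1 b2 c1 c2 c n1 n2 g1 g2 : (c1 + c2)%N = c.+2 ->
  genus_eq b1 c1 n1 g1 -> genus_eq b2 c2 n2 g2 ->
  genus_eq (b1 + b2) c (n1 + n2) (g1 + g2).
Proof. by rewrite /genus_eq => Ec /eqP E1 /eqP E2; apply/eqP; lia. Qed.

Lemma genus_contract (same : bool) b c n g : (0 < b)%N -> genus_eq b c n g ->
  genus_eq (if same then b.+1 else b.-1) c (n + 2) (if same then g else g.+1).
Proof. by rewrite /genus_eq => b0 /eqP E; apply/eqP; case: same; lia. Qed.

Lemma genus_contract_closed b c n g : genus_eq b c.+2 n g -> genus_eq b c (n + 2) g.+1.
Proof. by rewrite /genus_eq => /eqP E; apply/eqP; lia. Qed.

Lemma size_mc_contract (O : finType) (u v : O) (uv : u != v) (M : multicycle O) :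
  size (mc_contract uv M) = if same_cycle M u v then (size M).+1 else (size M).-1.
Proof. by rewrite /= size_map; case: (mc_contractP uv M). Qed.

Lemma card_without2 (T : finType) (u v : T) : u != v -> #|T| = #|without2 u v|.+2.
Proof.
move=> uv; rewrite card_sig -(cardC (pred2 u v)) card2 uv.
by congr _.+2; apply: eq_card => x; rewrite !inE negb_or.
Qed.

Lemma card_bijection (T T' : finType) (f : bijection T T') : #|T| = #|T'|.
Proof. by apply: bij_eq_card; exists (binv f); [apply: bfunK|apply: binvK]. Qed.

Lemma same_cycle_union (O1 O2 : finType) (M1 : multicycle O1) (M2 : multicycle O2) u v :
  same_cycle (mc_union M1 M2) (inl u) (inr v) = false.
Proof.
apply/hasP => -[c]; rewrite mem_cat => /orP[] /mapP[d _ ->] /andP[].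
  by move=> _ /mapP[].
by move=> /mapP[].
Qed.

Lemma size_gt0 (O : finType) (M : multicycle O) (u : O) : (0 < size M)%N.
Proof.
have : u \in flatten M by rewrite (perm_mem (multicycleP M)) mem_enum.
by case: (cycles M).
Qed.

Lemma qoc_relabel_subproof (O O' : finType) (M : multicycle O) (M' : multicycle O')
    (C C' : finType) n (f : mc_iso M M') (g : bijection C C') (x : qoc M C n) :
  genus_eq (size M') #|C'| n (sval x).
Proof.
rewrite -(card_bijection g).
have := card_bijection (iso_cyc f); rewrite !card_ord => <-; exact: svalP x.
Qed.

Lemma qoc_ocomp_subproof (O1 O2 : finType) (M1 : multicycle O1) (M2 : multicycle O2)
    (C1 C2 : finType) n1 n2 (u : O1) (v : O2) (x : qoc M1 C1 n1) (y : qoc M2 C2 n2) :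
  genus_eq (size (mc_merge M1 M2 u v)) #|{: C1 + C2}| (n1 + n2) (sval x + sval y).
Proof.
rewrite size_mc_contract same_cycle_union /= size_cat !size_map card_sum.
exact: genus_merge (size_gt0 M1 u) (svalP x) (svalP y).
Qed.

Lemma qoc_ccomp_subproof (O1 O2 : finType) (M1 : multicycle O1) (M2 : multicycle O2)
    (C1 C2 : finType) n1 n2 (u : C1) (v : C2) (x : qoc M1 C1 n1) (y : qoc M2 C2 n2) :
  genus_eq (size (mc_union M1 M2)) #|without2 (inl u : C1 + C2) (inr v)|
    (n1 + n2) (sval x + sval y).
Proof.
have := card_without2 (inl_neq_inr u v); rewrite card_sum /= size_cat !size_map => Ec.
exact: genus_union Ec (svalP x) (svalP y).
Qed.

Lemma qoc_octr_subproof (O : finType) (M : multicycle O) (C : finType) n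
    (u v : O) (uv : u != v) (x : qoc M C n) :
  genus_eq (size (mc_contract uv M)) #|C| (n + 2)
    (if same_cycle M u v then sval x else (sval x).+1).
Proof.
rewrite size_mc_contract; exact: genus_contract (size_gt0 M u) (svalP x).
Qed.

Lemma qoc_cctr_subproof (O : finType) (M : multicycle O) (C : finType) n
    (u v : C) (uv : u != v) (x : qoc M C n) :
  genus_eq (size M) #|without2 u v| (n + 2) (sval x).+1.
Proof.
by apply: genus_contract_closed; rewrite -card_without2 //; exact: svalP x.
Qed.

Definition Qoc (O : finType) (M : multicycle O) (C : finType) n g
  (h : genus_eq (size M) #|C| n g) : qoc M C n :=
  exist (fun g => is_true (genus_eq (size M) #|C| n g)) g h.

Definition QOC : modular_hybrid_data := @ModularHybrid qoc
  (fun O O' M M' C C' n f g x => Qoc (qoc_relabel_subproof f g x))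
  (fun O1 O2 M1 M2 C1 C2 n1 n2 u v x y => Qoc (qoc_ocomp_subproof u v x y))
  (fun O1 O2 M1 M2 C1 C2 n1 n2 u v x y => Qoc (qoc_ccomp_subproof u v x y))
  (fun O M C n u v uv x => Qoc (qoc_octr_subproof uv x))
  (fun O M C n u v uv x => Qoc (qoc_cctr_subproof uv x)).

(* 2(G - 1) + |O| + |C| > 0, in terms of n = 2G *)
Definition stable (o c n : nat) : bool := (2 < n + o + c)%N.

(* [(())...(()); 0; {}] with b >= 3, [(())...(()) o; 0; {}] with b >= 2 and o
   nonempty, and [(())...(()); 0; {d}] with b >= 2. *)
Definition KP_discarded (O : finType) (M : multicycle O) (C : finType) : bool :=
  let b := size M in
  let nonempty := count (fun c => ~~ nilp c) M in
  [|| [&& nonempty == 0, 3 <= b & #|C| == 0],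
      [&& nonempty == 1, 2 <= b & #|C| == 0]
    | [&& nonempty == 0, 2 <= b & #|C| == 1]]%N.

Definition OC_KP (O : finType) (M : multicycle O) (C : finType) n (x : qoc M C n) : Prop :=
  [&& sval x == 0%N, stable #|O| #|C| n & ~~ KP_discarded M C].

Definition QOC_KP : modular_hybrid_data := generated_subhybrid (H := QOC) OC_KP.

End Qoc.

Section Algebras.
Variables (K : fieldType) (A B : form_space K).

Definition End_hybrid : modular_hybrid_data := @ModularHybrid
  (fun O M C n => endo A B O C)
  (fun O O' M M' C C' n f g x => endo_relabel (bfunK f) (binvK f) (bfunK g) (binvK g) x)
  (fun O1 O2 M1 M2 C1 C2 n1 n2 u v x y =>
     endo_octr (inl_neq_inr u v) (endo_tensor x y))
  (fun O1 O2 M1 M2 C1 C2 n1 n2 u v x y =>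
     endo_cctr (inl_neq_inr u v) (endo_tensor x y))
  (fun O M C n u v uv x => endo_octr uv x)
  (fun O M C n u v uv x => endo_cctr uv x).

Definition KP_algebra : Type := hybrid_morphism QOC_KP End_hybrid.

Definition is_frobenius (V : form_space K) (mu : 'Hom(V, 'Hom(V, V))) : Prop :=
  [/\ forall d e a b, a \in hom V d -> b \in hom V e -> mu a b \in hom V (d + e),
      forall a b c, mu (mu a b) c = mu a (mu b c)
    & forall d1 d2 d3 a1 a2 a3,
        a1 \in hom V d1 -> a2 \in hom V d2 -> a3 \in hom V d3 ->
        form V (mu a1 a2) a3 =
        (-1) ^+ (oddz d1 && oddz (d2 + d3)) * form V (mu a2 a3) a1].

(* Invariance under the transpositions (1 2) and (2 3), which generate S_3. *)
Definition is_commutative_frobenius (V : form_space K) (mu : 'Hom(V, 'Hom(V, V))) : Prop :=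
  is_frobenius mu /\
  forall d1 d2 d3 a1 a2 a3,
    a1 \in hom V d1 -> a2 \in hom V d2 -> a3 \in hom V d3 ->
    form V (mu a1 a2) a3 = (-1) ^+ (oddz d1 && oddz d2) * form V (mu a2 a1) a3 /\
    form V (mu a1 a2) a3 = (-1) ^+ (oddz d2 && oddz d3) * form V (mu a1 a3) a2.

Definition is_central_morphism (mu : 'Hom(A, 'Hom(A, A))) (omega : 'Hom(B, 'Hom(B, B)))
    (f : 'Hom(B, A)) : Prop :=
  [/\ forall d b, b \in hom B d -> f b \in hom A d,
      forall b c, f (omega b c) = mu (f b) (f c)
    & forall d e b a, b \in hom B d -> a \in hom A e ->
        mu (f b) a = (-1) ^+ (oddz d && oddz e) *: mu a (f b)].

(* Both sides evaluated on a (x) b with b of degree d; koszul_scale A d e.1 is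
   e.1 with the sign of its exchange with b. *)
Definition cardy_condition (mu : 'Hom(A, 'Hom(A, A))) (f : 'Hom(B, A)) : Prop :=
  forall d a b, b \in hom A d ->
    \sum_(e <- copairing A) form A (mu a (koszul_scale A d e.1)) (mu b e.2) =
    \sum_(c <- copairing B) form A a (f c.1) * form A (f c.2) b.

Record cardy_frobenius := CardyFrobenius {
  mulA : 'Hom(A, 'Hom(A, A));
  mulB : 'Hom(B, 'Hom(B, B));
  mapBA : 'Hom(B, A);
  _ : is_frobenius mulA;
  _ : is_commutative_frobenius mulB;
  _ : is_central_morphism mulA mulB mapBA;
  _ : cardy_condition mulA mapBA }.

End Algebras.

Section Generators.

Lemma mc3_subproof : perm_eq (flatten [:: [:: 0; 1; 2 : 'I_3]]) (enum 'I_3).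
Proof. by apply: orderingP => // -[[|[|[|]]]]. Qed.

(* ((p q r)) *)
Definition mc3 : multicycle 'I_3 := Multicycle mc3_subproof.

Lemma mc1_subproof : perm_eq (flatten [:: [:: tt]]) (enum {: unit}).
Proof. by apply: orderingP => // -[]. Qed.

(* ((p)) *)
Definition mc1 : multicycle unit := Multicycle mc1_subproof.

Lemma mc0_subproof : perm_eq (flatten [::]) (enum {: void}).
Proof. by apply: orderingP. Qed.

Definition mc0 : multicycle void := Multicycle mc0_subproof.

Lemma gen_open_subproof : genus_eq (size mc3) #|{: void}| 0 0.
Proof. by rewrite card_void. Qed.
Lemma gen_closed_subproof : genus_eq (size mc0) #|'I_3| 1 0.
Proof. by rewrite card_ord. Qed.
Lemma gen_mixed_subproof : genus_eq (size mc1) #|{: unit}| 1 0.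
Proof. by rewrite card_unit. Qed.

Lemma gen_open_KP : OC_KP (Qoc gen_open_subproof).
Proof. by rewrite /OC_KP /= /stable /KP_discarded card_ord card_void. Qed.
Lemma gen_closed_KP : OC_KP (Qoc gen_closed_subproof).
Proof. by rewrite /OC_KP /= /stable /KP_discarded card_ord card_void. Qed.
Lemma gen_mixed_KP : OC_KP (Qoc gen_mixed_subproof).
Proof. by rewrite /OC_KP /= /stable /KP_discarded card_unit. Qed.

(* [((pqr)); 0; {}] *)
Definition gen_open : QOC_KP _ mc3 void 0%N := exist _ _ (gen_base (H := QOC) gen_open_KP).
(* [trivial; 0; {d, e, f}] *)
Definition gen_closed : QOC_KP _ mc0 'I_3 1%N := exist _ _ (gen_base (H := QOC) gen_closed_KP).
(* [((p)); 0; {d}] *)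
Definition gen_mixed : QOC_KP _ mc1 unit 1%N := exist _ _ (gen_base (H := QOC) gen_mixed_KP).

Lemma ord_open_subproof : perm_eq [:: inl 0; inl 1; inl 2] (enum {: 'I_3 + void}).
Proof. by apply: orderingP => // -[[[|[|[|]]]]|[]]. Qed.
Lemma ord_closed_subproof : perm_eq [:: inr 0; inr 1; inr 2] (enum {: void + 'I_3}).
Proof. by apply: orderingP => // -[[]|[[|[|[|]]]]]. Qed.
Lemma ord_mixed_subproof : perm_eq [:: inl tt; inr tt] (enum {: unit + unit}).
Proof. by apply: orderingP => // -[[]|[]]. Qed.

Definition corresponds (K : fieldType) (A B : form_space K)
    (alpha : KP_algebra A B) (S : cardy_frobenius A B) : Prop :=
  [/\ forall a1 a2 a3 : A,
        form A (mulA S a1 a2) a3 =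
        alpha _ _ _ _ gen_open (mk_ordering ord_open_subproof)
          [ffun i => tnth [tuple a1; a2; a3] i] [ffun=> 0],
      forall b1 b2 b3 : B,
        form B (mulB S b1 b2) b3 =
        alpha _ _ _ _ gen_closed (mk_ordering ord_closed_subproof)
          [ffun=> 0] [ffun i => tnth [tuple b1; b2; b3] i]
    & forall (a : A) (b : B),
        form A a (mapBA S b) =
        alpha _ _ _ _ gen_mixed (mk_ordering ord_mixed_subproof)
          [ffun=> a] [ffun=> b]].

End Generators.

(* Main.v *)
(* An algebra S of the kind (i)-(iii) is evaluated on surfaces as follows.  Words in A
   are multiplied in the unital Frobenius algebra K + A + K; a boundary circle is
   sent by the adjoint f^* to a unital graded commutative algebra K + K eta + B + K + K,
   where eta stands for a circle without open inputs (it acts on B as f^* f, which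
   makes it an element although f^*(1) need not exist).  A surface is the trace of
   the product of its circles, of its closed inputs and of one factor
   beta_B^{-1} per handle.  The Cardy condition is the formula for cutting a circle;
   with the inputs listed in a suitable order no other Koszul signs occur.

   Conversely, all planar surfaces are obtained by gluing from the three
   generators, so an algebra over the hybrid is determined by mu_A, omega_B and f.
   Each axiom of (i)-(iii) compares two decompositions of a planar surface, and the
   Cardy condition those of the annulus with one open input on each boundary. *)

From HB Require Import structures.
From mathcomp Require Import all_boot all_order all_algebra.
From mathcomp Require Import zify ring.
From mathcomp Require Import boolp.
Require Import Defs.

Set Implicit Arguments.
Unset Strict Implicit.
Unset Printing Implicit Defensive.

Import GRing.Theory.
Local Open Scope ring_scope.

(** * Signs and values of multilinear forms *)

(** Two obstacles shape the proof. The first is the absence of units. Circles without open inputs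
    occur, but [A] and [B] need not contain anything to represent them, and a trace on [B] need not
    come from an element. Units and traces are therefore adjoined as coordinates, with structure
    constants dictated by the formal rules that eta is f^*(1) and that f f^*(1) is the Casimir
    element of [A]. A copairing cannot reproduce an adjoined unit, so gluing two surfaces is
    delicate; the discs and spheres on which the unit would be seen are unstable, and this is where
    stability enters.

    The second obstacle is the signs. A form is a family of values, one for each order of the
    inputs. Every identity is tested on homogeneous arguments in a single order, chosen so that each
    remaining sign is one of graded commutativity.

    In the converse direction, a disc with empty boundary and one closed input is unstable. An empty
    circle can thus be split off from a planar surface along a closed curve only together with a
    closed input, which explains why planar surfaces with several circles but too few inputs are
    discarded. *)

Lemma oddzD a b : oddz (a + b) = oddz a (+) oddz b.
Proof. rewrite /oddz; case: a b => [a|a] [b|b]; lia. Qed.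

Lemma oddzN a : oddz (- a) = oddz a.
Proof. by rewrite /oddz abszN. Qed.

Lemma sgnM (R : pzRingType) (a b : bool) (x : R) : (-1) ^+ a * ((-1) ^+ b * x) = (-1) ^+ (a (+) b)
  * x.
Proof. by rewrite mulrA signr_addb. Qed.

Section GradedFacts.
Variables (K : fieldType) (V : graded_space K).

(** The usual passage from homogeneous vectors to all vectors: an additive identity with a sign in
    it can only be stated for homogeneous arguments, and its sign-free consequences are extended by
    this induction. *)
Lemma hom_ind (P : V -> Prop) :
  P 0 -> (forall d a b, a \in hom V d -> P b -> P (a + b)) -> forall a, P a.
Proof.
move=> P0 PD a; rewrite [a]hom_sum_dec.
elim/big_rec: _ => // i x _; apply: PD; exact: memv_sum_pi.
Qed.

Lemma koszul_scaleE d e (v : V) : v \in hom V e ->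
  koszul_scale V d v = (-1) ^+ (oddz d && oddz e) *: v.
Proof. exact: koszul_scale_hom. Qed.

End GradedFacts.

Section FormFacts.
Variables (K : fieldType) (V : form_space K).

Lemma form_deg d e (a b : V) : a \in hom V d -> b \in hom V e -> d + e != 0 -> form V a b = 0.
Proof. by case: V a b => ? ? h ? ? a b /=; apply: h. Qed.

Lemma form_sym d e (a b : V) : a \in hom V d -> b \in hom V e ->
  form V a b = (-1) ^+ (oddz d && oddz e) * form V b a.
Proof. by case: V a b => ? ? ? h ? a b /=; apply: h. Qed.

Lemma form_nd (a : V) : (forall b, form V a b = 0) -> a = 0.
Proof. by case: V a => ? ? ? ? h a; apply: h. Qed.

Lemma form_inj (a b : V) : (forall c, form V a c = form V b c) -> a = b.
Proof.
move=> h; apply/eqP; rewrite -subr_eq0; apply/eqP/form_nd => c.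
by rewrite formDl -scaleN1r formZl h mulN1r subrr.
Qed.

Lemma form_injr (a b : V) : (forall c, form V c a = form V c b) -> a = b.
Proof.
move=> h; rewrite -[a]copairing_snakel -[b]copairing_snakel.
by apply: eq_bigr => e _; rewrite h.
Qed.

End FormFacts.

Section KoszulLists.
Variables (I : finType).
Implicit Types (l : seq I) (p : pred I).

Lemma card_set_count p l : uniq l -> #|[set i in l | p i]| = count p l.
Proof.
move=> ul; rewrite -size_filter -(card_uniqP (filter_uniq p ul)).
by apply: eq_card => i; rewrite !inE mem_filter andbC.
Qed.

(** The pairs whose order is reversed are exactly those with one member in [l1] and the other in
    [l2]; the number of odd ones is a product, whence the conjunction of parities. *)
Lemma koszul_swap p l0 l1 l2 l3 : uniq (l0 ++ l1 ++ l2 ++ l3) ->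
  koszul p (l0 ++ l1 ++ l2 ++ l3) (l0 ++ l2 ++ l1 ++ l3) =
  odd (count p l1) && odd (count p l2).
Proof.
move=> us.
have us' := us; rewrite !cat_uniq in us'.
have u1 : uniq l1 by case/and5P: us'.
have u2 : uniq l2 by case/and5P: us' => _ _ _ _ /andP[].
rewrite /koszul (_ : [set _ | _] = setX [set i in l1 | p i] [set j in l2 | p j]).
  by rewrite cardsX !card_set_count // oddM.
apply/setP => -[i j]; rewrite !inE /=.
(* By uniqueness an entry lies in only one of the four blocks, and its position in either list is
   then an offset plus its index in that block. *)
have loc k : [\/ [/\ k \in l0, k \notin l1, k \notin l2 & k \notin l3],
    [/\ k \notin l0, k \in l1, k \notin l2 & k \notin l3],
    [/\ k \notin l0, k \notin l1, k \in l2 & k \notin l3] |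
    k \notin l0 /\ k \notin l1 /\ k \notin l2].
  have := count_uniq_mem k us; rewrite !count_cat !mem_cat.
  have hc m : (k \in m : nat) = (0 < count_mem k m)%N by rewrite -has_pred1 has_count.
  have := hc l0; have := hc l1; have := hc l2; have := hc l3.
  case: (k \in l0); case: (k \in l1); case: (k \in l2); case: (k \in l3) => /=; try lia;
    by move=> *; first [by apply: Or41 | by apply: Or42 | by apply: Or43 | by apply: Or44].
have lt (m : seq I) k : k \in m -> (index k m < size m)%N by rewrite index_mem.
rewrite /before !index_cat; case: (p i); case: (p j); rewrite ?andbF ?andbT //=.
case: (loc i) => [[a b c e]|[a b c e]|[a b c e]|[a [b c]]];
  rewrite ?(negPf a) ?(negPf b) ?(negPf c) ?a ?b ?c;
  case: (loc j) => [[a' b' c' e']|[a' b' c' e']|[a' b' c' e']|[a' [b' c']]];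
  rewrite ?(negPf a') ?(negPf b') ?(negPf c') ?a' ?b' ?c'; clear us us' u1 u2 loc;
  try (move/lt: a => a); try (move/lt: b => b); try (move/lt: c => c);
  try (move/lt: a' => a'); try (move/lt: b' => b'); try (move/lt: c' => c'); clear lt;
  lia.
Qed.

Lemma koszul_step p (s : ordering I) l0 l1 l2 l3 :
  perm_eq (l0 ++ l1 ++ l2 ++ l3) (enum I) ->
  koszul p (val s) (l0 ++ l1 ++ l2 ++ l3) =
  koszul p (val s) (l0 ++ l2 ++ l1 ++ l3) (+) (odd (count p l1) && odd (count p l2)).
Proof.
move=> pr; have pt : perm_eq (l0 ++ l2 ++ l1 ++ l3) (enum I).
  by apply: perm_trans pr; rewrite perm_cat2l; apply/permPl/perm_catCA.
rewrite -(koszul_cocycle p s (mk_ordering pt) (mk_ordering pr)); congr addb.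
by rewrite koszul_swap 1?andbC // (perm_uniq pt) enum_uniq.
Qed.

Definition dg (d : I -> int) l : int := \sum_(i <- l) d i.

Lemma dg_cat d l1 l2 : dg d (l1 ++ l2) = dg d l1 + dg d l2.
Proof. by rewrite /dg big_cat. Qed.
Lemma dg_cons d i l : dg d (i :: l) = d i + dg d l.
Proof. by rewrite /dg big_cons. Qed.
Lemma dg_nil d : dg d [::] = 0.
Proof. by rewrite /dg big_nil. Qed.

Lemma odd_count d l : odd (count (fun i => oddz (d i)) l) = oddz (dg d l).
Proof.
elim: l => [|i l IH]; first by rewrite dg_nil.
by rewrite dg_cons oddzD -IH /= oddD; case: (oddz (d i)).
Qed.

End KoszulLists.

Lemma dg_map (I J : finType) (f : I -> J) d (l : seq I) : dg d (map f l) = dg (fun i => d (f i)) l.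
Proof. by rewrite /dg big_map. Qed.

Lemma inputs_perm (O C : finType) (cs : seq O) (l : seq C) :
  perm_eq cs (enum O) -> perm_eq l (enum C) ->
  perm_eq (map inl cs ++ map inr l) (enum {: O + C}).
Proof.
move=> pc pl; apply: orderingP => [|[o|c]]; last 2 first.
- by rewrite mem_cat map_f // (perm_mem pc) mem_enum.
- by rewrite mem_cat orbC map_f // (perm_mem pl) mem_enum.
rewrite cat_uniq (map_inj_uniq (@inl_inj _ _)) (map_inj_uniq (@inr_inj _ _)).
rewrite (perm_uniq pc) (perm_uniq pl) !enum_uniq andbT /=.
by apply/hasPn => _ /mapP[c _ ->]; apply/mapP => -[].
Qed.

Section Evl.
Variables (K : fieldType) (A B : form_space K) (O C : finType).
Implicit Types (phi psi : endo A B O C) (l : seq (O + C)).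

(* The value of phi in the order l, or 0 if l does not list all the inputs. *)
Definition evl phi l x y : K :=
  if insub l is Some s then phi s x y else 0.

Lemma evlE phi (s : ordering (O + C)%type) x y : evl phi (val s) x y = phi s x y.
Proof. by rewrite /evl valK. Qed.

Lemma evl_mk phi l (h : perm_eq l (enum {: O + C})) x y :
  phi (mk_ordering h) x y = evl phi l x y.
Proof. by rewrite -evlE. Qed.

Lemma evl_koszul phi (s : ordering (O + C)%type) l d x y :
  homog d x y -> perm_eq l (val s) ->
  phi s x y = (-1) ^+ koszul (fun i => oddz (d i)) (val s) l * evl phi l x y.
Proof.
move=> h pl; have pl' := perm_trans pl (valP s).
by rewrite -(evl_mk _ pl') (ev_sign phi s (mk_ordering pl') h).
Qed.

Lemma evl_swap phi l0 l1 l2 l3 d x y : homog d x y ->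
  evl phi (l0 ++ l1 ++ l2 ++ l3) x y =
  (-1) ^+ (oddz (dg d l1) && oddz (dg d l2)) * evl phi (l0 ++ l2 ++ l1 ++ l3) x y.
Proof.
move=> h; have P : perm_eq (l0 ++ l1 ++ l2 ++ l3) (l0 ++ l2 ++ l1 ++ l3).
  by rewrite perm_cat2l; apply/permPl/perm_catCA.
(* A list that is not an ordering of all inputs gives the default value 0 on both sides. *)
have [p1|np] := boolP (perm_eq (l0 ++ l1 ++ l2 ++ l3) (enum {: O + C})); last first.
  rewrite /evl !insubN ?mulr0 //; apply: contra np; exact: perm_trans.
rewrite -(evl_mk _ p1) (evl_koszul _ h (l := l0 ++ l2 ++ l1 ++ l3)) /=; last by rewrite perm_sym.
by rewrite koszul_swap ?(perm_uniq p1) ?enum_uniq // !odd_count.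
Qed.

Lemma evl_scaleO phi l x y o k a :
  evl phi l (upd x o (k *: a)) y = k * evl phi l (upd x o a) y.
Proof.
rewrite /evl; case: insub => [s|]; last by rewrite mulr0.
have E : phi s (upd x o 0) y = 0 by apply: (ev_zeroO _ _ _ (o := o)); rewrite ffunE eqxx.
by rewrite -[k *: a]addr0 ev_linO E addr0.
Qed.

Lemma endo_ext phi psi : (forall s x y, phi s x y = psi s x y) -> phi = psi.
Proof.
case: phi psi => f f1 f2 f3 f4 [g g1 g2 g3 g4] /= E.
have {}E : f = g by apply/funext => s; apply/funext => x; apply/funext.
by case: g / E g1 g2 g3 g4 => *; congr Endo; apply: Prop_irrelevance.
Qed.

Lemma ev_addO phi s x y o a a' :
  phi s (upd x o (a + a')) y = phi s (upd x o a) y + phi s (upd x o a') y.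
Proof. by rewrite -{1}[a]scale1r ev_linO mul1r. Qed.

Lemma ev_addC phi s x y c b b' :
  phi s x (upd y c (b + b')) = phi s x (upd y c b) + phi s x (upd y c b').
Proof. by rewrite -{1}[b]scale1r ev_linC mul1r. Qed.

(** Multilinearity allows the arguments to be decomposed into homogeneous ones slot by slot, first
    the open and then the closed inputs. *)
Lemma ev_homog_ext phi psi s :
  (forall d x y, homog d x y -> phi s x y = psi s x y) ->
  forall x y, phi s x y = psi s x y.
Proof.
move=> H x y.
(* The list [l] contains the slots that may still hold inhomogeneous vectors; each induction step
   decomposes one of them. When it is empty, [choice] collects the degrees into a function. *)
have H1 (l : seq O) : forall (x : {ffun O -> A}) (y : {ffun C -> B}), (forall o, o \notin l ->
  exists d, x o \in hom A d) ->
    (forall c, exists d, y c \in hom B d) -> phi s x y = psi s x y.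
  elim: l => [|o l IH] {}x {}y hx hy.
    have /choice[dx Hx] : forall o, exists d, x o \in hom A d by move=> o; apply: hx.
    have /choice[dy Hy] := hy.
    by apply: (H (fun i => match i with inl o => dx o | inr c => dy c end)).
  rewrite -[x](upd_id _ o); elim/hom_ind: (x o) => [|d a b ha IHb].
    by rewrite !(ev_zeroO _ s _ (x := upd x o 0) (o := o)) ?ffunE ?eqxx.
  rewrite !ev_addO IHb; congr (_ + _); apply: IH => // o' no'.
  rewrite ffunE; case: eqP => [_|/eqP ne]; first by exists d.
  by apply: hx; rewrite inE negb_or ne.
have H2 (l : seq C) : forall (x : {ffun O -> A}) (y : {ffun C -> B}), (forall c, c \notin l ->
  exists d, y c \in hom B d) -> phi s x y = psi s x y.
  elim: l => [|c l IH] {}x {}y hy.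
    by apply: (H1 (enum O)) => [o|c]; [rewrite mem_enum | apply: hy].
  rewrite -[y](upd_id _ c); elim/hom_ind: (y c) => [|d a b ha IHb].
    by rewrite !(ev_zeroC _ s _ (y := upd y c 0) (c := c)) ?ffunE ?eqxx.
  rewrite !ev_addC IHb; congr (_ + _); apply: IH => // o' no'.
  rewrite ffunE; case: eqP => [_|/eqP ne]; first by exists d.
  by apply: hy; rewrite inE negb_or ne.
by apply: (H2 (enum C)) => c; rewrite mem_enum.
Qed.

(** One order suffices, because both forms change by the same Koszul sign when the order changes.
    Every identity between glued surfaces below is tested in the order in which its signs cancel. *)
Lemma endo_ext_homog phi psi l : perm_eq l (enum {: O + C}) ->
  (forall d x y, homog d x y -> evl phi l x y = evl psi l x y) -> phi = psi.
Proof.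
move=> pl H; apply: endo_ext => s; apply: ev_homog_ext => d x y h.
have ps : perm_eq l (val s) by apply: perm_trans pl _; rewrite perm_sym (valP s).
by rewrite !(evl_koszul _ h ps) (H _ _ _ h).
Qed.

Lemma evl_deg phi l d x y : homog d x y -> dg d l != 0 -> evl phi l x y = 0.
Proof.
move=> h; rewrite /evl; case: insubP => // s _ <- dl; apply: (ev_deg _ _ h).
by move: dl; rewrite /dg (perm_big _ (valP s)) big_enum.
Qed.

End Evl.

Section ContractionHomog.
Variables (K : fieldType) (A B : form_space K) (O C : finType).

(** The degrees at [u] and [v] are recorded because these two inputs are going to be moved through
    the list, at the cost of signs that depend on them. *)
Lemma octr_homog (u v : O) (uv : u != v) d (x : {ffun without2 u v -> A})
    (y : {ffun C -> B}) f e1 e2 :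
  homog d x y -> e1 \in hom A f -> e2 \in hom A (- f) ->
  exists D : O + C -> int, [/\ homog D (ext2 x e1 e2) y,
    forall i, D (sum_map val id i) = d i, D (inl u) = f & D (inl v) = - f].
Proof.
move=> [hx hy] he1 he2; have [h hK Kh] := octr_bij C uv.
pose D (i : O + C) := match h i with inl a => d a | inr b => if b then - f else f end.
have Dl i : D (sum_map val id i) = d i by rewrite /D (hK (inl i)).
have Du : D (inl u) = f by rewrite /D (hK (inr false)).
have Dv : D (inl v) = - f by rewrite /D (hK (inr true)).
exists D; split=> //; split=> [|c]; last by rewrite (Dl (inr c)).
apply: (ext2_in (U := fun o => hom A (D (inl o))) uv); rewrite ?Du ?Dv //.
by move=> z; rewrite (Dl (inl z)).
Qed.

Lemma cctr_homog (u v : C) (uv : u != v) d (x : {ffun O -> A})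
    (y : {ffun without2 u v -> B}) f e1 e2 :
  homog d x y -> e1 \in hom B f -> e2 \in hom B (- f) ->
  exists D : O + C -> int, [/\ homog D x (ext2 y e1 e2),
    forall i, D (sum_map id val i) = d i, D (inr u) = f & D (inr v) = - f].
Proof.
move=> [hx hy] he1 he2; have [h hK Kh] := cctr_bij O uv.
pose D (i : O + C) := match h i with inl a => d a | inr b => if b then - f else f end.
have Dl i : D (sum_map id val i) = d i by rewrite /D (hK (inl i)).
have Du : D (inr u) = f by rewrite /D (hK (inr false)).
have Dv : D (inr v) = - f by rewrite /D (hK (inr true)).
exists D; split=> //; split=> [o|]; first by rewrite (Dl (inl o)).
apply: (ext2_in (U := fun c => hom B (D (inr c))) uv); rewrite ?Du ?Dv //.
by move=> z; rewrite (Dl (inr z)).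
Qed.

Lemma ext2_updl (T : finType) (W : zmodType) (u v : T) (w : {ffun without2 u v -> W}) e e1 e2 :
  ext2 w e e2 = upd (ext2 w e1 e2) u e.
Proof. by apply/ffunP => z; rewrite !ffunE; case: eqP. Qed.

(** The contraction is defined with [u], [v] at the end of the list. The pair has total degree 0 and
    moves to the front without a sign; moving [v] on behind [P] costs the sign that [koszul_scale]
    puts into the first leg. *)
Lemma octr_evl (u v : O) (uv : u != v) (phi : endo A B O C) P Q T d x y :
  homog d x y -> perm_eq (P ++ Q ++ T) (enum {: without2 u v + C}) ->
  evl (endo_octr uv phi) (P ++ Q ++ T) x y =
  \sum_(e <- copairing A)
     evl phi (inl u :: map (sum_map val id) P ++ inl v :: map (sum_map val id) Q
                ++ map (sum_map val id) T)
       (ext2 x (koszul_scale A (dg d P) e.1) e.2) y.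
Proof.
move=> h pS; rewrite -(evl_mk _ pS) /= /endo_octr_ev !big_seq.
apply: eq_bigr => e /copairing_hom[f [e1 e2]].
have [D [hD Dl Du Dv]] := octr_homog uv h e1 e2.
rewrite (koszul_scaleE _ e1) (ext2_updl x (_ *: e.1) e.1) evl_scaleO -(ext2_updl x e.1).
rewrite -evlE /= map_cat map_cat.
set lP := map _ P; set lQ := map _ Q; set lT := map _ T.
have := evl_swap phi [::] (lP ++ lQ ++ lT) [:: inl u; inl v] [::] hD.
rewrite /= cats0 => ->; rewrite !dg_cons dg_nil addr0 Du Dv addrN andbF mul1r.
have := evl_swap phi [:: inl u] [:: inl v] lP (lQ ++ lT) hD; rewrite /= => ->.
rewrite dg_cons dg_nil addr0 Dv oddzN andbC; congr (_ ^+ (_ && _) * _).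
by rewrite dg_map /dg (eq_bigr d).
Qed.

Lemma cctr_evl (u v : C) (uv : u != v) (phi : endo A B O C) P T d x y :
  homog d x y -> perm_eq (P ++ T) (enum {: O + without2 u v}) ->
  evl (endo_cctr uv phi) (P ++ T) x y =
  \sum_(e <- copairing B)
     evl phi (map (sum_map id val) P ++ inr u :: inr v :: map (sum_map id val) T)
       x (ext2 y e.1 e.2).
Proof.
move=> h pS; rewrite -(evl_mk _ pS) /= /endo_cctr_ev !big_seq.
apply: eq_bigr => e /copairing_hom[f [e1 e2]].
have [D [hD Dl Du Dv]] := cctr_homog uv h e1 e2.
rewrite -evlE /= map_cat.
set lP := map _ P; set lT := map _ T.
have := evl_swap phi lP lT [:: inr u; inr v] [::] hD.
rewrite /= cats0 catA => ->; rewrite !dg_cons dg_nil addr0 Du Dv addrN andbF mul1r.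
by [].
Qed.

End ContractionHomog.

Section Composition.
Variables (K : fieldType) (A B : form_space K) (O1 O2 C1 C2 : finType).
Variables (phi1 : endo A B O1 C1) (phi2 : endo A B O2 C2).
Let L : O1 + C1 -> (O1 + O2) + (C1 + C2) := sum_map inl inl.
Let R : O2 + C2 -> (O1 + O2) + (C1 + C2) := sum_map inr inr.

Lemma pmap_left P1 P2 :
  pmap (@left_input O1 C1 O2 C2) (map L P1 ++ map R P2) = P1.
Proof.
rewrite pmap_cat; have -> : pmap (@left_input O1 C1 O2 C2) (map R P2) = [::].
  by elim: P2 => [|[] ? s IH] //=.
rewrite cats0; elim: P1 => [|[] ? s IH] //=; by rewrite IH.
Qed.

Lemma pmap_right P1 P2 :
  pmap (@right_input O1 C1 O2 C2) (map L P1 ++ map R P2) = P2.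
Proof.
rewrite pmap_cat; have -> : pmap (@right_input O1 C1 O2 C2) (map L P1) = [::].
  by elim: P1 => [|[] ? s IH] //=.
by rewrite cat0s; elim: P2 => [|[] ? s IH] //=; rewrite IH.
Qed.

(* The order of the two contracted inputs makes all Koszul signs cancel. *)
Lemma tensor_evl (s : ordering ((O1 + O2) + (C1 + C2))%type) D x y P1 P2 u v :
  homog D x y -> val s = (map L P1 ++ map R P2) ++ [:: L u; R v] ->
  oddz (D (L u)) = oddz (D (R v)) ->
  endo_tensor phi1 phi2 s x y =
  evl phi1 (P1 ++ [:: u]) [ffun o => x (inl o)] [ffun c => y (inl c)] *
  evl phi2 (v :: P2) [ffun o => x (inr o)] [ffun c => y (inr c)].
Proof.
move=> h Es Euv; rewrite /= (endo_tensor_hom _ _ _ h).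
have El : val (left_ord s) = P1 ++ [:: u].
  rewrite /= Es pmap_cat pmap_left /=; have /= := pmap_left [:: u] [:: v]; by move=> ->.
have Er : val (right_ord s) = P2 ++ [:: v].
  rewrite /= Es pmap_cat pmap_right /=; have /= := pmap_right [:: u] [:: v]; by move=> ->.
rewrite -!evlE El Er.
have := evl_swap phi2 [::] P2 [:: v] [::] (homog_right h); rewrite /= cats0 => ->.
rewrite mulrCA; congr (_ * _); rewrite mulrA -[RHS]mul1r; congr (_ * _).
have U : uniq (map L P1 ++ map R P2 ++ [:: L u] ++ [:: R v]).
  by have := ordering_uniq s; rewrite Es -catA.
rewrite /unshuffle El Er Es -/L -/R; set k := koszul _ _ _.
have -> : k = oddz (dg D (map R P2)) && oddz (dg D [:: L u]).
  by rewrite -!odd_count -(koszul_swap _ U) /k !map_cat -!catA.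
rewrite -signr_addb !dg_cons !dg_nil !addr0 /dg big_map Euv.
by rewrite addbb.
Qed.

Lemma ocomp_evl (u : O1) (v : O2) S P1 P2 d x y :
  homog d x y -> perm_eq S (enum {: without2 (inl u) (inr v) + (C1 + C2)}) ->
  map (sum_map val id) S = map L P1 ++ map R P2 ->
  evl (endo_octr (inl_neq_inr u v) (endo_tensor phi1 phi2)) S x y =
  \sum_(e <- copairing A)
     evl phi1 (P1 ++ [:: inl u]) [ffun o => ext2 x e.1 e.2 (inl o)] [ffun c => y (inl c)] *
     evl phi2 (inl v :: P2) [ffun o => ext2 x e.1 e.2 (inr o)] [ffun c => y (inr c)].
Proof.
move=> h pS ES; rewrite -(evl_mk _ pS) /= /endo_octr_ev !big_seq.
apply: eq_bigr => e /copairing_hom[f [e1 e2]].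
have [D [hD _ Du Dv]] := octr_homog (inl_neq_inr u v) h e1 e2.
apply: (tensor_evl hD); first by rewrite /= ES.
by rewrite /L /R /= Du Dv oddzN.
Qed.

Lemma ccomp_evl (u : C1) (v : C2) S P1 P2 d x y :
  homog d x y -> perm_eq S (enum {: (O1 + O2) + without2 (inl u) (inr v)}) ->
  map (sum_map id val) S = map L P1 ++ map R P2 ->
  evl (endo_cctr (inl_neq_inr u v) (endo_tensor phi1 phi2)) S x y =
  \sum_(e <- copairing B)
     evl phi1 (P1 ++ [:: inr u]) [ffun o => x (inl o)] [ffun c => ext2 y e.1 e.2 (inl c)] *
     evl phi2 (inr v :: P2) [ffun o => x (inr o)] [ffun c => ext2 y e.1 e.2 (inr c)].
Proof.
move=> h pS ES; rewrite -(evl_mk _ pS) /= /endo_cctr_ev !big_seq.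
apply: eq_bigr => e /copairing_hom[f [e1 e2]].
have [D [hD _ Du Dv]] := cctr_homog (inl_neq_inr u v) h e1 e2.
apply: (tensor_evl hD); first by rewrite /= ES.
by rewrite /L /R /= Du Dv oddzN.
Qed.

End Composition.

Section RelabelEvl.
Variables (K : fieldType) (A B : form_space K) (O O' C C' : finType).
Variables (f : bijection O O') (g : bijection C C').

Lemma relabel_evl (phi : endo A B O C) l x y :
  perm_eq l (enum {: O' + C'}) ->
  evl (endo_relabel (bfunK f) (binvK f) (bfunK g) (binvK g) phi) l x y =
  evl phi (map (sum_map (binv f) (binv g)) l) [ffun o => x (f o)] [ffun c => y (g c)].
Proof. by move=> pl; rewrite -(evl_mk _ pl) /= /endo_relabel_ev -evlE. Qed.

End RelabelEvl.

(** * Frobenius algebras *)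

Section HomLinear.
Variables (K : fieldType) (U W : vectType K) (f : 'Hom(U, W)).

Lemma homD a b : f (a + b) = f a + f b. Proof. exact: linearD. Qed.
Lemma homZ k a : f (k *: a) = k *: f a. Proof. exact: linearZ. Qed.
Lemma hom0 : f 0 = 0. Proof. exact: linear0. Qed.
Lemma hom_suml I (r : seq I) (F : I -> U) :
  f (\sum_(i <- r) F i) = \sum_(i <- r) f (F i).
Proof. exact: linear_sum. Qed.

End HomLinear.

Section LinearMaps.
Variables (K : fieldType) (U W : lmodType K) (g : U -> W).
Hypothesis lg : linear g.

Lemma lin_sum I (r : seq I) (F : I -> U) : g (\sum_(i <- r) F i) = \sum_(i <- r) g (F i).
Proof.
have g0 : g 0 = 0 by have := lg (-1) 0 0; rewrite scaler0 addr0 scaleN1r addNr.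
by elim/big_rec2: _ => // i y1 y2 _ <-; have := lg 1 (F i) y2; rewrite !scale1r.
Qed.

Lemma scale_of_linear k x : g (k *: x) = k *: g x.
Proof.
have := lin_sum [::] (fun _ : unit => 0); rewrite !big_nil => g0.
by have := lg k x 0; rewrite g0 !addr0.
Qed.

Lemma lin_comb I (r : seq I) (k : I -> K) (F : I -> U) :
  g (\sum_(i <- r) k i *: F i) = \sum_(i <- r) k i *: g (F i).
Proof. by rewrite lin_sum; apply: eq_bigr => i _; apply: scale_of_linear. Qed.

End LinearMaps.

Section Bilinear.
Variables (K : fieldType) (V : form_space K).
Implicit Types (a b c : V) (k : K).

(** The values of [form] lie in the module [K^o]; here they are presented as scalars of the field,
    so that products of values can be handled by [ring]. *)
Definition bil a b : K := form V a b.

Lemma bilDl a b c : bil (a + b) c = bil a c + bil b c. Proof. exact: formDl. Qed.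
Lemma bilZl k a b : bil (k *: a) b = k * bil a b. Proof. exact: formZl. Qed.
Lemma bilDr a b c : bil c (a + b) = bil c a + bil c b. Proof. by rewrite /bil linearD. Qed.
Lemma bilZr k a b : bil b (k *: a) = k * bil b a. Proof. by rewrite /bil linearZ. Qed.
Lemma bil0l b : bil 0 b = 0. Proof. by rewrite /bil linear0 lfunE. Qed.
Lemma bil0r b : bil b 0 = 0. Proof. by rewrite /bil linear0. Qed.

Lemma bil_suml I (r : seq I) (F : I -> V) b :
  bil (\sum_(i <- r) F i) b = \sum_(i <- r) bil (F i) b.
Proof. exact: form_suml. Qed.
Lemma bil_sumr I (r : seq I) (F : I -> V) b :
  bil b (\sum_(i <- r) F i) = \sum_(i <- r) bil b (F i).
Proof. by rewrite /bil linear_sum. Qed.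

Lemma bil_sym d e a b : a \in hom V d -> b \in hom V e ->
  bil a b = (-1) ^+ (oddz d && oddz e) * bil b a.
Proof. exact: form_sym. Qed.

Lemma bil_sym0 a b : a \in hom V 0 -> bil a b = bil b a.
Proof.
move=> ha; elim/hom_ind: b => [|d b b' hb IH]; first by rewrite bil0l bil0r.
by rewrite bilDl bilDr IH (bil_sym ha hb) /= mul1r.
Qed.

Lemma bil_inj a b : (forall c, bil a c = bil b c) -> a = b.
Proof. exact: form_inj. Qed.

Lemma bil_snakel a : \sum_(e <- copairing V) bil e.2 a *: e.1 = a.
Proof. exact: copairing_snakel. Qed.
Lemma bil_snaker a : \sum_(e <- copairing V) bil a e.1 *: e.2 = a.
Proof. exact: copairing_snaker. Qed.

Lemma bil_snake a b : \sum_(e <- copairing V) bil a e.1 * bil e.2 b = bil a b.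
Proof.
rewrite -[in RHS](bil_snaker a) bil_suml; apply: eq_bigr => e _; by rewrite bilZl.
Qed.

End Bilinear.

Section Transfer.
Variables (K : fieldType) (V W : form_space K) (Z : lmodType K).
Variables (G : W -> V -> Z) (T : V -> W) (Ts : W -> V).
Hypotheses (Gl : forall y, linear (G^~ y)) (Gr : forall x, linear (G x)).
Hypothesis adj : forall x a, bil x (T a) = bil (Ts x) a.

(* (T (x) id) beta_V^{-1} = (id (x) Ts) beta_W^{-1} *)
Lemma copairing_transfer :
  \sum_(e <- copairing V) G (T e.1) e.2 = \sum_(c <- copairing W) G c.1 (Ts c.2).
Proof.
under eq_bigr => e _ do rewrite -(bil_snakel (T e.1)) (lin_comb (Gl _)).
rewrite exchange_big /=; apply: eq_bigr => c _.
rewrite -[in RHS](bil_snaker (Ts c.2)) (lin_comb (Gr _)); apply: eq_bigr => e _.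
by rewrite adj.
Qed.

End Transfer.

Section CopairingSym.
Variables (K : fieldType) (V : form_space K) (Z : lmodType K).
Variables (G : V -> V -> Z).
Hypotheses (Gl : forall y, linear (G^~ y)) (Gr : forall x, linear (G x)).

(** The inverse of a graded symmetric form is graded symmetric. The two legs have opposite degrees,
    hence equal parities, so the sign of their exchange is the parity of one leg, which is the
    effect of [koszul_scale V 1]. *)
Lemma copairing_sym :
  \sum_(e <- copairing V) G e.1 e.2 = \sum_(e <- copairing V) G (koszul_scale V 1 e.2) e.1.
Proof.
under [RHS]eq_bigr => e _ do
  rewrite -(bil_snakel e.2) hom_suml (eq_bigr _ (fun i _ => homZ _ _ _))
    (lin_comb (Gl _)).
rewrite exchange_big /= !big_seq; apply: eq_bigr => e' /copairing_hom[g [h1 h2]].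
rewrite -[in LHS](bil_snakel e'.2) (lin_comb (Gr _)) !big_seq;
  apply: eq_bigr => e /copairing_hom[g' [h1' h2']].
rewrite (koszul_scaleE _ h1) /=.
rewrite (scale_of_linear (Gl _)) scalerA; have [E|n] := eqVneq g (- g'); last first.
  rewrite /bil (form_deg h2' h2) ?(form_deg h2 h2') ?mul0r //.
    by rewrite -opprD oppr_eq0 addr_eq0.
  by rewrite -opprD oppr_eq0 addrC addr_eq0.
rewrite (bil_sym h2 h2') !oddzN E oddzN andbb; congr (_ *: _).
by rewrite mulrAC -signr_addb addbb mul1r.
Qed.

End CopairingSym.

Section Frobenius.
Variables (K : fieldType) (V : form_space K) (mu : 'Hom(V, 'Hom(V, V))).
Implicit Types (a b c : V) (k : K).

Definition mul a b : V := mu a b.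

Lemma mulvDl a b c : mul (a + b) c = mul a c + mul b c.
Proof. by rewrite /mul linearD lfunE. Qed.
Lemma mulvZl k a b : mul (k *: a) b = k *: mul a b.
Proof. by rewrite /mul linearZ lfunE. Qed.
Lemma mulvDr a b c : mul c (a + b) = mul c a + mul c b. Proof. exact: linearD. Qed.
Lemma mulvZr k a b : mul b (k *: a) = k *: mul b a. Proof. exact: linearZ. Qed.
Lemma mulv0l b : mul 0 b = 0. Proof. by rewrite /mul linear0 lfunE. Qed.
Lemma mulv0r b : mul b 0 = 0. Proof. exact: linear0. Qed.
Lemma mulv_suml I (r : seq I) (F : I -> V) b :
  mul (\sum_(i <- r) F i) b = \sum_(i <- r) mul (F i) b.
Proof. by rewrite /mul linear_sum sum_lfunE. Qed.
Lemma mulv_sumr I (r : seq I) (F : I -> V) b :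
  mul b (\sum_(i <- r) F i) = \sum_(i <- r) mul b (F i).
Proof. exact: linear_sum. Qed.

(** Cyclicity moves the first argument to the end and the graded symmetry of the form brings it back
    to the front; both signs exchange it with the product of the other two, so they cancel. *)
Lemma bil_mul_cyc :
  (forall d e a b, a \in hom V d -> b \in hom V e -> mul a b \in hom V (d + e)) ->
  (forall d1 d2 d3 a1 a2 a3, a1 \in hom V d1 -> a2 \in hom V d2 -> a3 \in hom V d3 ->
     bil (mul a1 a2) a3 = (-1) ^+ (oddz d1 && oddz (d2 + d3)) * bil (mul a2 a3) a1) ->
  forall a b c, bil (mul a b) c = bil a (mul b c).
Proof.
move=> mulv_hom h a b c.
elim/hom_ind: a b c => [b c|da a a' ha IHa b c]; first by rewrite mulv0l !bil0l.
rewrite mulvDl !bilDl IHa; congr (_ + _).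
elim/hom_ind: b c {IHa} => [c|db b b' hb IHb c]; first by rewrite mulv0r mulv0l bil0l bil0r.
rewrite mulvDr mulvDl bilDl bilDr IHb; congr (_ + _).
elim/hom_ind: c {IHb} => [|dc c c' hc IHc]; first by rewrite mulv0r !bil0r.
rewrite mulvDr !bilDr IHc; congr (_ + _).
rewrite (h _ _ _ _ _ _ ha hb hc) (bil_sym ha (mulv_hom _ _ _ _ hb hc)); congr (_ * _).
Qed.

Hypothesis frob : is_frobenius mu.

Lemma mulv_hom d e a b : a \in hom V d -> b \in hom V e -> mul a b \in hom V (d + e).
Proof. by case: frob => h _ _; apply: h. Qed.

Lemma mulvA a b c : mul (mul a b) c = mul a (mul b c).
Proof. by case: frob => _ h _; apply: h. Qed.

Lemma bil_mul a b c : bil (mul a b) c = bil a (mul b c).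
Proof. by case: frob => h1 _ h3; apply: bil_mul_cyc. Qed.

Definition casimir : V := \sum_(e <- copairing V) mul e.1 e.2.

(** The superdimension: a homogeneous basis vector contributes 1 or -1 according to its parity,
    since the dual vector stands on the right. *)
Definition sdim : K := \sum_(e <- copairing V) bil e.1 e.2.

Lemma casimir_hom : casimir \in hom V 0.
Proof.
rewrite /casimir big_seq; apply: rpred_sum => e /copairing_hom[d [h1 h2]].
by have := mulv_hom h1 h2; rewrite addrN.
Qed.

(** By invariance of the form, left and right multiplication by [a] are adjoint to each other; the
    adjoint moves from one leg of the copairing to the other. *)
Lemma copairing_mul (Z : lmodType K) (G : V -> V -> Z) a :
  (forall y, linear (G^~ y)) -> (forall x, linear (G x)) ->
  \sum_(e <- copairing V) G (mul a e.1) e.2 = \sum_(e <- copairing V) G e.1 (mul e.2 a).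
Proof.
move=> Gl Gr; apply: (copairing_transfer (T := mul a) (Ts := mul^~ a)) => // x b.
by rewrite bil_mul.
Qed.

Lemma casimirC a : mul a casimir = mul casimir a.
Proof.
rewrite /casimir mulv_sumr mulv_suml.
under eq_bigr => e _ do rewrite -mulvA.
under [RHS]eq_bigr => e _ do rewrite mulvA.
apply: (copairing_mul (G := mul)) => [y|x] k b c; by rewrite ?mulvDl ?mulvZl ?mulvDr ?mulvZr.
Qed.

End Frobenius.

(** * The algebra of surfaces *)

Section PairLinear.
Variables (K : fieldType) (U V : lmodType K).
Lemma fstD (x y : U * V) : (x + y).1 = x.1 + y.1. Proof. by []. Qed.
Lemma sndD (x y : U * V) : (x + y).2 = x.2 + y.2. Proof. by []. Qed.
Lemma fstZ k (x : U * V) : (k *: x).1 = k *: x.1. Proof. by []. Qed.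
Lemma sndZ k (x : U * V) : (k *: x).2 = k *: x.2. Proof. by []. Qed.
End PairLinear.

Section CardyFrobenius.
Variables (K : fieldType) (A B : form_space K).
Variables (mu : 'Hom(A, 'Hom(A, A))) (om : 'Hom(B, 'Hom(B, B))) (f : 'Hom(B, A)).
Hypotheses (HA : is_frobenius mu) (HB : is_commutative_frobenius om).
Hypotheses (Hf : is_central_morphism mu om f) (Hc : cardy_condition mu f).
Local Notation mA := (mul mu).
Local Notation mB := (mul om).

Let HB1 : is_frobenius om := HB.1.

Lemma mB_sym d e b c : b \in hom B d -> c \in hom B e ->
  mB b c = (-1) ^+ (oddz d && oddz e) *: mB c b.
Proof.
move=> hb hc; apply: bil_inj => x; elim/hom_ind: x => [|g x y hx IH]; first by rewrite !bil0r.
rewrite !bilDr IH; congr (_ + _); rewrite bilZl.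
by have [E _] := HB.2 _ _ _ _ _ _ hb hc hx; apply: E.
Qed.

Lemma f_hom d b : b \in hom B d -> f b \in hom A d.
Proof. by case: Hf => h _ _; apply: h. Qed.

Lemma fM b c : f (mB b c) = mA (f b) (f c).
Proof. by case: Hf => _ h _; apply: h. Qed.

Lemma f_central d e b a : b \in hom B d -> a \in hom A e ->
  mA (f b) a = (-1) ^+ (oddz d && oddz e) *: mA a (f b).
Proof. by case: Hf => _ _ h; apply: h. Qed.

(** The adjoint f^* for the two forms, written out with the copairing. *)
Definition fs (a : A) : B := \sum_(c <- copairing B) bil a (f c.1) *: c.2.

Lemma fs_adj a b : bil (fs a) b = bil a (f b).
Proof.
rewrite -[in RHS](bil_snakel b) hom_suml bil_sumr /fs bil_suml.
by apply: eq_bigr => e _; rewrite homZ bilZl bilZr mulrC.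
Qed.

Lemma fsD a a' : fs (a + a') = fs a + fs a'.
Proof. by apply: bil_inj => b; rewrite bilDl !fs_adj bilDl. Qed.
Lemma fsZ k a : fs (k *: a) = k *: fs a.
Proof. by apply: bil_inj => b; rewrite bilZl !fs_adj bilZl. Qed.
Lemma fs0 : fs 0 = 0.
Proof. by apply: bil_inj => b; rewrite fs_adj !bil0l. Qed.

Lemma fs_hom d a : a \in hom A d -> fs a \in hom B d.
Proof.
move=> ha; rewrite /fs big_seq; apply: rpred_sum => c /copairing_hom[e [h1 h2]].
have [E|n] := eqVneq (d + e) 0; last by rewrite /bil (form_deg ha (f_hom h1) n) scale0r mem0v.
by rewrite (_ : d = - e) ?memvZ //; apply/eqP; rewrite -addr_eq0 E.
Qed.

Lemma fs_adjl b a : bil b (fs a) = bil (f b) a.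
Proof.
elim/hom_ind: a b => [b|d a a' ha IHa b]; first by rewrite fs0 !bil0r.
rewrite fsD !bilDr IHa; congr (_ + _).
elim/hom_ind: b => [|e b b' hb IHb]; first by rewrite hom0 !bil0l.
rewrite homD !bilDl IHb; congr (_ + _).
by rewrite (bil_sym hb (fs_hom ha)) (bil_sym (f_hom hb) ha) fs_adj.
Qed.

Definition hh (b : B) : B := fs (f b).

Lemma hhD b c : hh (b + c) = hh b + hh c. Proof. by rewrite /hh homD fsD. Qed.
Lemma hhZ k b : hh (k *: b) = k *: hh b. Proof. by rewrite /hh homZ fsZ. Qed.
Lemma hh0 : hh 0 = 0. Proof. by rewrite /hh hom0 fs0. Qed.
Lemma hh_hom d b : b \in hom B d -> hh b \in hom B d.
Proof. by move=> h; apply/fs_hom/f_hom. Qed.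

(** The projection formula: f^* is a map of modules over [B], being adjoint to an algebra
    morphism. *)
Lemma fs_mulr a b : mB (fs a) b = fs (mA a (f b)).
Proof. by apply: bil_inj => c; rewrite (bil_mul HB1) !fs_adj fM (bil_mul HA). Qed.

(** Since [f] has central values, its adjoint kills graded commutators. This is what makes the value
    of a boundary circle depend on its word only up to rotation. *)
Lemma fs_mulC d e a b : a \in hom A d -> b \in hom A e ->
  fs (mA a b) = (-1) ^+ (oddz d && oddz e) *: fs (mA b a).
Proof.
move=> ha hb; apply: bil_inj => c.
elim/hom_ind: c => [|g c c' hc IH]; first by rewrite !bil0r.
rewrite !bilDr IH; congr (_ + _); rewrite bilZl !fs_adj !(bil_mul HA).
(* In nonzero total degree both sides vanish. In total degree 0 the parity of [d] is that of
   [e + g], which identifies the signs. *)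
have [E|n] := eqVneq (d + (e + g)) 0; last first.
  rewrite {1}/bil (form_deg ha (mulv_hom HA hb (f_hom hc)) n) /bil.
  rewrite (form_deg hb (mulv_hom HA ha (f_hom hc))) ?mulr0 //.
  by rewrite addrCA.
rewrite (bil_sym ha (mulv_hom HA hb (f_hom hc))) (bil_mul HA) (f_central hc ha) bilZr sgnM.
congr (_ ^+ nat_of_bool _ * _).
have := oddzD d (e + g); rewrite E oddzD /=; case: (oddz d); case: (oddz e); case: (oddz g) => //.
Qed.

Lemma hh_mull b c : hh (mB b c) = mB (hh b) c.
Proof. by rewrite /hh fM fs_mulr. Qed.

Lemma hh_adj b c : bil (hh b) c = bil b (hh c).
Proof. by rewrite /hh fs_adj fs_adjl. Qed.

Lemma hh_mulr b c : mB b (hh c) = mB (hh b) c.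
Proof.
by apply: bil_inj => x; rewrite !(bil_mul HB1) hh_adj hh_mull.
Qed.

(** Takes the place of f f^*(1): the Cardy condition with a unit as one argument would say that f
    f^*(1) is the Casimir element. *)
Definition vA : A := casimir mu.
Local Notation v := vA.

Lemma v_hom : v \in hom A 0. Proof. exact: casimir_hom HA. Qed.
Lemma vC a : mA a v = mA v a. Proof. exact: casimirC HA a. Qed.

(** The Cardy condition with one argument removed by non-degeneracy, which turns an identity of
    forms into one between elements of [A]. *)
Lemma cardyE d b : b \in hom A d ->
  \sum_(e <- copairing A) mA (koszul_scale A d e.1) (mA b e.2) = f (fs b).
Proof.
move=> hb; apply: form_injr => a.
rewrite -[LHS]/(bil a _) -[RHS]/(bil a _).
rewrite -fs_adj fs_adjl bil_sumr.
have := Hc a hb.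
under eq_bigr => e _ do rewrite -[form A _ _]/(bil (mA a _) (mA b _)) (bil_mul HA).
move=> ->; rewrite -[X in bil (f X)](bil_snaker (fs a)) hom_suml bil_suml.
by apply: eq_bigr => c _; rewrite homZ bilZl fs_adj.
Qed.

(** In the Cardy sum for a central element f(b), that element can be pulled out of the middle,
    leaving the Casimir element; the sign of this move is the one carried by [koszul_scale]. *)
Lemma f_fs_f b : f (hh b) = mA v (f b).
Proof.
elim/hom_ind: b => [|d b b' hb IH]; first by rewrite hh0 hom0 mulv0r.
rewrite hhD !homD IH mulvDr; congr (_ + _).
rewrite -(cardyE (f_hom hb)) -vC /v /casimir mulv_sumr !big_seq.
apply: eq_bigr => e /copairing_hom[g [h1 h2]].
rewrite (koszul_scaleE _ h1) mulvZl -!(mulvA HA) (f_central hb h1) mulvZl.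
by [].
Qed.

Lemma f_fs_v : f (fs v) = mA v v.
Proof.
have -> : mA v v = \sum_(e <- copairing A) mA (mA e.1 e.2) v.
  by rewrite -mulv_suml.
rewrite -(cardyE v_hom) !big_seq.
apply: eq_bigr => e /copairing_hom[g [h1 h2]].
by rewrite (koszul_scaleE _ h1) /= scale1r (mulvA HA) vC.
Qed.

(* fs v is f^*(1) up to the missing unit. *)
Lemma hh2 b : hh (hh b) = mB (fs v) b.
Proof. by rewrite fs_mulr /hh -[fs (f b)]/(hh b) f_fs_f. Qed.

Lemma fs_v_hom : fs v \in hom B 0. Proof. exact: fs_hom v_hom. Qed.

Lemma mB_0 b c : b \in hom B 0 -> mB b c = mB c b.
Proof.
move=> hb; elim/hom_ind: c => [|d c c' hc IH]; first by rewrite mulv0r mulv0l.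
by rewrite mulvDr mulvDl IH (mB_sym hb hc) /= scale1r.
Qed.

Lemma hh_fs a : hh (fs a) = fs (mA v a).
Proof.
apply: bil_inj => b; rewrite hh_adj !fs_adj f_fs_f -(bil_mul HA).
by rewrite vC.
Qed.

Lemma bil_vv_fs a : bil (fs v) (fs a) = bil v (mA v a).
Proof. by rewrite fs_adjl f_fs_v (bil_mul HA). Qed.

(* The unital Frobenius algebra K 1 + A + K t, with a b = mu a b + beta(a, b) t. *)
Definition Ah : lmodType K := (K^o * A * K^o)%type.
(** The constructor and the projections are locked so that elements are only compared through the
    coordinate equations [mkHE], [hD] and [hZ]; the coordinates of [Ut] are treated in the same
    way. *)
Definition mkH (k : K) (a : A) (t : K) : Ah := locked ((k : K^o), a, (t : K^o)).
Definition hk (p : Ah) : K := locked p.1.1.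
Definition ha (p : Ah) : A := locked p.1.2.
Definition ht (p : Ah) : K := locked p.2.

Definition oneH : Ah := mkH 1 0 0.
Definition mH (p q : Ah) : Ah :=
  mkH (hk p * hk q) (hk p *: ha q + hk q *: ha p + mA (ha p) (ha q))
      (hk p * ht q + hk q * ht p + bil (ha p) (ha q)).

(* The unital commutative algebra K 1 + K eta + B + K + K in which surfaces are
   evaluated.  The fourth coordinate of x is its trace, and the fifth one the
   trace of eta x; eta stands for a boundary circle without open inputs. *)
Definition Ut : lmodType K := (K^o * K^o * B * K^o * K^o)%type.
Definition mkU (r q : K) (c : B) (s e : K) : Ut :=
  locked ((r : K^o), (q : K^o), c, (s : K^o), (e : K^o)).
Definition ur (x : Ut) : K := locked x.1.1.1.1.
Definition uq (x : Ut) : K := locked x.1.1.1.2.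
Definition uc (x : Ut) : B := locked x.1.1.2.
Definition us (x : Ut) : K := locked x.1.2.
Definition ue (x : Ut) : K := locked x.2.

Definition oneU : Ut := mkU 1 0 0 0 0.
(** The constants are forced by reading eta as f^*(1). Its square is f^*(f f^*(1)) = f^*(v); the
    trace of the square is the pairing of 1 with v, which is the superdimension of [A]; the trace of
    its cube is the pairing of v with itself. The traces of 1 and of eta are set to 0: they would
    belong to a sphere and a disc without inputs. *)
Definition mU (x y : Ut) : Ut :=
  mkU (ur x * ur y) (ur x * uq y + uq x * ur y)
    (ur x *: uc y + ur y *: uc x + uq x *: hh (uc y) + uq y *: hh (uc x)
       + (uq x * uq y) *: fs v + mB (uc x) (uc y))
    (ur x * us y + ur y * us x + uq x * ue y + uq y * ue x
       + uq x * uq y * sdim A + bil (uc x) (uc y))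
    (ur x * ue y + ur y * ue x + uq x * bil (fs v) (uc y) + uq y * bil (fs v) (uc x)
       + uq x * uq y * bil v v + bil (hh (uc x)) (uc y)).

Lemma mkHE k a t : (hk (mkH k a t) = k) * (ha (mkH k a t) = a) * (ht (mkH k a t) = t).
Proof. by rewrite /hk /ha /ht /mkH -!lock. Qed.
Lemma hD p q : (hk (p + q) = hk p + hk q) * (ha (p + q) = ha p + ha q) * (ht (p + q) = ht p + ht q).
Proof. by rewrite /hk /ha /ht -!lock !fstD !sndD. Qed.
Lemma hZ k p : (hk (k *: p) = k * hk p) * (ha (k *: p) = k *: ha p) * (ht (k *: p) = k * ht p).
Proof. by rewrite /hk /ha /ht -!lock !fstZ !sndZ. Qed.
Lemma H_ext p q : hk p = hk q -> ha p = ha q -> ht p = ht q -> p = q.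
Proof.
by case: p q => [[k a] t] [[k' a'] t']; rewrite /hk /ha /ht -!lock /= => -> -> ->.
Qed.

Lemma mkUE r q c s e : (ur (mkU r q c s e) = r) * (uq (mkU r q c s e) = q) *
  (uc (mkU r q c s e) = c) * (us (mkU r q c s e) = s) * (ue (mkU r q c s e) = e).
Proof. by rewrite /ur /uq /uc /us /ue /mkU -!lock. Qed.
Lemma uD x y : (ur (x + y) = ur x + ur y) * (uq (x + y) = uq x + uq y) *
  (uc (x + y) = uc x + uc y) * (us (x + y) = us x + us y) * (ue (x + y) = ue x + ue y).
Proof. by rewrite /ur /uq /uc /us /ue -!lock !fstD !sndD. Qed.
Lemma uZ k x : (ur (k *: x) = k * ur x) * (uq (k *: x) = k * uq x) *
  (uc (k *: x) = k *: uc x) * (us (k *: x) = k * us x) * (ue (k *: x) = k * ue x).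
Proof. by rewrite /ur /uq /uc /us /ue -!lock !fstZ !sndZ. Qed.
Lemma U_ext x y : ur x = ur y -> uq x = uq y -> uc x = uc y -> us x = us y ->
  ue x = ue y -> x = y.
Proof.
case: x y => [[[[r q] c] s] e] [[[[r' q'] c'] s'] e'].
by rewrite /ur /uq /uc /us /ue -!lock /= => -> -> -> -> ->.
Qed.

Definition bE := (bilDl, bilDr, bilZl, bilZr, mulvDl, mulvDr, mulvZl, mulvZr,
  fsD, fsZ, hhD, hhZ, homD, homZ).
Definition b0E := (bil0l, bil0r, mulv0l, mulv0r, fs0, hh0, hom0).

Lemma mU_linl y : linear (mU^~ y).
Proof.
move=> k x x'; rewrite /mU; apply: U_ext; rewrite !(uD, uZ, mkUE) ?bE; try ring.
apply: bil_inj => b; rewrite !bE; ring.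
Qed.

Lemma mU_linr x : linear (mU x).
Proof.
move=> k y y'; rewrite /mU; apply: U_ext; rewrite !(uD, uZ, mkUE) ?bE; try ring.
apply: bil_inj => b; rewrite !bE; ring.
Qed.

Lemma mH_linl q : linear (mH^~ q).
Proof.
move=> k x x'; rewrite /mH; apply: H_ext; rewrite !(hD, hZ, mkHE) ?bE; try ring.
apply: bil_inj => b; rewrite !bE; ring.
Qed.

Lemma mH_linr p : linear (mH p).
Proof.
move=> k y y'; rewrite /mH; apply: H_ext; rewrite !(hD, hZ, mkHE) ?bE; try ring.
apply: bil_inj => b; rewrite !bE; ring.
Qed.

Lemma mHA p q r : mH (mH p q) r = mH p (mH q r).
Proof.
rewrite /mH; apply: H_ext; rewrite !mkHE ?bE ?(bil_mul HA) ?(mulvA HA); try ring.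
apply: bil_inj => b; rewrite !bE; ring.
Qed.

Lemma mH1l p : mH oneH p = p.
Proof.
rewrite /mH /oneH; apply: H_ext; rewrite !mkHE ?b0E; try ring.
apply: bil_inj => b; rewrite !(bE, b0E); ring.
Qed.
Lemma mH1r p : mH p oneH = p.
Proof.
rewrite /mH /oneH; apply: H_ext; rewrite !mkHE ?b0E; try ring.
apply: bil_inj => b; rewrite !(bE, b0E); ring.
Qed.

Lemma mU1l x : mU oneU x = x.
Proof.
rewrite /mU /oneU; apply: U_ext; rewrite !mkUE ?b0E; try ring.
apply: bil_inj => b; rewrite !(bE, b0E); ring.
Qed.
Lemma mU1r x : mU x oneU = x.
Proof.
rewrite /mU /oneU; apply: U_ext; rewrite !mkUE ?b0E; try ring.
apply: bil_inj => b; rewrite !(bE, b0E); ring.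
Qed.

Lemma mB_fv b : mB b (fs v) = mB (fs v) b.
Proof. by rewrite (mB_0 b fs_v_hom). Qed.
Lemma bil_fv b : bil b (fs v) = bil (fs v) b.
Proof. by rewrite (bil_sym0 b fs_v_hom). Qed.

Lemma mUA x y z : mU (mU x y) z = mU x (mU y z).
Proof.
(* These rules orient the occurrences of [hh] and [fs v] towards the left, so that both sides reach
   forms which [ring] can compare. *)
have N1 b c : bil b (hh c) = bil (hh b) c by rewrite hh_adj.
have N2 b c : mB b (hh c) = mB (hh b) c by rewrite hh_mulr.
have N3 b c d : bil (mB b c) d = bil b (mB c d) by rewrite (bil_mul HB1).
have N4 b c d : bil b (mB (hh c) d) = bil (hh b) (mB c d) by rewrite -!N3 N2.
have N5 b c : bil b (mB (fs v) c) = bil (fs v) (mB b c) by rewrite -!N3 mB_fv.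
pose N := (mulvA HB1, hh_mull, hh2, N3, N4, N1, N2, N5 (uc x), bil_fv (uc x), bil_fv (hh (uc x)),
  mB_fv (uc x)).
rewrite /mU; apply: U_ext; rewrite !mkUE ?bE; try ring.
- apply: bil_inj => b; rewrite !bE !N; ring.
- rewrite !N; ring.
- rewrite !N.
ring.
Qed.

(* phi p is the contribution of a boundary circle carrying the word p, and fh is
   adjoint to phi; they extend f^* and f.  Multiplication by wU adds a handle. *)
Definition iA (a : A) : Ah := mkH 0 a 0.
Definition iB (b : B) : Ut := mkU 0 0 b 0 0.
(** The empty word goes to eta. The trace of f^*(a) is the pairing of 1 with a, the coordinate [ht];
    the trace of eta f^*(a) is the pairing of f f^*(1), that is of v, with a. *)
Definition phi (p : Ah) : Ut := mkU 0 (hk p) (fs (ha p)) (ht p) (bil v (ha p)).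
Definition fh (x : Ut) : Ah :=
  mkH (ur x) (f (uc x) + uq x *: v) (ue x + uq x * sdim A).
Definition wU : Ut := \sum_(c <- copairing B) mU (iB c.1) (iB c.2).

Definition homH (d : int) (p : Ah) : Prop :=
  ha p \in hom A d /\ (d != 0 -> hk p = 0 /\ ht p = 0).
Definition homU (d : int) (x : Ut) : Prop :=
  uc x \in hom B d /\ (d != 0 -> [/\ ur x = 0, uq x = 0, us x = 0 & ue x = 0]).

Lemma iA_lin : linear iA.
Proof.
move=> k a a'; rewrite /iA; apply: H_ext; rewrite !(hD, hZ, mkHE) //; ring.
Qed.
Lemma iB_lin : linear iB.
Proof.
move=> k a a'; rewrite /iB; apply: U_ext; rewrite !(uD, uZ, mkUE) //; ring.
Qed.
Lemma phi_lin : linear phi.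
Proof.
by move=> k a a'; rewrite /phi; apply: U_ext; rewrite !(uD, uZ, mkUE, hD, hZ) ?bE ?mulr0 ?addr0.
Qed.

Lemma homH_iA d a : a \in hom A d -> homH d (iA a).
Proof. by move=> h; split; rewrite /iA !mkHE. Qed.
Lemma homU_iB d b : b \in hom B d -> homU d (iB b).
Proof. by move=> h; split; rewrite /iB !mkUE. Qed.
Lemma homH1 : homH 0 oneH.
Proof. by split; rewrite /oneH !mkHE // mem0v. Qed.
Lemma homU1 : homU 0 oneU.
Proof. by split; rewrite /oneU !mkUE // mem0v. Qed.

Lemma bil_hom0 (V : form_space K) d e (a b : V) : a \in hom V d -> b \in hom V e ->
  d + e != 0 -> bil a b = 0.
Proof. exact: form_deg. Qed.

(** A scalar coordinate of an element of degree [d] vanishes unless [d] is 0, so it may be treated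
    as a factor of degree [d] in the products defining [mH] and [mU]. *)
Lemma homZ0 (V : graded_space K) (d d' : int) (k : K) (a : V) :
  (d != 0 -> k = 0) -> a \in hom V d' -> k *: a \in hom V (d + d').
Proof.
have [->|n] := eqVneq d 0; first by rewrite add0r => _ h; apply: memvZ.
by move=> h _; rewrite h // scale0r mem0v.
Qed.

Lemma mulZ0 (d d' : int) (k k' : K) : (d != 0 -> k = 0) -> (d' != 0 -> k' = 0) ->
  d + d' != 0 -> k * k' = 0.
Proof.
have [->|n] := eqVneq d 0; first by rewrite add0r => _ h /h ->; rewrite mulr0.
by move=> -> // _ _; rewrite mul0r.
Qed.

Lemma homH_mul d e p q : homH d p -> homH e q -> homH (d + e) (mH p q).
Proof.
move=> [hp p0] [hq q0].
have pk : d != 0 -> hk p = 0 by case/p0.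
have pt : d != 0 -> ht p = 0 by case/p0.
have qk : e != 0 -> hk q = 0 by case/q0.
have qt : e != 0 -> ht q = 0 by case/q0.
split; rewrite /mH !mkHE.
  rewrite !rpredD // ?(mulv_hom HA) //; first exact: homZ0.
  by rewrite addrC; apply: homZ0.
move=> n; rewrite (mulZ0 pk qk n) (mulZ0 pk qt n) (bil_hom0 hp hq n).
by rewrite (mulZ0 qk pt) ?addr0 // addrC.
Qed.

Lemma homU_mul d e x y : homU d x -> homU e y -> homU (d + e) (mU x y).
Proof.
move=> [hx x0] [hy y0].
have xr : d != 0 -> ur x = 0 by case/x0.
have xq : d != 0 -> uq x = 0 by case/x0.
have xs : d != 0 -> us x = 0 by case/x0.
have xe : d != 0 -> ue x = 0 by case/x0.
have yr : e != 0 -> ur y = 0 by case/y0.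
have yq : e != 0 -> uq y = 0 by case/y0.
have ys : e != 0 -> us y = 0 by case/y0.
have ye : e != 0 -> ue y = 0 by case/y0.
have Z k : d + e != 0 -> uq x * uq y * k = 0 by move=> n; rewrite (mulZ0 xq yq n) mul0r.
split; rewrite /mU !mkUE.
  rewrite !rpredD // ?(mulv_hom HB1) //; try exact: homZ0;
    try (by rewrite addrC; apply: homZ0).
  - by apply: homZ0 => //; apply: hh_hom.
  - by rewrite addrC; apply: homZ0 => //; apply: hh_hom.
  - have [E|n] := eqVneq (d + e) 0; first by rewrite E memvZ // fs_v_hom.
    by rewrite (mulZ0 xq yq n) scale0r mem0v.
move=> n; have n' : e + d != 0 by rewrite addrC.
rewrite (mulZ0 xr yr n) (mulZ0 xr yq n) (mulZ0 xr ys n) (mulZ0 xr ye n).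
rewrite !Z // (mulZ0 xq ye n) (mulZ0 xq yr n) (mulZ0 yr xs n') (mulZ0 yr xe n') (mulZ0 yq xe n').
rewrite (bil_hom0 hx hy n) (bil_hom0 (hh_hom hx) hy n).
have yb : e != 0 -> bil (fs v) (uc y) = 0.
  by move=> e0; rewrite (bil_hom0 fs_v_hom hy) // add0r.
have xb : d != 0 -> bil (fs v) (uc x) = 0.
  by move=> d0; rewrite (bil_hom0 fs_v_hom hx) // add0r.
by rewrite (mulZ0 xq yb n) (mulZ0 yq xb n') !addr0.
Qed.

Lemma homU_phi d p : homH d p -> homU d (phi p).
Proof.
move=> [hp p0]; split; rewrite /phi !mkUE; first exact: fs_hom.
by move=> n; have [-> ->] := p0 n; rewrite (bil_hom0 v_hom hp) ?add0r.
Qed.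

Lemma sgn0 (d e : int) : d = 0 \/ e = 0 -> (oddz d && oddz e) = false.
Proof. by case=> ->; rewrite ?andbF. Qed.

Lemma mU_comm d e x y : homU d x -> homU e y ->
  mU x y = (-1) ^+ (oddz d && oddz e) *: mU y x.
Proof.
move=> [hx x0] [hy y0].
(* If one degree is 0 there is no sign, and all coordinates can be compared directly. If neither is,
   the scalar coordinates vanish and only the components in [B] are left. The next two commutation
   lemmas use the same distinction. *)
have [de|/norP[d0 e0]] := boolP ((d == 0) || (e == 0)).
  have E0 : (oddz d && oddz e) = false by apply: sgn0; case/orP: de => /eqP; auto.
  have C : mB (uc x) (uc y) = mB (uc y) (uc x) by rewrite (mB_sym hx hy) E0 scale1r.
  have S b : bil (uc x) (mB (uc y) b) = bil (uc y) (mB (uc x) b) by rewrite -!(bil_mul HB1) C.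
  have S1 : bil (uc x) (uc y) = bil (uc y) (uc x) by rewrite (bil_sym hx hy) E0 mul1r.
  have S2 : bil (hh (uc x)) (uc y) = bil (hh (uc y)) (uc x).
    by rewrite (bil_sym (hh_hom hx) hy) E0 mul1r hh_adj.
  rewrite E0 scale1r /mU; apply: U_ext; rewrite !mkUE ?bE ?S1 ?S2; try ring.
  apply: bil_inj => b; rewrite !bE C; ring.
have [x1 x2 x3 x4] := x0 d0; have [y1 y2 y3 y4] := y0 e0.
rewrite /mU; apply: U_ext; rewrite !(uZ, mkUE) ?x1 ?x2 ?x3 ?x4 ?y1 ?y2 ?y3 ?y4 ?(mul0r, mulr0,
  addr0, add0r, scale0r) //.
- by rewrite (mB_sym hx hy).
- by rewrite (bil_sym hx hy).
- by rewrite (bil_sym (hh_hom hx) hy) hh_adj.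
Qed.

Lemma fh_central d e x p : homU d x -> homH e p ->
  mH (fh x) p = (-1) ^+ (oddz d && oddz e) *: mH p (fh x).
Proof.
move=> [hx x0] [hp p0].
have [de|/norP[d0 e0]] := boolP ((d == 0) || (e == 0)).
  have E0 : (oddz d && oddz e) = false by apply: sgn0; case/orP: de => /eqP; auto.
  have C : mA (f (uc x)) (ha p) = mA (ha p) (f (uc x)) by rewrite (f_central hx hp) E0 scale1r.
  have S1 : bil (f (uc x)) (ha p) = bil (ha p) (f (uc x)).
    by rewrite (bil_sym (f_hom hx) hp) E0 mul1r.
  have S2 : bil (ha p) v = bil v (ha p) by rewrite (bil_sym0 _ v_hom).
  rewrite E0 scale1r /mH /fh; apply: H_ext; rewrite !mkHE ?bE ?S1 ?S2; try ring.
  apply: bil_inj => b; rewrite !bE C vC; ring.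
have [x1 x2 x3 x4] := x0 d0; have [p1 p2] := p0 e0.
rewrite /mH /fh; apply: H_ext; rewrite !(hZ, mkHE) ?x1 ?x2 ?x3 ?x4 ?p1 ?p2 ?(mul0r, mulr0, addr0,
  add0r, scale0r) //.
- by rewrite (f_central hx hp).
- by rewrite (bil_sym (f_hom hx) hp).
Qed.

Lemma phi_mulC d e p q : homH d p -> homH e q ->
  phi (mH p q) = (-1) ^+ (oddz d && oddz e) *: phi (mH q p).
Proof.
move=> [hp p0] [hq q0].
have V : bil v (mA (ha p) (ha q)) = (-1) ^+ (oddz d && oddz e) * bil v (mA (ha q) (ha p)).
  have hvq : mA v (ha q) \in hom A e by rewrite -[e]add0r; apply: (mulv_hom HA v_hom hq).
  by rewrite -(bil_mul HA) -vC (bil_mul HA) (bil_sym hp hvq) (bil_mul HA).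
have [de|/norP[d0 e0]] := boolP ((d == 0) || (e == 0)).
  have E0 : (oddz d && oddz e) = false by apply: sgn0; case/orP: de => /eqP; auto.
  have S1 : bil (ha p) (ha q) = bil (ha q) (ha p) by rewrite (bil_sym hp hq) E0 mul1r.
  rewrite E0 mul1r in V.
  rewrite E0 scale1r /mH /phi; apply: U_ext; rewrite !(mkUE, mkHE) ?bE ?S1 ?V ?(fs_mulC hp hq) ?E0
    ?scale1r; try ring.
  apply: bil_inj => b; rewrite !bE; ring.
have [p1 p2] := p0 d0; have [q1 q2] := q0 e0.
rewrite /mH /phi; apply: U_ext; rewrite !(uZ, mkUE, mkHE) ?p1 ?p2 ?q1 ?q2 ?(mul0r, mulr0, addr0,
  add0r, scale0r) //.
- by rewrite (fs_mulC hp hq).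
- by rewrite (bil_sym hp hq).
Qed.

Lemma fs_mull a b : fs (mA (f b) a) = mB b (fs a).
Proof.
apply: bil_inj => c.
by rewrite fs_adj (bil_mul HA) -fs_adjl -fs_mulr (bil_mul HB1).
Qed.

(** The projection formula for the enlarged algebras. On the adjoined elements it rests on f f^*(v)
    = v v and f f^* f(b) = v f(b). *)
Lemma phi_fh x p : phi (mH (fh x) p) = mU x (phi p).
Proof.
have V : bil v (mA (f (uc x)) (ha p)) = bil (hh (uc x)) (fs (ha p)).
  by rewrite -(bil_mul HA) -f_fs_f fs_adjl.
have hf a : fs (mA v a) = hh (fs a) by rewrite hh_fs.
rewrite /mH /phi /fh /mU; apply: U_ext; rewrite !(mkUE, mkHE) ?bE ?V ?bil_vv_fs ?fs_adjl ?fs_adj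
  ?(bil_sym0 _ v_hom) ?b0E; try ring.
by apply: bil_inj => c; rewrite !bE !hf fs_mull; ring.
Qed.

Lemma us_phi p x : us (mU (phi p) x) = ht (mH p (fh x)).
Proof.
rewrite /mH /phi /fh /mU !(mkUE, mkHE) ?bE fs_adj (bil_sym0 (ha p) v_hom); ring.
Qed.

Lemma fhM x y : fh (mU x y) = mH (fh x) (fh y).
Proof.
have S a : bil a v = bil v a by rewrite (bil_sym0 _ v_hom).
have S1 b : bil (f b) v = bil (fs v) b by rewrite S fs_adj.
rewrite /mH /fh /mU; apply: H_ext; rewrite !(mkUE, mkHE) ?bE ?S1 ?fs_adj ?fs_adjl; try ring.
by apply: bil_inj => c; rewrite !bE fM !f_fs_f f_fs_v !vC; ring.
Qed.

Lemma u_sum I (r : seq I) (F : I -> Ut) :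
  [/\ ur (\sum_(i <- r) F i) = \sum_(i <- r) ur (F i),
      uq (\sum_(i <- r) F i) = \sum_(i <- r) uq (F i),
      uc (\sum_(i <- r) F i) = \sum_(i <- r) uc (F i),
      us (\sum_(i <- r) F i) = \sum_(i <- r) us (F i)
    & ue (\sum_(i <- r) F i) = \sum_(i <- r) ue (F i)].
Proof.
have u0 : [/\ ur 0 = 0, uq 0 = 0, uc 0 = 0, us 0 = 0 & ue 0 = 0].
  have := uZ 0 0; rewrite !scale0r !mul0r => -[[[[-> ->] ->] ->] ->] //.
elim: r => [|i r [h1 h2 h3 h4 h5]]; first by rewrite !big_nil.
by rewrite !big_cons !uD h1 h2 h3 h4 h5.
Qed.

Lemma h_sum I (r : seq I) (F : I -> Ah) :
  [/\ hk (\sum_(i <- r) F i) = \sum_(i <- r) hk (F i),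
      ha (\sum_(i <- r) F i) = \sum_(i <- r) ha (F i)
    & ht (\sum_(i <- r) F i) = \sum_(i <- r) ht (F i)].
Proof.
have h0 : [/\ hk 0 = 0, ha 0 = 0 & ht 0 = 0].
  have := hZ 0 0; rewrite !scale0r !mul0r => -[[-> ->] ->] //.
elim: r => [|i r [h1 h2 h3]]; first by rewrite !big_nil.
by rewrite !big_cons !hD h1 h2 h3.
Qed.

Lemma homU_wU : homU 0 wU.
Proof.
have H (r : seq (B * B)) : {subset r <= copairing B} ->
    homU 0 (\sum_(c <- r) mU (iB c.1) (iB c.2)).
  elim: r => [|c r IH] sr.
    by rewrite big_nil; split=> //; have := uZ 0 0; rewrite !scale0r => -[[[_ ->] _] _];
      rewrite mem0v.
  rewrite big_cons; have [|h1 _] := IH; first by move=> x xr; apply: sr; rewrite inE xr orbT.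
  have /copairing_hom[d [hc1 hc2]] : c \in copairing B by apply: sr; rewrite inE eqxx.
  have [h2 _] := homU_mul (homU_iB hc1) (homU_iB hc2).
  by split=> //; rewrite uD rpredD // -(addrN d).
exact: H.
Qed.

(** A supertrace of right multiplication by [a]. In degree 0 the exchange of the two legs of the
    copairing and the symmetry of the form contribute the same sign; in other degrees both sides
    vanish. *)
Lemma str_mul d a : a \in hom A d ->
  \sum_(e <- copairing A) bil (mA (koszul_scale A d e.1) a) e.2 = bil v a.
Proof.
move=> ha; have [d0|n] := eqVneq d 0; last first.
  rewrite (bil_hom0 v_hom ha) ?add0r // big_seq big1 // => e /copairing_hom[g [h1 h2]].
  rewrite (koszul_scaleE _ h1) mulvZl bilZl (bil_hom0 (mulv_hom HA h1 ha) h2) ?mulr0 //.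
  by rewrite addrAC addrN add0r.
rewrite d0 in ha *.
have -> : \sum_(e <- copairing A) bil (mA (koszul_scale A 0 e.1) a) e.2 =
    \sum_(e <- copairing A) (bil (mA e.1 a) e.2 : K^o).
  rewrite !big_seq; apply: eq_bigr => e /copairing_hom[g [h1 _]].
  by rewrite (koszul_scaleE _ h1) scale1r.
rewrite (copairing_sym (G := fun x y => bil (mA x a) y : K^o)); first last.
- by move=> x k y y'; rewrite bilDr bilZr.
- by move=> y k x x'; rewrite mulvDl mulvZl bilDl bilZl.
rewrite /v /vA /casimir bil_suml !big_seq; apply: eq_bigr => e /copairing_hom[g [h1 h2]].
have h3 : mA e.2 a \in hom A (- g) by rewrite -[- g]addr0; apply: mulv_hom.
rewrite (koszul_scaleE _ h2) mulvZl bilZl (bil_sym h3 h1) sgnM oddzN /= andbb addbb mul1r.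
by rewrite (bil_mul HA).
Qed.

(** On the component in [A] this is [cardyE]. The unit component gives the Casimir element and the
    superdimension, which is where the two constants in [fh] come from; [str_mul] accounts for the
    last coordinate. *)
Lemma cardyH d p : homH d p ->
  \sum_(e <- copairing A) mH (mH (iA (koszul_scale A d e.1)) p) (iA e.2) = fh (phi p).
Proof.
move=> [hp p0].
have K0 : hk p != 0 -> d = 0.
  by move=> n; apply/eqP; apply: contraNT n => /p0[-> _].
have ks0 : d = 0 -> forall e, e \in copairing A -> koszul_scale A d e.1 = e.1.
  by move=> -> e /copairing_hom[g [h1 _]]; rewrite (koszul_scaleE _ h1) scale1r.
have [s1 s2 s3] := h_sum (copairing A) (fun e => mH (mH (iA (koszul_scale A d e.1)) p) (iA e.2)).
apply: H_ext; rewrite ?s1 ?s2 ?s3 /fh /phi !(mkUE, mkHE).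
- by rewrite big1 // => e _; rewrite /mH /iA !mkHE !mul0r ?mulr0.
- rewrite -(cardyE hp).
  rewrite (_ : hk p *: v = \sum_(e <- copairing A) hk p *: mA (koszul_scale A d e.1) e.2).
    rewrite -big_split; apply: eq_bigr => e _ /=; rewrite /mH /iA !mkHE ?bE -(mulvA HA).
    apply: bil_inj => b; rewrite !bE; ring.
  have [->|n] := eqVneq (hk p) 0.
    by rewrite scale0r big1 // => e _; rewrite scale0r.
  rewrite /v /vA /casimir scaler_sumr !big_seq; apply: eq_bigr => e he.
  by rewrite ks0 // K0.
- rewrite -(str_mul hp) /sdim.
  rewrite (_ : hk p * _ = \sum_(e <- copairing A) hk p * bil (koszul_scale A d e.1) e.2).
    rewrite -big_split; apply: eq_bigr => e _ /=; rewrite /mH /iA !mkHE ?bE; ring.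
  have [->|n] := eqVneq (hk p) 0.
    by rewrite mul0r big1 // => e _; rewrite mul0r.
  rewrite mulr_sumr !big_seq; apply: eq_bigr => e he.
  by rewrite ks0 // K0.
Qed.

(** Cutting a circle: the sum over the two legs surrounding [p] is [fh (phi p)] by the Cardy
    condition, and the projection formula then extracts [phi p] as a separate factor. *)
Lemma phi_cut d p q : homH d p ->
  \sum_(e <- copairing A) phi (mH (iA (koszul_scale A d e.1)) (mH p (mH (iA e.2) q))) =
  mU (phi p) (phi q).
Proof.
move=> hp; rewrite -phi_fh -(cardyH hp) (lin_sum (mH_linl q)) (lin_sum phi_lin).
by apply: eq_bigr => e _; rewrite !mHA.
Qed.

(** The product of two elements without components along 1 and eta; it depends on their components
    in [B] only, which makes it bilinear there. *)
Let nn (b c : B) : Ut := mkU 0 0 (mB b c) (bil b c) (bil (hh b) c).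

Lemma mU_nn x y : ur x = 0 -> uq x = 0 -> ur y = 0 -> uq y = 0 -> mU x y = nn (uc x) (uc y).
Proof.
move=> x1 x2 y1 y2; rewrite /mU /nn x1 x2 y1 y2; apply: U_ext; rewrite !mkUE; try ring.
by rewrite !scale0r mul0r scale0r !add0r.
Qed.

Lemma nn_linl c : linear (nn^~ c).
Proof.
by move=> k b b'; rewrite /nn; apply: U_ext; rewrite !(uD, uZ, mkUE) ?bE ?mulr0 ?addr0.
Qed.
Lemma nn_linr b : linear (nn b).
Proof.
by move=> k c c'; rewrite /nn; apply: U_ext; rewrite !(uD, uZ, mkUE) ?bE ?mulr0 ?addr0.
Qed.

(** Merging two circles creates a handle. Invariance of the copairing collects [p] and [q] on one
    leg. Since f^* is applied to the other leg, the copairing of [A] can be traded for that of [B],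
    and the projection formula leaves the handle element as a factor. *)
Lemma phi_merge p q :
  \sum_(e <- copairing A) mU (phi (mH p (iA e.1))) (phi (mH (iA e.2) q)) =
  mU (phi (mH p q)) wU.
Proof.
(* Left multiplication by [r] as an operator on [A], with the unit component of [r] acting by
   scalars. *)
pose lm (r : Ah) (x : A) := hk r *: x + mA (ha r) x.
have lmD r k x y : lm r (k *: x + y) = k *: lm r x + lm r y.
  by apply: bil_inj => b; rewrite /lm !bE; ring.
have E1 e : mU (phi (mH p (iA e.1))) (phi (mH (iA e.2) q)) =
    nn (fs (lm p e.1)) (fs (hk q *: e.2 + mA e.2 (ha q))).
  rewrite mU_nn /phi /mH /iA !(mkUE, mkHE) ?mulr0 ?mul0r ?scale0r ?addr0 ?add0r //.
under eq_bigr => e _ do rewrite E1.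
pose G1 x y := nn (fs (lm p x)) (fs y).
have G1l y : linear (G1^~ y).
  by move=> k x x'; rewrite /G1 lmD (fsD (k *: lm p x)) (fsZ k (lm p x)) nn_linl.
have G1r x : linear (G1 x).
  by move=> k y y'; rewrite /G1 (fsD (k *: y)) (fsZ k y) nn_linr.
have -> : \sum_(e <- copairing A) nn (fs (lm p e.1)) (fs (hk q *: e.2 + mA e.2 (ha q))) =
    \sum_(e <- copairing A) nn (fs (lm (mH p q) e.1)) (fs e.2).
  transitivity (hk q *: (\sum_(e <- copairing A) G1 e.1 e.2) +
                \sum_(e <- copairing A) G1 e.1 (mA e.2 (ha q))).
    by rewrite scaler_sumr -big_split; apply: eq_bigr => e _ /=; rewrite -G1r.
  rewrite -(copairing_mul HA _ G1l G1r) scaler_sumr -big_split.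
  apply: eq_bigr => e _; rewrite /= -G1l /G1; congr (nn (fs _) _).
  rewrite /lm /mH !mkHE; apply: bil_inj => b; rewrite !bE (mulvA HA); ring.
pose G2 x c := nn (fs (lm (mH p q) x)) c.
have G2l y : linear (G2^~ y).
  by move=> k x x'; rewrite /G2 lmD (fsD (k *: lm _ x)) (fsZ k (lm _ x)) nn_linl.
have G2r x : linear (G2 x).
  by move=> k y y'; rewrite /G2 nn_linr.
(* The adjoint on the second leg moves to the first as [f]; from here on the sum runs over the
   copairing of [B]. *)
have := copairing_transfer G2l G2r (T := f) (Ts := fs) (fun x a => esym (fs_adj x a)).
rewrite /G2 => <-; rewrite /wU (lin_sum (mU_linr _)); apply: eq_bigr => c _.
have H r b : [/\ ur (mU (phi r) (iB b)) = 0, uq (mU (phi r) (iB b)) = 0 &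
    uc (mU (phi r) (iB b)) = fs (lm r (f b))].
  rewrite /mU /phi /iB !mkUE; split; try ring.
  by rewrite /lm fsD fsZ -fs_mulr; apply: bil_inj => x; rewrite !(bE, b0E); ring.
have [h1 h2 h3] := H (mH p q) c.1.
by rewrite -mUA mU_nn // ?h3 /iB !mkUE.
Qed.

Lemma ht_mH_iAr Y a : ht (mH Y (iA a)) = bil (ha Y) a.
Proof. by rewrite /mH /iA !mkHE mulr0 mul0r !add0r. Qed.
Lemma ht_mH_iAl Z a : ht (mH (iA a) Z) = bil a (ha Z).
Proof. by rewrite /mH /iA !mkHE mulr0 mul0r !add0r. Qed.

(** The copairing of [A] transmits only components in [A]. The product on the right also contains
    [hk Y * ht Z] and [hk Z * ht Y], which the hypotheses remove; [us_snake] is the analogue for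
    [B], where 1 and eta must both be absent. *)
Lemma ht_snake Y Z : hk Y = 0 -> hk Z = 0 ->
  \sum_(e <- copairing A) ht (mH Y (iA e.1)) * ht (mH (iA e.2) Z) = ht (mH Y Z).
Proof.
move=> y0 z0; under eq_bigr => e _ do rewrite ht_mH_iAr ht_mH_iAl.
by rewrite bil_snake /mH !mkHE y0 z0 !mul0r !add0r.
Qed.

Lemma us_snake X Y : ur X = 0 -> uq X = 0 -> ur Y = 0 -> uq Y = 0 ->
  \sum_(c <- copairing B) us (mU X (iB c.1)) * us (mU (iB c.2) Y) = us (mU X Y).
Proof.
move=> x1 x2 y1 y2.
have E c : us (mU X (iB c)) = bil (uc X) c.
  by rewrite mU_nn // /nn /iB !mkUE.
have E' c : us (mU (iB c) Y) = bil c (uc Y).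
  by rewrite mU_nn // /nn /iB !mkUE.
under eq_bigr => c _ do rewrite E E'.
by rewrite bil_snake mU_nn // /nn mkUE.
Qed.

End CardyFrobenius.

(* Equality of multicycles: rotations of the cycles and a permutation of the list. *)
Definition mcsim (T : eqType) (cs cs' : seq (seq T)) : Prop :=
  exists2 cs'', perm_eq cs cs'' & size cs'' = size cs' /\
    forall i, (i < size cs')%N -> exists k, nth [::] cs' i = rot k (nth [::] cs'' i).

Lemma mcsim_flatten (T : eqType) (cs cs' : seq (seq T)) : mcsim cs cs' ->
  perm_eq (flatten cs') (flatten cs).
Proof.
move=> [cs'' p [sz rt]]; rewrite perm_sym; apply: (perm_trans (perm_flatten p)) => {p}.
elim: cs' cs'' sz rt => [|c cs1 IH] [|c'' cs''] //= [sz] rt.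
apply: perm_cat; last by apply: IH => // i lti; apply: (rt i.+1).
by have [k /= ->] := rt 0%N isT; rewrite perm_sym perm_rot.
Qed.

(** * Cutting and merging in lists of cycles *)

Section CycleLists.
Variable (T : eqType).
Implicit Types (cs : seq (seq T)) (c : seq T).

Lemma mcsim_refl cs : mcsim cs cs.
Proof. by exists cs => //; split=> // i _; exists 0%N; rewrite rot0. Qed.

Lemma mcsim_perm_head cs c cs' k : perm_eq cs (c :: cs') -> mcsim cs (rot k c :: cs').
Proof.
move=> p; exists (c :: cs') => //; split=> // -[|i] _ /=; first by exists k.
by exists 0%N; rewrite rot0.
Qed.

Lemma rot_open_at c u : u \in c -> rot (index u c) c = u :: open_at c u.
Proof.
by move=> uc; rewrite /open_at /rot (drop_nth u) ?index_mem // nth_index.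
Qed.

Lemma mcsim_open cs u : uniq (flatten cs) -> u \in flatten cs ->
  mcsim cs ((u :: open_at (cycle_of cs u) u) :: [seq c <- cs | u \notin c]).
Proof.
move=> ucs uin; have [uc _] := cycle_ofP uin.
by rewrite -(rot_open_at uc); apply/mcsim_perm_head/perm_cycle_of.
Qed.

Lemma open_at_split c u v : uniq c -> u \in c -> v \in c -> u != v ->
  open_at c u = take (index v (open_at c u)) (open_at c u) ++
    v :: drop (index v (open_at c u)).+1 (open_at c u).
Proof.
move=> uc ui vi uv; set p := open_at c u.
have vp : v \in p by move: vi; rewrite (perm_mem (perm_open_at ui)) inE eq_sym (negPf uv).
by rewrite -{1}(cat_take_drop (index v p) p) (drop_nth v) ?index_mem // nth_index.
Qed.

(** Up to rotation the cycle reads u P v Q, and contracting is the cut into P and Q. In this form,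
    and in the corresponding one for two cycles below, the words of the circles can be substituted
    directly. *)
Lemma contract_same cs u v : u != v -> uniq (flatten cs) -> u \in flatten cs ->
    same_cycle cs u v ->
  exists P Q R, contract_cycles cs u v = P :: Q :: R /\ mcsim cs ((u :: P ++ v :: Q) :: R).
Proof.
move=> uv ucs uin sc; rewrite /contract_cycles sc.
move: sc; rewrite same_cycleE // => vcu; have [uc cin] := cycle_ofP uin.
have P1 := perm_cycle_of ucs uin.
have U1 : uniq (cycle_of cs u ++ flatten [seq c <- cs | u \notin c]).
  by rewrite -(perm_uniq (perm_flatten P1)).
have E3 : [seq c <- cs | (u \notin c) && (v \notin c)] = [seq c <- cs | u \notin c].
  have -> : [seq c <- cs | (u \notin c) && (v \notin c)] =
          [seq c <- [seq c <- cs | u \notin c] | v \notin c].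
    by rewrite -filter_predI; apply: eq_filter => c /=; rewrite andbC.
  rewrite filter_notin //; move: U1; rewrite cat_uniq => /and3P[_ /hasPn dis _].
  by apply/negP => /dis; rewrite /= vcu.
rewrite E3; do 3!eexists; split; first by [].
rewrite -open_at_split //; first exact: mcsim_open.
by move: U1; rewrite cat_uniq => /and3P[].
Qed.

Lemma contract_diff cs u v : u != v -> uniq (flatten cs) -> u \in flatten cs ->
    v \in flatten cs -> ~~ same_cycle cs u v ->
  exists P Q R, contract_cycles cs u v = (P ++ Q) :: R /\
    mcsim cs ((u :: P) :: (v :: Q) :: R).
Proof.
move=> uv ucs uin vin sc; rewrite /contract_cycles (negPf sc).
move: sc; rewrite same_cycleE // => vcu.
have [uc cin] := cycle_ofP uin; have [vc din] := cycle_ofP vin.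
have P1 := perm_cycle_of ucs uin.
have U1 : uniq (cycle_of cs u ++ flatten [seq c <- cs | u \notin c]).
  by rewrite -(perm_uniq (perm_flatten P1)).
have v1 : v \in flatten [seq c <- cs | u \notin c].
  by move: vin; rewrite (perm_mem (perm_flatten P1)) /= mem_cat (negPf vcu).
have uni1 : uniq (flatten [seq c <- cs | u \notin c]).
  by move: U1; rewrite cat_uniq => /and3P[].
have [vc1 din1] := cycle_ofP v1.
have P2 := perm_cycle_of uni1 v1.
have Ec : cycle_of [seq c <- cs | u \notin c] v = cycle_of cs v.
  move: din1; rewrite mem_filter => /andP[_ d1].
  have /perm_mem/(_ (cycle_of [seq c <- cs | u \notin c] v)) := perm_cycle_of ucs vin.
  by rewrite d1 inE mem_filter vc1 /= orbF => /esym/eqP.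
have E2 : [seq c <- cs | (u \notin c) && (v \notin c)] =
          [seq c <- [seq c <- cs | u \notin c] | v \notin c].
  by rewrite -filter_predI; apply: eq_filter => c /=; rewrite andbC.
rewrite E2 Ec in P2 *; do 3!eexists; split; first by [].
exists (cycle_of cs u :: cycle_of cs v :: [seq c <- [seq c <- cs | u \notin c] | v \notin c]).
  by apply: (perm_trans P1); rewrite perm_cons.
split=> // -[|[|i]] _ /=.
- by exists (index u (cycle_of cs u)); rewrite rot_open_at.
- by exists (index v (cycle_of cs v)); rewrite rot_open_at.
by exists 0%N; rewrite rot0.
Qed.

End CycleLists.

Section Maps.
Variables (T T' : eqType) (h : T -> T').
Hypothesis ih : injective h.

Lemma open_at_map c u : open_at (map h c) (h u) = map h (open_at c u).
Proof. by rewrite /open_at index_map // -map_rot behead_map. Qed.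

End Maps.

Section MergeCycles.
Variables (T1 T2 : eqType) (cs1 : seq (seq T1)) (cs2 : seq (seq T2)) (u : T1) (v : T2).
Hypotheses (uin : u \in flatten cs1) (vin : v \in flatten cs2).
Let inl' : T1 -> T1 + T2 := inl.
Let inr' : T2 -> T1 + T2 := inr.

Lemma inl_inj' : injective inl'. Proof. by move=> ? ? []. Qed.
Lemma inr_inj' : injective inr'. Proof. by move=> ? ? []. Qed.

Lemma inl_notin_inr (c : seq T2) : inl' u \notin map inr' c.
Proof. by apply/negP => /mapP[]. Qed.
Lemma inr_notin_inl (c : seq T1) : inr' v \notin map inl' c.
Proof. by apply/negP => /mapP[]. Qed.

Lemma merge_cycles :
  contract_cycles (map (map inl') cs1 ++ map (map inr') cs2) (inl u) (inr v) =
  (map inl' (open_at (cycle_of cs1 u) u) ++ map inr' (open_at (cycle_of cs2 v) v)) ::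
  map (map inl') [seq c <- cs1 | u \notin c] ++ map (map inr') [seq c <- cs2 | v \notin c].
Proof.
rewrite /contract_cycles.
have -> : same_cycle (map (map inl') cs1 ++ map (map inr') cs2) (inl u) (inr v) = false.
  apply/hasP => -[c]; rewrite mem_cat => /orP[] /mapP[d _ ->] /andP[].
    by move=> _ /mapP[].
  by move=> /mapP[].
have hu : has (fun c => u \in c) cs1.
  by case/flattenP: uin => c h1 h2; apply/hasP; exists c.
have hv : has (fun c => v \in c) cs2.
  by case/flattenP: vin => c h1 h2; apply/hasP; exists c.
have Eu : cycle_of (map (map inl') cs1 ++ map (map inr') cs2) (inl' u) = map inl' (cycle_of cs1 u).
  have E : find (fun c => inl' u \in c) (map (map inl') cs1) = find (fun c => u \in c) cs1.
    rewrite find_map; apply: eq_find => c /=; exact: (mem_map inl_inj').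
  have hu' : has (fun c => inl' u \in c) (map (map inl') cs1).
    by rewrite has_find E size_map -has_find.
  rewrite /cycle_of find_cat hu' E nth_cat size_map -has_find hu (nth_map [::]) //.
  by rewrite -has_find.
have Ev : cycle_of (map (map inl') cs1 ++ map (map inr') cs2) (inr' v) = map inr' (cycle_of cs2 v).
  have E : find (fun c => inr' v \in c) (map (map inr') cs2) = find (fun c => v \in c) cs2.
    rewrite find_map; apply: eq_find => c /=; exact: (mem_map inr_inj').
  have hn : has (fun c => inr' v \in c) (map (map inl') cs1) = false.
    by apply/hasP => -[c /mapP[d _ ->]]; rewrite (negPf (inr_notin_inl d)).
  rewrite /cycle_of find_cat hn E nth_cat ltnNge leq_addr /= addKn (nth_map [::]) //.
  by rewrite -has_find.
rewrite Eu Ev !open_at_map; [|exact: inr_inj'|exact: inl_inj'].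
congr (_ :: _); rewrite filter_cat !filter_map; congr cat; congr map; apply: eq_filter => c /=.
  by rewrite (inr_notin_inl c) andbT (mem_map inl_inj').
by rewrite (inl_notin_inr c) (mem_map inr_inj').
Qed.

End MergeCycles.

Section SubLists.
Variables (T : finType) (u v : T).

Definition sub (c : seq T) : seq (without2 u v) := pmap insub c.

Lemma map_val_sub c : u \notin c -> v \notin c -> map val (sub c) = c.
Proof.
elim: c => //= t c IH; rewrite !inE !negb_or => /andP[ut uc] /andP[vt vc].
rewrite /sub /=; case: insubP => [z _ Ez|] /=; first by rewrite Ez IH.
by rewrite ![t == _]eq_sym ut vt.
Qed.

Lemma sub_cat c c' : sub (c ++ c') = sub c ++ sub c'.
Proof. exact: pmap_cat. Qed.

Lemma map_val_sub_all cs : u \notin flatten cs -> v \notin flatten cs ->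
  map (map val) (map sub cs) = cs.
Proof.
elim: cs => //= c cs IH; rewrite !mem_cat !negb_or => /andP[u1 u2] /andP[v1 v2].
by rewrite map_val_sub // IH.
Qed.

Lemma ext2_val (W : zmodType) (w : {ffun without2 u v -> W}) e e' z :
  ext2 w e e' (val z) = w z.
Proof.
rewrite ffunE; have /andP[/negPf -> /negPf ->] := valP z; by rewrite valK.
Qed.
Lemma ext2_u (W : zmodType) (w : {ffun without2 u v -> W}) e e' : ext2 w e e' u = e.
Proof. by rewrite ffunE eqxx. Qed.
Lemma ext2_v (W : zmodType) (w : {ffun without2 u v -> W}) e e' : u != v -> ext2 w e e' v = e'.
Proof. by move=> uv; rewrite ffunE eq_sym (negPf uv) eqxx. Qed.

End SubLists.

Lemma sub_perm (T : finType) (u v : T) l : perm_eq (u :: v :: l) (enum T) ->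
  perm_eq (sub u v l) (enum (without2 u v)).
Proof.
move=> p; have : uniq (u :: v :: l) by rewrite (perm_uniq p) enum_uniq.
move=> /= /and3P[_ _ ul]; apply: orderingP => [|z]; first exact: pmap_sub_uniq.
rewrite /sub mem_pmap_sub; have := mem_enum T (val z); rewrite -(perm_mem p) !inE.
by have /andP[/negPf-> /negPf->] := valP z.
Qed.

Lemma map_val_comp (T : finType) (u v : T) (W : Type) (g : T -> W) l :
  u \notin l -> v \notin l -> map (fun z : without2 u v => g (val z)) (sub u v l) = map g l.
Proof. by move=> nu nv; rewrite (map_comp g val) map_val_sub. Qed.

Section SumLabels.
Variables (T1 T2 : finType) (u : T1) (v : T2).

Lemma inl_inr_notin (Q1 : seq T1) (Q2 : seq T2) : u \notin Q1 -> v \notin Q2 ->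
  [/\ inl u \notin map (inl : T1 -> T1 + T2) Q1, inr v \notin map (inl : T1 -> T1 + T2) Q1,
      inl u \notin map (inr : T2 -> T1 + T2) Q2 & inr v \notin map (inr : T2 -> T1 + T2) Q2].
Proof.
by move=> nu nv; split; rewrite ?(mem_map (@inl_inj _ _)) ?(mem_map (@inr_inj _ _)) //;
  apply/mapP => -[].
Qed.

Lemma map_sub_sum (Z : Type) (G1 : T1 -> Z) (G2 : T2 -> Z)
    (G : without2 (inl u : T1 + T2) (inr v) -> Z) Q1 Q2 : u \notin Q1 -> v \notin Q2 ->
  (forall z, G z = match val z with inl o => G1 o | inr o => G2 o end) ->
  map G (sub (inl u) (inr v) (map inl Q1)) = map G1 Q1 /\
  map G (sub (inl u) (inr v) (map inr Q2)) = map G2 Q2.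
Proof.
move=> nu nv GE; have [nu1 nv1 nu2 nv2] := inl_inr_notin nu nv.
pose G' (o : T1 + T2) := match o with inl o => G1 o | inr o => G2 o end.
by rewrite !(eq_map (GE : G =1 fun z => G' (val z))) !map_val_comp // -!map_comp.
Qed.

Lemma ext2_sum (V : zmodType) (X1 : {ffun T1 -> V}) (X2 : {ffun T2 -> V}) e1 e2
    (X : {ffun without2 (inl u : T1 + T2) (inr v) -> V}) :
  (forall z, X z = match val z with inl o => X1 o | inr o => X2 o end) ->
  [ffun o => ext2 X e1 e2 (inl o)] = upd X1 u e1 /\
  [ffun o => ext2 X e1 e2 (inr o)] = upd X2 v e2.
Proof.
move=> XE; split; apply/ffunP => o; rewrite !ffunE ?(inj_eq (@inl_inj _ _)) ?(inj_eq (@inr_inj _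
  _)) /=;
  case: eqP => // /eqP ne; (case: insubP => [z _ Ez|]; first by rewrite /= XE Ez);
  by rewrite /= ?(inj_eq (@inl_inj _ _)) ?(inj_eq (@inr_inj _ _)) ne.
Qed.

End SumLabels.

Lemma contract_notin (O : finType) (u v : O) (uv : u != v) (M : multicycle O) :
  u \notin flatten (contract_cycles M u v) /\ v \notin flatten (contract_cycles M u v).
Proof.
have [p _] := mc_contractP uv M.
have := enum_uniq O; rewrite -(perm_uniq (multicycleP M)) (perm_uniq p) /= inE negb_or.
by case/and3P => /andP[_ ->] ->.
Qed.

(** * Values of surfaces in an algebra of the kind (i)-(iii) *)

Section Surfaces.
Variables (K : fieldType) (A B : form_space K).
Variables (mu : 'Hom(A, 'Hom(A, A))) (om : 'Hom(B, 'Hom(B, B))) (f : 'Hom(B, A)).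
Hypotheses (HA : is_frobenius mu) (HB : is_commutative_frobenius om).
Hypotheses (Hf : is_central_morphism mu om f) (Hc : cardy_condition mu f).
Local Notation mH := (mH mu).
Local Notation mU := (mU mu om f).
Local Notation phi := (phi mu f).
Local Notation fh := (fh mu f).
Local Notation wU := (wU mu om f).
Local Notation oneH := (oneH A).
Local Notation oneU := (oneU B).
Let mHA := mHA HA.
Let mUA := mUA HA HB Hf Hc.
Let mU_comm := @mU_comm _ _ _ mu om f HB Hf.
Let homU_mul := @homU_mul _ _ _ mu om f HA HB Hf.
Let homH_mul := @homH_mul _ _ mu HA.
Let homU_w := homU_wU HA HB Hf.
Let mU1l := mU1l mu om f.
Let mU1r := mU1r mu om f.

Lemma mU_comm0 d x y : homU 0 x -> homU d y -> mU x y = mU y x.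
Proof. by move=> hx hy; rewrite (mU_comm hx hy) scale1r. Qed.

Lemma mU_Zl k x y : mU (k *: x) y = k *: mU x y.
Proof. exact: (scale_of_linear (mU_linl mu om f y)). Qed.
Lemma mU_Zr k x y : mU x (k *: y) = k *: mU x y.
Proof. exact: (scale_of_linear (mU_linr mu om f x)). Qed.
Lemma mH_Zl k x y : mH (k *: x) y = k *: mH x y.
Proof. exact: (scale_of_linear (mH_linl mu y)). Qed.
Lemma mH_Zr k x y : mH x (k *: y) = k *: mH x y.
Proof. exact: (scale_of_linear (mH_linr mu x)). Qed.
Lemma phiZ k p : phi (k *: p) = k *: phi p.
Proof. exact: (scale_of_linear (phi_lin mu f)). Qed.
Lemma iAZ k a : iA (k *: a) = k *: iA a :> Ah A.
Proof. exact: (scale_of_linear (@iA_lin _ A)). Qed.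

Definition wpow (g : nat) : Ut B := iter g (fun x => mU x wU) oneU.

Lemma wpow_hom g : homU 0 (wpow g).
Proof.
elim: g => [|g IH]; first exact: homU1.
by have := homU_mul IH homU_w; rewrite addr0.
Qed.

Lemma wpowD g g' : wpow (g + g') = mU (wpow g) (wpow g').
Proof.
elim: g' => [|g' IH]; first by rewrite addn0 mU1r.
by rewrite addnS /= IH mUA.
Qed.

Section Blocks.
Variables (O C : finType).
Implicit Types (x : {ffun O -> A}) (y : {ffun C -> B}).

(* A block is either a boundary circle or a closed input. *)
Definition flatb (b : seq O + C) : seq (O + C) :=
  match b with inl c => map inl c | inr c => [:: inr c] end.
Definition flat (bs : seq (seq O + C)) : seq (O + C) := flatten (map flatb bs).
Definition word x (c : seq O) : Ah A := foldr (fun o p => mH (iA (x o)) p) oneH c.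
Definition bval x y (b : seq O + C) : Ut B :=
  match b with inl c => phi (word x c) | inr c => iB (y c) end.
Definition bprod x y bs : Ut B := foldr (fun b u => mU (bval x y b) u) oneU bs.
Definition surf x y g bs : K := us (mU (wpow g) (bprod x y bs)).

Lemma word_cat x c c' : word x (c ++ c') = mH (word x c) (word x c').
Proof. by elim: c => [|o c IH] /=; rewrite ?mH1l // IH mHA. Qed.

Lemma bprod_cat x y bs bs' : bprod x y (bs ++ bs') = mU (bprod x y bs) (bprod x y bs').
Proof. by elim: bs => [|b bs IH] /=; rewrite ?mU1l // IH mUA. Qed.

Lemma flat_cat bs bs' : flat (bs ++ bs') = flat bs ++ flat bs'.
Proof. by rewrite /flat map_cat flatten_cat. Qed.

Lemma homH_word d x y c : homog d x y -> homH (dg d (map inl c)) (word x c).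
Proof.
move=> [hx _]; elim: c => [|o c IH]; first by rewrite /= dg_nil; apply: homH1.
by rewrite /= dg_cons; apply: homH_mul => //; apply: homH_iA.
Qed.

Lemma homU_bval d x y b : homog d x y -> homU (dg d (flatb b)) (bval x y b).
Proof.
case: b => [c|c] h /=; last by rewrite dg_cons dg_nil addr0; apply: homU_iB; case: h.
exact: (homU_phi HA Hf (homH_word c h)).
Qed.

Lemma homU_bprod d x y bs : homog d x y -> homU (dg d (flat bs)) (bprod x y bs).
Proof.
move=> h; elim: bs => [|b bs IH]; first by rewrite /flat /= dg_nil; apply: homU1.
by rewrite /flat /= dg_cat; apply: homU_mul => //; apply: homU_bval.
Qed.

(** The product of the blocks is the value in the order in which the blocks list their inputs; the
    sign transports it to the order [s]. *)
Definition ssurf d (s : ordering (O + C)%type) x y g bs : K :=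
  (-1) ^+ koszul (fun i => oddz (d i)) (val s) (flat bs) * surf x y g bs.

(** The Koszul sign for exchanging two groups of blocks is the sign with which their values commute,
    so the two cancel. For rotations of a circle, [phi_mulC] plays the same part in [ssurf_rot]. *)
Lemma ssurf_swap d s x y g b1 b2 b3 : homog d x y ->
  perm_eq (flat (b1 ++ b2 ++ b3)) (enum {: O + C}) ->
  ssurf d s x y g (b1 ++ b2 ++ b3) = ssurf d s x y g (b2 ++ b1 ++ b3).
Proof.
move=> h; rewrite /ssurf /surf !flat_cat => ps.
have := koszul_step (fun i => oddz (d i)) s (l0 := [::]) ps; rewrite /= => ->.
rewrite !bprod_cat -(mUA (bprod x y b1)) (mU_comm (homU_bprod b1 h) (homU_bprod b2 h)).
rewrite mU_Zl mU_Zr uZ mUA mulrA -signr_addb !odd_count.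
by rewrite addbK.
Qed.

Lemma ssurf_perm d s x y g bs bs' : homog d x y ->
  perm_eq (flat bs) (enum {: O + C}) -> perm_eq bs bs' ->
  ssurf d s x y g bs = ssurf d s x y g bs'.
Proof.
move=> h ps pb.
pose P l := perm_eq (flat l) (enum {: O + C}) /\ ssurf d s x y g bs = ssurf d s x y g l.
suff [] : P bs' by [].
apply: (catCA_perm_ind _ pb) => [b1 b2 b3 [pf E]|]; last by [].
split; last by rewrite E; apply: ssurf_swap.
by apply: perm_trans pf; rewrite !flat_cat; apply/permPl/perm_catCA.
Qed.

Lemma ssurf_rot d s x y g bs c1 c2 bs' : homog d x y ->
  perm_eq (flat (bs ++ inl (c1 ++ c2) :: bs')) (enum {: O + C}) ->
  ssurf d s x y g (bs ++ inl (c1 ++ c2) :: bs') =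
  ssurf d s x y g (bs ++ inl (c2 ++ c1) :: bs').
Proof.
move=> h; rewrite /ssurf /surf !flat_cat !bprod_cat /= /flat /= !map_cat -!catA => ps.
have := koszul_step (fun i => oddz (d i)) s ps; rewrite /= => ->.
rewrite !word_cat (phi_mulC HA Hf (homH_word c1 h) (homH_word c2 h)).
rewrite mU_Zl !mU_Zr uZ mulrA -signr_addb !odd_count.
by rewrite addbK.
Qed.

Lemma perm_flat_map_inl bs cs cs' : perm_eq cs cs' ->
  perm_eq (flat (map inl cs ++ bs)) (flat (map inl cs' ++ bs)).
Proof.
by move=> pc; rewrite !flat_cat perm_cat2r /flat; apply: perm_flatten; do 2!apply: perm_map.
Qed.

Lemma ssurf_sim d s x y g cs cs' bs : homog d x y ->
  perm_eq (flat (map inl cs ++ bs)) (enum {: O + C}) -> mcsim cs cs' ->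
  ssurf d s x y g (map inl cs ++ bs) = ssurf d s x y g (map inl cs' ++ bs).
Proof.
move=> h pf [cs'' pcs [sz rt]].
rewrite (@ssurf_perm _ _ _ _ _ _ (map inl cs'' ++ bs) h pf); last first.
  by rewrite perm_cat2r; apply: perm_map.
have {}pf : perm_eq (flat (map inl cs'' ++ bs)) (enum {: O + C}).
  by apply: perm_trans pf; rewrite perm_sym perm_flat_map_inl.
(* The prefix [pre] holds the cycles that are already rotated, so that the induction on the
   remaining ones can proceed from left to right. *)
suff H pre : perm_eq (flat (pre ++ map inl cs'' ++ bs)) (enum {: O + C}) ->
    ssurf d s x y g (pre ++ map inl cs'' ++ bs) = ssurf d s x y g (pre ++ map inl cs' ++ bs).
  exact: (H [::] pf).
move=> {pf}; move: pre.
elim: cs' cs'' sz rt {pcs} => [|c cs' IH] [|c'' cs''] //= [sz] rt pre pf.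
have [k /= Ek] := rt 0%N isT.
have E : c = drop k c'' ++ take k c'' by rewrite Ek.
have Ec : c'' = take k c'' ++ drop k c'' by rewrite cat_take_drop.
have -> : ssurf d s x y g (pre ++ inl c'' :: (map inl cs'' ++ bs)) =
          ssurf d s x y g (pre ++ inl c :: (map inl cs'' ++ bs)).
  rewrite E [in LHS]Ec ssurf_rot //; rewrite -Ec.
  exact: pf.
rewrite -!cat_rcons; apply: IH => // [i lti|]; first exact: (rt i.+1).
apply: perm_trans pf; rewrite cat_rcons /flat !map_cat !flatten_cat /= !map_cat !flatten_cat
  perm_cat2l perm_cat2r.
by apply: perm_map; rewrite Ek perm_rot.
Qed.

End Blocks.

Section BlockMaps.
Variables (O O' C C' : finType) (h : O' -> O) (k : C' -> C).
Variables (x : {ffun O -> A}) (x' : {ffun O' -> A}) (y : {ffun C -> B}) (y' : {ffun C' -> B}).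
Hypotheses (xE : forall o, x (h o) = x' o) (yE : forall c, y (k c) = y' c).

Definition bmap (b : seq O' + C') : seq O + C := sum_map (map h) k b.

Lemma flat_bmap bs : flat (map bmap bs) = map (sum_map h k) (flat bs).
Proof.
rewrite /flat map_flatten -!map_comp; congr flatten; apply: eq_map => -[c|c] //=.
by rewrite -!map_comp.
Qed.

Lemma word_map c : word x (map h c) = word x' c.
Proof. by elim: c => //= o c ->; rewrite xE. Qed.

Lemma bprod_map bs : bprod x y (map bmap bs) = bprod x' y' bs.
Proof. by elim: bs => //= -[c|c] bs -> /=; rewrite ?word_map ?yE. Qed.

Lemma surf_map g bs : surf x y g (map bmap bs) = surf x' y' g bs.
Proof. by rewrite /surf bprod_map. Qed.

End BlockMaps.

Section Linear.
Variables (O C : finType).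
Implicit Types (x : {ffun O -> A}) (y : {ffun C -> B}).

Lemma upd_at (T : finType) (W : Type) (w : {ffun T -> W}) t a : upd w t a t = a.
Proof. by rewrite ffunE eqxx. Qed.
Lemma upd_ne (T : finType) (W : Type) (w : {ffun T -> W}) t a z : z != t -> upd w t a z = w z.
Proof. by rewrite ffunE => /negPf ->. Qed.

Lemma word_notin x o a c : o \notin c -> word (upd x o a) c = word x c.
Proof.
elim: c => //= o' c IH; rewrite inE negb_or => /andP[n1 n2].
by rewrite IH // upd_ne // eq_sym.
Qed.

Lemma word_lin x o k a a' c : uniq c -> o \in c ->
  word (upd x o (k *: a + a')) c = k *: word (upd x o a) c + word (upd x o a') c.
Proof.
elim: c => //= o' c IH /andP[n u]; rewrite inE; have [E _|ne /= oc] := eqVneq o o'.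
  by rewrite -E in n *; rewrite !word_notin // !upd_at iA_lin mH_linl.
by rewrite !upd_ne 1?eq_sym // IH // mH_linr.
Qed.

Lemma bval_notinO x y o a b : inl o \notin flatb b -> bval (upd x o a) y b = bval x y b.
Proof.
case: b => //= c n; rewrite word_notin //; apply: contra n; exact: map_f.
Qed.

Lemma bval_linO x y o k a a' b : uniq (flatb b) -> inl o \in flatb b ->
  bval (upd x o (k *: a + a')) y b = k *: bval (upd x o a) y b + bval (upd x o a') y b.
Proof.
case: b => [c|c] /=; last by rewrite inE.
rewrite map_inj_uniq; last by move=> ? ? [].
rewrite mem_map; last by move=> ? ? [].
by move=> u i; rewrite word_lin // phi_lin.
Qed.

Lemma bval_notinC x y c a b : inr c \notin flatb b -> bval x (upd y c a) b = bval x y b.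
Proof. by case: b => //= c'; rewrite inE => n; rewrite upd_ne // eq_sym. Qed.

Lemma bval_linC x y c k a a' b : inr c \in flatb b ->
  bval x (upd y c (k *: a + a')) b = k *: bval x (upd y c a) b + bval x (upd y c a') b.
Proof.
case: b => [l|c'] /=; first by case/mapP.
by rewrite inE => /eqP[<-]; rewrite !upd_at iB_lin.
Qed.

Lemma bprod_notinO x y o a bs : inl o \notin flat bs -> bprod (upd x o a) y bs = bprod x y bs.
Proof.
elim: bs => //= b bs IH; rewrite /flat /= mem_cat negb_or => /andP[n1 n2].
by rewrite bval_notinO // IH.
Qed.

Lemma bprod_notinC x y c a bs : inr c \notin flat bs -> bprod x (upd y c a) bs = bprod x y bs.
Proof.
elim: bs => //= b bs IH; rewrite /flat /= mem_cat negb_or => /andP[n1 n2].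
by rewrite bval_notinC // IH.
Qed.

Lemma bprod_linO x y o k a a' bs : uniq (flat bs) -> inl o \in flat bs ->
  bprod (upd x o (k *: a + a')) y bs = k *: bprod (upd x o a) y bs + bprod (upd x o a') y bs.
Proof.
elim: bs => //= b bs IH; rewrite /flat /= cat_uniq mem_cat => /and3P[u1 /hasPn n u2].
have [i|ni /= i] := boolP (inl o \in flatb b).
  have no : inl o \notin flat bs by apply: contraL i => /n.
  by rewrite !(bprod_notinO _ _ _ no) bval_linO // mU_linl.
by rewrite !(bval_notinO _ _ _ ni) IH // mU_linr.
Qed.

Lemma bprod_linC x y c k a a' bs : uniq (flat bs) -> inr c \in flat bs ->
  bprod x (upd y c (k *: a + a')) bs = k *: bprod x (upd y c a) bs + bprod x (upd y c a') bs.
Proof.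
elim: bs => //= b bs IH; rewrite /flat /= cat_uniq mem_cat => /and3P[u1 /hasPn n u2].
have [i|ni /= i] := boolP (inr c \in flatb b).
  have no : inr c \notin flat bs by apply: contraL i => /n.
  by rewrite !(bprod_notinC _ _ _ no) bval_linC // mU_linl.
by rewrite !(bval_notinC _ _ _ ni) IH // mU_linr.
Qed.

Lemma surf_linO x y o k a a' g bs : uniq (flat bs) -> inl o \in flat bs ->
  surf (upd x o (k *: a + a')) y g bs = k * surf (upd x o a) y g bs + surf (upd x o a') y g bs.
Proof. by move=> u i; rewrite /surf bprod_linO // mU_linr uD uZ. Qed.

Lemma surf_linC x y c k a a' g bs : uniq (flat bs) -> inr c \in flat bs ->
  surf x (upd y c (k *: a + a')) g bs = k * surf x (upd y c a) g bs + surf x (upd y c a') g bs.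
Proof. by move=> u i; rewrite /surf bprod_linC // mU_linr uD uZ. Qed.

End Linear.

Section Phi.
Variables (O C : finType) (M : multicycle O) (g : nat).
Implicit Types (x : {ffun O -> A}) (y : {ffun C -> B}).
Let I := (O + C)%type.

Definition blocks : seq (seq O + C) := map inl M ++ map inr (enum C).

Lemma flat_map_inr (l : seq C) : flat (map inr l) = map inr l :> seq I.
Proof. by elim: l => //= c l; rewrite /flat /= => ->. Qed.

Lemma flat_map_inl (l : seq (seq O)) : flat (map inl l) = map inl (flatten l) :> seq I.
Proof. by elim: l => //= c l; rewrite /flat /= map_cat => ->. Qed.

Lemma flat_inl_perm (cs : seq (seq O)) (l : seq C) :
  perm_eq (flatten cs) (enum O) -> perm_eq l (enum C) ->
  perm_eq (flat (map inl cs ++ map inr l)) (enum {: I}).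
Proof.
by move=> pc pl; rewrite flat_cat flat_map_inl flat_map_inr inputs_perm.
Qed.

Lemma blocks_perm : perm_eq (flat blocks) (enum {: I}).
Proof. exact: flat_inl_perm (multicycleP M) (perm_refl _). Qed.

Definition xpart (p : {ffun I -> bool}) (x : {ffun O -> A}) : {ffun O -> A} :=
  [ffun o => parity_part A (p (inl o)) (x o)].
Definition ypart (p : {ffun I -> bool}) (y : {ffun C -> B}) : {ffun C -> B} :=
  [ffun c => parity_part B (p (inr c)) (y c)].

(* On homogeneous arguments only the term of their parities p survives. *)
Definition phi_ev (s : ordering I) (x : {ffun O -> A}) (y : {ffun C -> B}) : K :=
  \sum_(p : {ffun I -> bool}) (-1) ^+ koszul p (val s) (flat blocks) *
     surf (xpart p x) (ypart p y) g blocks.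

Lemma xpart_upd p x o a : xpart p (upd x o a) = upd (xpart p x) o (parity_part A (p (inl o)) a).
Proof. by apply/ffunP => z; rewrite !ffunE; case: eqP => // ->. Qed.
Lemma ypart_upd p y c a : ypart p (upd y c a) = upd (ypart p y) c (parity_part B (p (inr c)) a).
Proof. by apply/ffunP => z; rewrite !ffunE; case: eqP => // ->. Qed.

Let ub : uniq (flat blocks).
Proof. by rewrite (perm_uniq blocks_perm) enum_uniq. Qed.
Let inb i : i \in flat blocks.
Proof. by rewrite (perm_mem blocks_perm) mem_enum. Qed.

Lemma phi_linO s x y o k a a' :
  phi_ev s (upd x o (k *: a + a')) y = k * phi_ev s (upd x o a) y + phi_ev s (upd x o a') y.
Proof.
rewrite /phi_ev mulr_sumr -big_split; apply: eq_bigr => p _ /=.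
by rewrite !xpart_upd homD homZ surf_linO // mulrDr; congr (_ + _); rewrite mulrCA.
Qed.

Lemma phi_linC s x y o k a a' :
  phi_ev s x (upd y o (k *: a + a')) = k * phi_ev s x (upd y o a) + phi_ev s x (upd y o a').
Proof.
rewrite /phi_ev mulr_sumr -big_split; apply: eq_bigr => p _ /=.
by rewrite !ypart_upd homD homZ surf_linC // mulrDr; congr (_ + _); rewrite mulrCA.
Qed.

Lemma surf_zeroO (x : {ffun O -> A}) (y : {ffun C -> B}) o bs : x o = 0 -> uniq (flat bs) -> inl o
  \in flat bs -> surf x y g bs = 0.
Proof.
move=> xo u i; rewrite -[x](upd_id _ o) xo.
by have := surf_linO x y (-1) 0 0 g u i; rewrite scaler0 addr0 mulN1r addNr.
Qed.
Lemma surf_zeroC (x : {ffun O -> A}) (y : {ffun C -> B}) c bs : y c = 0 -> uniq (flat bs) -> inr c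
  \in flat bs -> surf x y g bs = 0.
Proof.
move=> xo u i; rewrite -[y](upd_id _ c) xo.
by have := surf_linC x y (-1) 0 0 g u i; rewrite scaler0 addr0 mulN1r addNr.
Qed.

Lemma phi_hom s d x y : homog d x y -> phi_ev s x y = ssurf d s x y g blocks.
Proof.
case=> hx hy; pose p0 : {ffun I -> bool} := [ffun i => oddz (d i)].
rewrite /phi_ev (bigD1 p0) //= big1 ?addr0 => [|p pp0]; last first.
  have [i pi] : exists i, p i != oddz (d i).
    apply/existsP; apply: contraNT pp0; rewrite negb_exists => /forallP h.
    by apply/eqP/ffunP => i; rewrite ffunE; apply/eqP; rewrite -[_ == _]negbK.
  case: i pi => i pi.
  - rewrite (@surf_zeroO _ _ i) ?mulr0 //.
    by rewrite ffunE (parity_part_hom _ (hx _)) eq_sym (negPf pi).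
  - rewrite (@surf_zeroC _ _ i) ?mulr0 //.
    by rewrite ffunE (parity_part_hom _ (hy _)) eq_sym (negPf pi).
have -> : xpart p0 x = x.
  by apply/ffunP => o; rewrite !ffunE (parity_part_hom _ (hx _)) eqxx.
have -> : ypart p0 y = y.
  by apply/ffunP => o; rewrite !ffunE (parity_part_hom _ (hy _)) eqxx.
rewrite /ssurf; congr (_ ^+ nat_of_bool _ * _).
by rewrite !koszulE; apply: eq_bigr => i _; apply: eq_bigr => j _; rewrite !ffunE.
Qed.

Lemma phi_sign s t d x y : homog d x y ->
  phi_ev s x y = (-1) ^+ koszul (fun i => oddz (d i)) (val s) (val t) * phi_ev t x y.
Proof.
move=> h; rewrite !(phi_hom _ h) /ssurf mulrA -signr_addb.
congr (_ ^+ nat_of_bool _ * _).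
by have := koszul_cocycle (fun i => oddz (d i)) s t (mk_ordering blocks_perm) => /= ->.
Qed.

Lemma phi_deg s d x y : homog d x y -> \sum_i d i != 0 -> phi_ev s x y = 0.
Proof.
move=> h d0; rewrite (phi_hom _ h) /ssurf /surf.
have := homU_mul (wpow_hom g) (homU_bprod blocks h).
rewrite add0r => -[_]; case; last by move=> _ _ -> _; rewrite mulr0.
by move: d0; rewrite /dg (perm_big _ blocks_perm) big_enum.
Qed.

Definition Phi : endo A B O C := Endo phi_linO phi_linC phi_sign phi_deg.

(** The working formula for [Phi]: any presentation of the multicycle and any order of its blocks
    may be used, and there is no sign when the inputs are listed as the blocks list them. *)
Lemma Phi_evl d x y cs bs : homog d x y -> mcsim M cs ->
  perm_eq bs (map inl cs ++ map inr (enum C)) ->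
  evl Phi (flat bs) x y = surf x y g bs.
Proof.
move=> h sm pb.
have pcs := perm_trans (mcsim_flatten sm) (multicycleP M).
have pf2 := flat_inl_perm pcs (perm_refl (enum C)).
have pf : perm_eq (flat bs) (enum {: I}).
  by apply: perm_trans pf2; rewrite /flat; apply/perm_flatten/perm_map.
rewrite -(evl_mk _ pf) /= (phi_hom _ h).
rewrite (ssurf_sim _ _ h blocks_perm sm).
rewrite perm_sym in pb.
rewrite (ssurf_perm _ _ h pf2 pb).
by rewrite /ssurf /= koszul_id mul1r.
Qed.

End Phi.

(** The sign in [koszul_scale] is that of rotating the letter around the rest of the circle. This
    converts the leg placed in front by [octr_evl] into the one placed behind by [phi_merge]. *)
Lemma phi_koszul_scale d p g e : homH d p -> e \in hom A g ->
  phi (mH (iA (koszul_scale A d e)) p) = phi (mH p (iA e)).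
Proof.
move=> hp he; rewrite (koszul_scaleE _ he) iAZ mH_Zl phiZ.
rewrite (phi_mulC HA Hf (homH_iA he) hp) scalerA -signr_addb andbC addbb.
by rewrite scale1r.
Qed.

Lemma us_sum I (r : seq I) (F : I -> Ut B) : us (\sum_(i <- r) F i) = \sum_(i <- r) us (F i).
Proof. by have [_ _ _ ->] := u_sum r F. Qed.

Lemma mc_uniq (O : finType) (M : multicycle O) : uniq (flatten M).
Proof. by rewrite (perm_uniq (multicycleP M)) enum_uniq. Qed.
Lemma mc_mem (O : finType) (M : multicycle O) o : o \in flatten M.
Proof. by rewrite (perm_mem (multicycleP M)) mem_enum. Qed.

(** * Compatibility with contractions *)

Section Contractions.
Variables (O C : finType).

Lemma flat_cons (O' C' : finType) (b : seq O' + C') bs : flat (b :: bs) = flatb b ++ flat bs.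
Proof. by []. Qed.

(** If [u] and [v] lie on one circle u P v Q, this is [phi_cut]. If they lie on two circles, it is
    [phi_merge], whose factor [wU] is the additional handle. *)
Lemma Phi_octr (M : multicycle O) (u v : O) (uv : u != v) g :
  endo_octr uv (Phi C M g) =
  Phi C (mc_contract uv M) (if same_cycle M u v then g else g.+1).
Proof.
have [nu nv] := contract_notin uv M.
have Ecy : cycles (mc_contract uv M) = map (sub u v) (contract_cycles M u v) by [].
apply: (endo_ext_homog (blocks_perm C (mc_contract uv M))) => d x y h.
rewrite [RHS](Phi_evl _ h (mcsim_refl _) (perm_refl _)).
have pl := blocks_perm C (mc_contract uv M).
have valx e1 e2 z : ext2 x e1 e2 (val z) = x z by exact: ext2_val.
have idy z : y (id z) = y z by [].
rewrite /blocks in pl *; rewrite Ecy in pl *.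
case: ifPn => sc.
- have [P [Q [R [Ec sm]]]] := contract_same uv (mc_uniq M) (mc_mem M u) sc.
  rewrite Ec in nu nv; rewrite Ec /= in pl *.
  move: nu nv; rewrite /= !mem_cat !negb_or => /and3P[uP uQ uR] /and3P[vP vQ vR].
  set P' := sub u v P in pl *; set Q' := sub u v Q in pl *; set R' := map _ R in pl *.
  set T := map inl R' ++ map inr (enum C) in pl *.
  rewrite 2!flat_cons /= in pl; rewrite 2!flat_cons /=.
  rewrite (octr_evl uv (Phi C M g) h pl).
  have hp := homH_word P' h.
  (* On the contracted side the factors of the two new circles stand next to each other and are
     joined by [phi_cut]; the sums over the copairing are then compared term by term. *)
  rewrite /surf /= -(mUA (phi (word x P'))) -(phi_cut HA HB Hf Hc (word x Q') hp).
  rewrite (lin_sum (mU_linl mu om f _)) (lin_sum (mU_linr mu om f _)) us_sum.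
  rewrite !big_seq; apply: eq_bigr => e /copairing_hom[a [h1 h2]].
  have h1' : koszul_scale A (dg d (map inl P')) e.1 \in hom A a.
    by rewrite (koszul_scaleE _ h1) memvZ.
  have [D [hD _ _ _]] := octr_homog uv h h1' h2.
  have EP : map val P' = P by apply: map_val_sub.
  have EQ : map val Q' = Q by apply: map_val_sub.
  have ET : map inl R ++ map inr (enum C) = map (bmap val id) T.
    by rewrite map_cat -!map_comp -{1}(map_val_sub_all uR vR) -!map_comp.
  have EL : inl u :: map (sum_map val id) (map inl P') ++ inl v :: map (sum_map val id) (map inl Q')
      ++ map (sum_map val id) (flat T) =
      flat (inl (u :: P ++ v :: Q) :: map inl R ++ map inr (enum C)).
    by rewrite ET flat_cons flat_bmap /= map_cat -catA /= -EP -EQ -!map_comp.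
  rewrite EL (Phi_evl _ hD sm) // /surf /= ET.
  rewrite (bprod_map (valx _ _) idy) word_cat //= ext2_u ext2_v //.
  by rewrite -EP -EQ !(word_map (valx _ _)).
have [P [Q [R [Ec sm]]]] := contract_diff uv (mc_uniq M) (mc_mem M u) (mc_mem M v) sc.
rewrite Ec in nu nv; rewrite Ec /= sub_cat in pl *.
move: nu nv; rewrite /= !mem_cat !negb_or => /andP[/andP[uP uQ] uR] /andP[/andP[vP vQ] vR].
set P' := sub u v P in pl *; set Q' := sub u v Q in pl *; set R' := map _ R in pl *.
set T := map inl R' ++ map inr (enum C) in pl *.
rewrite flat_cons /= map_cat -catA in pl; rewrite flat_cons /= map_cat -catA.
rewrite (octr_evl uv (Phi C M g) h pl).
have hp := homH_word P' h; have hq := homH_word Q' h.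
have hpq := homU_phi HA Hf (homH_mul hp hq).
(* The last handle has degree 0 and is moved next to the merged circle, where [phi_merge] replaces
   both by a sum over two circles. *)
rewrite /surf /= word_cat // mUA -(mUA wU) (mU_comm0 homU_w hpq).
rewrite -(phi_merge HA HB Hf Hc).
rewrite (lin_sum (mU_linl mu om f _)) (lin_sum (mU_linr mu om f _)) us_sum.
rewrite !big_seq; apply: eq_bigr => e /copairing_hom[a [h1 h2]].
have h1' : koszul_scale A (dg d (map inl P')) e.1 \in hom A a.
  by rewrite (koszul_scaleE _ h1) memvZ.
have [D [hD _ _ _]] := octr_homog uv h h1' h2.
have EP : map val P' = P by apply: map_val_sub.
have EQ : map val Q' = Q by apply: map_val_sub.
have ET : map inl R ++ map inr (enum C) = map (bmap val id) T.
  by rewrite map_cat -!map_comp -{1}(map_val_sub_all uR vR) -!map_comp.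
have EL : inl u :: map (sum_map val id) (map inl P') ++ inl v :: map (sum_map val id) (map inl Q')
    ++ map (sum_map val id) (flat T) =
    flat (inl (u :: P) :: inl (v :: Q) :: map inl R ++ map inr (enum C)).
  by rewrite ET !flat_cons flat_bmap /= -EP -EQ -!map_comp.
rewrite EL (Phi_evl _ hD sm) // /surf /= ET.
rewrite (bprod_map (valx _ _) idy) ext2_u ext2_v //.
rewrite -EP -EQ !(word_map (valx _ _)) (phi_koszul_scale hp h1).
by rewrite mUA.
Qed.

(** The handle element is by construction the product of the two legs of the copairing of [B]. One
    handle is expanded and, being of degree 0, moved behind the circles to the place of the closed
    inputs [u] and [v]. *)
Lemma Phi_cctr (M : multicycle O) (u v : C) (uv : u != v) g :
  endo_cctr uv (Phi C M g) = Phi (without2 u v) M g.+1.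
Proof.
apply: (endo_ext_homog (blocks_perm (without2 u v) M)) => d x y h.
rewrite [RHS](Phi_evl _ h (mcsim_refl _) (perm_refl _)).
have pl := blocks_perm (without2 u v) M.
rewrite /blocks flat_cat in pl *.
rewrite (cctr_evl uv (Phi C M g) h pl).
set P := map inl M; set T := map inr _.
have idx z : x (id z) = x z by [].
have valy e1 e2 z : ext2 y e1 e2 (val z) = y z by exact: ext2_val.
have hP := homU_bprod P h.
rewrite /surf bprod_cat // /= mUA -(mUA wU).
have -> : mU wU (bprod x y P) = mU (bprod x y P) wU by apply: mU_comm0 hP.
rewrite [X in us (mU _ (mU (mU _ X) _))]/wU.
rewrite mUA (lin_sum (mU_linl mu om f _)) !(lin_sum (mU_linr mu om f _)) us_sum.
rewrite !big_seq; apply: eq_bigr => e /copairing_hom[a [h1 h2]].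
have [D [hD _ _ _]] := cctr_homog uv h h1 h2.
have EL : map (sum_map id val) (flat P) ++ inr u :: inr v :: map (sum_map id val) (flat T) =
  flat (map inl M ++ inr u :: inr v :: map inr (map val (enum (without2 u v)))).
  rewrite flat_cat 2!flat_cons /= -!flat_bmap; congr (flat _ ++ _ :: _ :: flat _).
    by rewrite /P -map_comp; apply: eq_map => c /=; rewrite map_id.
  by rewrite /T -!map_comp.
rewrite EL (Phi_evl _ hD (mcsim_refl _)); last first.
  rewrite perm_cat2l -!map_cons perm_map //; apply: uniq_perm; rewrite ?enum_uniq //.
    rewrite /= map_inj_uniq ?enum_uniq ?andbT; last exact: val_inj.
    rewrite inE negb_or uv; apply/andP.
    split; apply/mapP => -[z _ E]; have /andP[/eqP a1 /eqP a2] := valP z.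
      exact: a1 (esym E).
    exact: a2 (esym E).
  move=> z; rewrite mem_enum !inE; have [->|zu] := eqVneq z u; first by [].
  have [->|zv] /= := eqVneq z v; first by [].
  have zz : (z != u) && (z != v) by rewrite zu.
  by apply/mapP; exists (exist _ z zz) => //; rewrite mem_enum.
rewrite /surf bprod_cat //= ext2_u ext2_v //.
have -> : bprod x (ext2 y e.1 e.2) (map inl M) = bprod x y P.
  rewrite /P; elim: (cycles M) => //= c l ->; by [].
have -> : bprod x (ext2 y e.1 e.2) (map inr (map val (enum (without2 u v)))) = bprod x y T.
  by rewrite /T -(bprod_map idx (valy e.1 e.2)) -!map_comp.
by rewrite !mUA.
Qed.

End Contractions.

Lemma mc_iso_sim (O O' : finType) (M : multicycle O) (M' : multicycle O') (h : mc_iso M M') :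
  mcsim M (map (map (binv h)) M').
Proof.
case: h => h ic nE /=.
exists [seq nth [::] M (binv ic i) | i <- enum 'I_(size M')].
  have E : [seq nth [::] M i | i <- iota 0 (size M)] = cycles M.
    by rewrite map_nth_iota0 ?take_size.
  rewrite -[X in perm_eq X _]E -val_enum_ord -map_comp.
  have -> : [seq nth [::] M (binv ic i) | i <- enum 'I_(size M')] =
      [seq nth [::] M (val i) | i <- map (binv ic) (enum 'I_(size M'))].
    by rewrite -[RHS]map_comp; apply: eq_map.
  apply: perm_map; apply: uniq_perm; first exact: enum_uniq.
    by rewrite map_inj_uniq ?enum_uniq //; apply: can_inj (binvK ic).
  move=> i; rewrite mem_enum; symmetry; apply/mapP; exists (ic i); rewrite ?mem_enum //.
  by rewrite bfunK.
split; first by rewrite [RHS]size_map [LHS]size_map size_enum_ord.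
rewrite size_map => i lti; pose j := binv ic (Ordinal lti).
have [r Er] := nE j; exists r.
rewrite (nth_map [::]) // (nth_map (Ordinal lti)) ?size_enum_ord //.
have -> : nth (Ordinal lti) (enum 'I_(size M')) i = Ordinal lti.
  by apply: val_inj; rewrite /= nth_enum_ord.
have Ei : i = ic j by rewrite /j binvK.
rewrite [in LHS]Ei Er map_rot -map_comp.
by rewrite (eq_map (f := _ \o _) (g := id)) ?map_id // => o /=; rewrite bfunK.
Qed.

Lemma Phi_relabel (O O' C C' : finType) (M : multicycle O) (M' : multicycle O')
    (h : mc_iso M M') (k : bijection C C') g :
  Phi C' M' g = endo_relabel (bfunK h) (binvK h) (bfunK k) (binvK k) (Phi C M g).
Proof.
apply: (endo_ext_homog (blocks_perm C' M')) => d x y hd.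
rewrite (Phi_evl _ hd (mcsim_refl _) (perm_refl _)).
rewrite relabel_evl ?blocks_perm // -flat_bmap /blocks.
have EB : map (bmap (binv h) (binv k)) (map inl M' ++ map inr (enum C')) =
    map inl (map (map (binv h)) M') ++ map inr (map (binv k) (enum C')).
  by rewrite map_cat -!map_comp.
have sm : mcsim M (map (map (binv h)) M').
  exact: mc_iso_sim.
have pk : perm_eq (map (binv k) (enum C')) (enum C).
  apply: uniq_perm.
  - by rewrite map_inj_uniq ?enum_uniq //; apply: can_inj (binvK k).
  - exact: enum_uniq.
  move=> c; rewrite mem_enum; apply/mapP; exists (k c); rewrite ?mem_enum //.
  by rewrite bfunK.
have idx o : [ffun o => x (h o)] (binv h o) = x o by rewrite ffunE binvK.
have idy c : [ffun c => y (k c)] (binv k c) = y c by rewrite ffunE binvK.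
have hd' := homog_relabel h k hd.
rewrite -(surf_map idx idy) EB (Phi_evl _ hd' sm) //.
by rewrite perm_cat2l perm_map.
Qed.

(** * Gluing of two surfaces *)

Section Stability.
Variables (O C : finType).
Implicit Types (x : {ffun O -> A}) (y : {ffun C -> B}).

Lemma hk_word x c : c != [::] -> hk (word x c) = 0.
Proof. by case: c => //= o c _; rewrite /mH /iA !mkHE mul0r. Qed.

Lemma ur_mU a b : ur (mU a b) = ur a * ur b.
Proof. by rewrite /mU !mkUE. Qed.
Lemma uq_mU a b : uq (mU a b) = ur a * uq b + uq a * ur b.
Proof. by rewrite /mU !mkUE. Qed.

Lemma ur_bval x y b : ur (bval x y b) = 0.
Proof. by case: b => c /=; rewrite /phi /iB !mkUE. Qed.

Lemma ur_bprod x y bs : bs != [::] -> ur (bprod x y bs) = 0.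
Proof. by case: bs => //= b bs _; rewrite ur_mU ur_bval mul0r. Qed.

Lemma ur_wU : ur wU = 0 /\ uq wU = 0.
Proof.
rewrite /wU; have [-> -> _ _ _] := u_sum (copairing B) (fun c => mU (iB c.1) (iB c.2)).
by split; rewrite big1 // => c _; rewrite /mU /iB !mkUE ?(mul0r, mulr0, addr0).
Qed.

Lemma ur_wpow g : ur (wpow g) = (g == 0%N)%:R /\ uq (wpow g) = 0.
Proof.
have [w1 w2] := ur_wU.
case: g => [|g]; first by rewrite /= /oneU !mkUE.
by rewrite /= ur_mU uq_mU w1 w2 !mulr0 addr0.
Qed.

(* Stability excludes the surfaces on which the units adjoined to A and B would
   be seen by the gluing formulas ht_snake and us_snake. *)
Definition stab (M : multicycle O) (g : nat) : bool :=
  stable #|O| #|C| (4 * g + 2 * size M + #|C| - 2).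

(** The first factor can be nonzero only if [u] is alone on its circle, the second only if there is
    no other block and no handle. Together they describe the disc whose single input is [u], which
    is unstable. *)
Lemma ocomp_stab (M : multicycle O) u g P R x y : stab M g ->
  mcsim M ((u :: P) :: R) ->
  hk (word x P) * ur (mU (wpow g) (bprod x y (map inl R ++ map inr (enum C)))) = 0.
Proof.
move=> st sm; rewrite ur_mU (ur_wpow g).1.
case: P sm => [|o P] sm; last by rewrite hk_word // mul0r.
case: R sm => [|c R] sm; last by rewrite ur_bprod // !mulr0.
case E: (enum C) => [|c l]; last by rewrite ur_bprod // !mulr0.
case: g st => [|g] st; last by rewrite mul0r mulr0.
exfalso; move: st; rewrite /stab /stable.
have -> : #|C| = 0%N by rewrite cardE E.
have -> : #|O| = 1%N.
  have := perm_size (perm_trans (mcsim_flatten sm) (multicycleP M)).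
  by rewrite -cardE => <-.
by case: sm => cs p [s _]; rewrite (perm_size p) s.
Qed.

(** The only products with a component along 1 or eta are the empty one and a single empty
    circle. *)
Lemma bprod_small x y bs : (exists c, inr c \in bs) \/ (1 < size bs)%N \/ has (fun b => b != inl
  [::]) bs ->
  ur (bprod x y bs) = 0 /\ uq (bprod x y bs) = 0.
Proof.
case: bs => [|b [|b' bs]]; first by case=> [[]|[|]].
- move=> H; rewrite ur_bprod // /= uq_mU ur_bval mul0r add0r /oneU !mkUE mulr1; split=> //.
  have {H} : b != inl [::] by case: H => [[c]|[|]] //=; rewrite ?orbF // inE => /eqP <-.
  case: b => [c|c] /=; last by rewrite /iB !mkUE.
  by move=> n; rewrite /phi !mkUE hk_word //; apply: contra n => /eqP ->.
by move=> _; rewrite ur_bprod // /= uq_mU ur_mU !ur_bval ?(mul0r, mulr0, addr0).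
Qed.

(** Without handles, a component along 1 or eta would require a sphere, or a disc with empty
    boundary, on which [u] is the only input. Both are unstable. *)
Lemma ccomp_stab (M : multicycle O) (u : C) l g x y (X := mU (wpow g) (bprod x y (map inl M ++ map
  inr l))) :
  stab M g -> perm_eq (u :: l) (enum C) -> ur X = 0 /\ uq X = 0.
Proof.
move=> st pl; rewrite /X ur_mU uq_mU (ur_wpow g).1 (ur_wpow g).2.
case: g st {X} => [|g] st; last by rewrite !mul0r addr0.
suff /(bprod_small x y) [-> ->] : (exists c : C, inr c \in (map inl M ++ map inr l : seq (seq O +
  C))) \/
   (1 < size (map inl M ++ map inr l : seq (seq O + C)))%N \/
   has (fun b : seq O + C => b != inl [::]) (map inl M ++ map inr l).
  by rewrite !mulr0 addr0.
case: l pl => [|c l] pl; last by left; exists c; rewrite mem_cat /= inE eqxx orbT.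
right; rewrite cats0 size_map.
have cC : #|C| = 1%N by rewrite cardE -(perm_size pl).
have pO := multicycleP M; move: st; rewrite /stab /stable cC.
case: (cycles M) pO => [|c1 [|c2 cs]] pO /=; last by left.
  by rewrite cardE -(perm_size pO).
move=> st; right; rewrite orbF; case: c1 pO st => //.
by move=> pO; rewrite cardE -(perm_size pO).
Qed.

End Stability.

Lemma bmap_split (O O' C C' : finType) (h : O' -> O) (k : C' -> C) cs l :
  map (bmap h k) (map inl cs ++ map inr l) = map inl (map (map h) cs) ++ map inr (map k l).
Proof. by rewrite map_cat -!map_comp. Qed.

Lemma mcsim_open_rcons (T : eqType) (cs : seq (seq T)) u : uniq (flatten cs) -> u \in flatten cs ->
  mcsim cs (rcons (open_at (cycle_of cs u) u) u :: [seq c <- cs | u \notin c]).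
Proof.
move=> ucs uin; have [uc _] := cycle_ofP uin.
rewrite -rot1_cons -(rot_open_at uc) -rotS ?index_mem //.
exact/mcsim_perm_head/perm_cycle_of.
Qed.

Section Compositions.
Variables (O1 O2 C1 C2 : finType).
Variables (M1 : multicycle O1) (M2 : multicycle O2) (g1 g2 : nat).
Hypotheses (st1 : stab C1 M1 g1) (st2 : stab C2 M2 g2).

Lemma perm_enum_sum (T1 T2 : finType) :
  perm_eq (map inl (enum T1) ++ map inr (enum T2)) (enum {: T1 + T2}).
Proof. exact: inputs_perm (perm_refl _) (perm_refl _). Qed.

(** Seen from one of its circles, the rest of a surface, handles included, acts on the word of that
    circle through [fh]. Open gluing thereby becomes a statement about the enlarged algebra of
    [A]. *)
Lemma us_head g d p X e : homH d p -> homU e X ->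
  us (mU (wpow g) (mU (phi p) X)) = ht (mH p (fh (mU (wpow g) X))).
Proof.
move=> hp hX; rewrite -mUA (mU_comm0 (wpow_hom g) (homU_phi HA Hf hp)) mUA.
by rewrite us_phi.
Qed.

(** By [us_head] each surface is its word through the glued input, multiplied by the central element
    [fh] of everything else. The snake identity joins the two, multiplicativity of [fh] unites the
    remaining parts, and centrality sorts the factors. *)
Lemma Phi_ocomp (u : O1) (v : O2) :
  endo_octr (inl_neq_inr u v) (endo_tensor (Phi C1 M1 g1) (Phi C2 M2 g2)) =
  Phi (C1 + C2)%type (mc_merge M1 M2 u v) (g1 + g2).
Proof.
pose P1 := open_at (cycle_of M1 u) u; pose P2 := open_at (cycle_of M2 v) v.
pose R1 := [seq c <- M1 | u \notin c]; pose R2 := [seq c <- M2 | v \notin c].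
have sm1 : mcsim M1 ((u :: P1) :: R1) by apply: mcsim_open; rewrite ?mc_uniq ?mc_mem.
have sm2 : mcsim M2 ((v :: P2) :: R2) by apply: mcsim_open; rewrite ?mc_uniq ?mc_mem.
have [nu nv] := contract_notin (inl_neq_inr u v) (mc_union M1 M2).
have Ecc : contract_cycles (mc_union M1 M2) (inl u) (inr v) =
    (map inl P1 ++ map inr P2) :: map (map inl) R1 ++ map (map inr) R2.
  exact: (merge_cycles (mc_mem M1 u) (mc_mem M2 v)).
rewrite Ecc /= flatten_cat !mem_cat !negb_or in nu nv.
case/andP: nu => /andP[uP1 uP2] /andP[uR1 uR2].
case/andP: nv => /andP[vP1 vP2] /andP[vR1 vR2].
pose sb := sub (inl u : O1 + O2) (inr v).
pose P1s := sb (map inl P1); pose P2s := sb (map inr P2).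
pose b1 : seq (seq O1 + C1) := map inl R1 ++ map inr (enum C1).
pose b2 : seq (seq O2 + C2) := map inl R2 ++ map inr (enum C2).
pose B1 : seq (seq (without2 (inl u : O1 + O2) (inr v)) + (C1 + C2)) :=
  map inl (map sb (map (map inl) R1)) ++ map inr (map inl (enum C1)).
pose B2 : seq (seq (without2 (inl u : O1 + O2) (inr v)) + (C1 + C2)) :=
  map inl (map sb (map (map inr) R2)) ++ map inr (map inr (enum C2)).
have EP1 : map val P1s = map inl P1 by apply: map_val_sub.
have EP2 : map val P2s = map inr P2 by apply: map_val_sub.
have EB1 : map (bmap val id) B1 = map (bmap inl inl) b1.
  by rewrite !bmap_split map_id map_val_sub_all.
have EB2 : map (bmap val id) B2 = map (bmap inr inr) b2.
  by rewrite !bmap_split map_id map_val_sub_all.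
pose bs := inl (P1s ++ P2s) :: B1 ++ B2.
have pbs : perm_eq bs (map inl (mc_merge M1 M2 u v) ++ map inr (enum {: C1 + C2})).
  have -> : cycles (mc_merge M1 M2 u v) =
      (P1s ++ P2s) :: map sb (map (map inl) R1) ++ map sb (map (map inr) R2).
    transitivity (map sb (contract_cycles (mc_union M1 M2) (inl u) (inr v))); first by [].
    by rewrite Ecc map_cons map_cat /sb sub_cat.
  rewrite map_cons map_cat cat_cons /bs perm_cons perm_catACA perm_cat2l -map_cat.
  by rewrite perm_map // perm_enum_sum.
have pfl : perm_eq (flat bs) (enum {: without2 (inl u : O1 + O2) (inr v) + (C1 + C2)}).
  apply: (perm_trans _ (blocks_perm (C1 + C2)%type (mc_merge M1 M2 u v))).
  by rewrite /flat; apply/perm_flatten/perm_map.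
(* The inputs of the first surface precede those of the second, as [ocomp_evl] requires. The glued
   surface lists [P2s] before [B1]; the sign of this exchange is that of commuting [fh X1] with
   [p2]. *)
pose S := map inl P1s ++ flat B1 ++ map inl P2s ++ flat B2.
have Efl : flat bs = map inl P1s ++ map inl P2s ++ flat B1 ++ flat B2.
  by rewrite /bs flat_cons flat_cat /= map_cat -catA.
have pS : perm_eq S (enum {: without2 (inl u : O1 + O2) (inr v) + (C1 + C2)}).
  apply: perm_trans pfl; rewrite Efl perm_cat2l; exact/permPl/perm_catCA.
apply: (endo_ext_homog pS) => d x y h.
have ES : map (sum_map val id) S =
    map (sum_map inl inl) (map inl P1 ++ flat b1) ++ map (sum_map inr inr) (map inl P2 ++ flat b2).
  rewrite /S !map_cat -!flat_bmap EB1 EB2 -!map_comp.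
  rewrite -[map (_ \o inl) P1s]/(map (inl \o val) P1s) map_comp EP1.
  rewrite -[map (_ \o inl) P2s]/(map (inl \o val) P2s) map_comp EP2.
  by rewrite -!map_comp -catA.
rewrite (ocomp_evl _ _ h pS ES) [RHS](evl_swap _ (map inl P1s) (flat B1) (map inl P2s) (flat B2) h).
rewrite -Efl (Phi_evl _ h (mcsim_refl _) pbs).
have hp1 := homH_word P1s h; have hp2 := homH_word P2s h.
have hB1 := homU_bprod B1 h; have hB2 := homU_bprod B2 h.
have hp12 := homH_mul hp1 hp2; have hB12 := homU_mul hB1 hB2.
set p1 := word x P1s in hp1 hp12 *; set p2 := word x P2s in hp2 hp12 *.
pose X1 := mU (wpow g1) (bprod x y B1); pose X2 := mU (wpow g2) (bprod x y B2).
have hX1 : homU (dg d (flat B1)) X1 by have := homU_mul (wpow_hom g1) hB1; rewrite add0r.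
have hX2 : homU (dg d (flat B2)) X2 by have := homU_mul (wpow_hom g2) hB2; rewrite add0r.
have -> : surf x y (g1 + g2) bs = ht (mH (mH p1 p2) (mH (fh X1) (fh X2))).
  rewrite /surf /bs /= bprod_cat // word_cat // -/p1 -/p2 (us_head _ hp12 hB12).
  congr (ht (mH _ _)); rewrite -(fhM HA Hf Hc) /X1 /X2 wpowD // !mUA; congr (fh (mU _ _)).
  rewrite -!mUA; congr mU; exact: mU_comm0 (wpow_hom _) hB1.
have C21 := fh_central HA Hf hX1 hp2.
have -> : (-1) ^+ (oddz (dg d (flat B1)) && oddz (dg d (map inl P2s))) *
   ht (mH (mH p1 p2) (mH (fh X1) (fh X2))) = ht (mH (mH p1 (fh X1)) (mH p2 (fh X2))).
  rewrite !mHA -(mHA (fh X1)) C21 mH_Zl mH_Zr hZ !mHA.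
  by [].
have valx e1 e2 z : ext2 x e1 e2 (val z) = x z by exact: ext2_val.
have idy z : y (id z) = y z by [].
pose x1 e1 e2 : {ffun O1 -> A} := [ffun o => ext2 x e1 e2 (inl o)].
pose x2 e1 e2 : {ffun O2 -> A} := [ffun o => ext2 x e1 e2 (inr o)].
pose y1 : {ffun C1 -> B} := [ffun c => y (inl c)].
pose y2 : {ffun C2 -> B} := [ffun c => y (inr c)].
have x1E e1 e2 o : ext2 x e1 e2 (inl o) = x1 e1 e2 o by rewrite [RHS]ffunE.
have x2E e1 e2 o : ext2 x e1 e2 (inr o) = x2 e1 e2 o by rewrite [RHS]ffunE.
have y1E c : y (inl c) = y1 c by rewrite [RHS]ffunE.
have y2E c : y (inr c) = y2 c by rewrite [RHS]ffunE.
have Ep1 e1 e2 : word (x1 e1 e2) P1 = p1.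
  by rewrite -(word_map (x1E e1 e2)) -EP1 (word_map (valx e1 e2)).
have Ep2 e1 e2 : word (x2 e1 e2) P2 = p2.
  by rewrite -(word_map (x2E e1 e2)) -EP2 (word_map (valx e1 e2)).
have Eb1 e1 e2 : bprod (x1 e1 e2) y1 b1 = bprod x y B1.
  by rewrite -(bprod_map (x1E e1 e2) y1E) -EB1 (bprod_map (valx e1 e2) idy).
have Eb2 e1 e2 : bprod (x2 e1 e2) y2 b2 = bprod x y B2.
  by rewrite -(bprod_map (x2E e1 e2) y2E) -EB2 (bprod_map (valx e1 e2) idy).
have hkE p z : hk (mH p (fh z)) = hk p * ur z by rewrite /mH /fh !mkHE.
have k1 : hk (mH p1 (fh X1)) = 0.
  by rewrite hkE -(Ep1 0 0) /X1 -(Eb1 0 0); apply: ocomp_stab st1 sm1.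
have k2 : hk (mH p2 (fh X2)) = 0.
  by rewrite hkE -(Ep2 0 0) /X2 -(Eb2 0 0); apply: ocomp_stab st2 sm2.
rewrite -(ht_snake mu k1 k2) !big_seq; apply: eq_bigr => e /copairing_hom[a [h1 h2]].
have [D [hD Dl Du Dv]] := octr_homog (inl_neq_inr u v) h h1 h2.
rewrite -/(x1 e.1 e.2) -/(x2 e.1 e.2) -/y1 -/y2; congr (_ * _).
  have hl := homog_left hD.
  (* The input [u] stands behind the blocks of [b1] but belongs to the end of its circle. Moving it
     there costs the sign with which [fh X1] commutes with the letter [e.1]. *)
  rewrite -catA -[_ ++ _ ++ _]cats0 -!catA (evl_swap _ (map inl P1) (flat b1) [:: inl u] [::] hl).
  rewrite cats0.
  have -> : map inl P1 ++ [:: inl u] ++ flat b1 = flat (inl (rcons P1 u) :: b1).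
    by rewrite flat_cons /= map_rcons cat_rcons.
  have sm1' : mcsim M1 (rcons P1 u :: R1) by apply: mcsim_open_rcons; rewrite ?mc_uniq ?mc_mem.
  rewrite (Phi_evl _ hl sm1') // /surf /=.
  have hb1 := homU_bprod b1 hl.
  rewrite (us_head _ (homH_word (rcons P1 u) hl) hb1).
  rewrite -cats1 word_cat // -/(x1 e.1 e.2) -/y1 Ep1 Eb1 -/X1 /= -x1E ext2_u mH1r mHA.
  rewrite [in RHS]mHA (fh_central HA Hf hX1 (homH_iA h1)) mH_Zr hZ.
  congr (_ ^+ nat_of_bool _ * _); rewrite dg_cons dg_nil addr0 /= Du; congr (oddz _ && _).
  rewrite -(dg_map (sum_map inl inl) D) -flat_bmap -EB1 flat_bmap dg_map.
  by rewrite /dg; apply: eq_bigr => i _; apply: Dl.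
have hr := homog_right hD.
have -> : inl v :: map inl P2 ++ flat b2 = flat (inl (v :: P2) :: b2) by [].
rewrite (Phi_evl _ hr sm2) // /surf /=.
have hb2 := homU_bprod b2 hr.
rewrite (us_head _ (homH_word (v :: P2) hr) hb2).
by rewrite /= -/(x2 e.1 e.2) -/y2 Ep2 Eb2 -x2E ext2_v // mHA.
Qed.

Lemma Phi_ccomp (u : C1) (v : C2) :
  endo_cctr (inl_neq_inr u v) (endo_tensor (Phi C1 M1 g1) (Phi C2 M2 g2)) =
  Phi (without2 (inl u : C1 + C2) (inr v)) (mc_union M1 M2) (g1 + g2).
Proof.
pose l1 := rem u (enum C1); pose l2 := rem v (enum C2).
have pl1 : perm_eq (u :: l1) (enum C1) by rewrite perm_sym perm_to_rem ?mem_enum.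
have pl2 : perm_eq (v :: l2) (enum C2) by rewrite perm_sym perm_to_rem ?mem_enum.
pose sb := sub (inl u : C1 + C2) (inr v).
have [nu1 nv1 nu2 nv2] := inl_inr_notin (negbT (mem_rem_uniqF u (enum_uniq C1)))
  (negbT (mem_rem_uniqF v (enum_uniq C2))).
have El1 : map val (sb (map inl l1)) = map inl l1 by apply: map_val_sub.
have El2 : map val (sb (map inr l2)) = map inr l2 by apply: map_val_sub.
have pJ : perm_eq (sb (map inl l1) ++ sb (map inr l2)) (enum (without2 (inl u : C1 + C2) (inr v))).
  rewrite -sub_cat; apply: sub_perm; apply: perm_trans (inputs_perm pl1 pl2).
  by rewrite /= perm_cons -cat1s perm_catCA.
pose b1 : seq (seq O1 + C1) := map inl M1 ++ map inr l1.
pose b2 : seq (seq O2 + C2) := map inl M2 ++ map inr l2.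
pose B1 : seq (seq (O1 + O2) + (without2 (inl u : C1 + C2) (inr v))) :=
  map inl (map (map inl) M1) ++ map inr (sb (map inl l1)).
pose B2 : seq (seq (O1 + O2) + (without2 (inl u : C1 + C2) (inr v))) :=
  map inl (map (map inr) M2) ++ map inr (sb (map inr l2)).
have mm (T T' : Type) (h : T -> T') (cs : seq (seq T)) : map (map id) (map (map h) cs) = map (map
  h) cs.
  by rewrite -map_comp; apply: eq_map => c /=; rewrite map_id.
have EB1 : map (bmap id val) B1 = map (bmap inl inl) b1 by rewrite !bmap_split El1 mm.
have EB2 : map (bmap id val) B2 = map (bmap inr inr) b2 by rewrite !bmap_split El2 mm.
have pbs : perm_eq (B1 ++ B2) (map inl (mc_union M1 M2) ++
    map inr (enum (without2 (inl u : C1 + C2) (inr v)))).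
  by rewrite /= map_cat perm_catACA perm_cat2l -map_cat perm_map.
have pfl : perm_eq (flat (B1 ++ B2)) (enum {: (O1 + O2) + without2 (inl u : C1 + C2) (inr v)}).
  apply: (perm_trans _ (blocks_perm _ (mc_union M1 M2))).
  by rewrite /flat; apply/perm_flatten/perm_map.
apply: (endo_ext_homog pfl) => d x y h.
have ES : map (sum_map id val) (flat (B1 ++ B2)) =
    map (sum_map inl inl) (flat b1) ++ map (sum_map inr inr) (flat b2).
  by rewrite flat_cat map_cat -!flat_bmap EB1 EB2.
rewrite (ccomp_evl _ _ h pfl ES) (Phi_evl _ h (mcsim_refl _) pbs).
have valy e1 e2 z : ext2 y e1 e2 (val z) = y z by exact: ext2_val.
have idx z : x (id z) = x z by [].
pose y1 e1 e2 : {ffun C1 -> B} := [ffun o => ext2 y e1 e2 (inl o)].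
pose y2 e1 e2 : {ffun C2 -> B} := [ffun o => ext2 y e1 e2 (inr o)].
pose x1 : {ffun O1 -> A} := [ffun c => x (inl c)].
pose x2 : {ffun O2 -> A} := [ffun c => x (inr c)].
have y1E e1 e2 o : ext2 y e1 e2 (inl o) = y1 e1 e2 o by rewrite [RHS]ffunE.
have y2E e1 e2 o : ext2 y e1 e2 (inr o) = y2 e1 e2 o by rewrite [RHS]ffunE.
have x1E c : x (inl c) = x1 c by rewrite [RHS]ffunE.
have x2E c : x (inr c) = x2 c by rewrite [RHS]ffunE.
have Eb1 e1 e2 : bprod x1 (y1 e1 e2) b1 = bprod x y B1.
  by rewrite -(bprod_map x1E (y1E e1 e2)) -EB1 (bprod_map idx (valy e1 e2)).
have Eb2 e1 e2 : bprod x2 (y2 e1 e2) b2 = bprod x y B2.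
  by rewrite -(bprod_map x2E (y2E e1 e2)) -EB2 (bprod_map idx (valy e1 e2)).
have hB1 := homU_bprod B1 h.
pose X1 := mU (wpow g1) (bprod x y B1); pose X2 := mU (wpow g2) (bprod x y B2).
have [r1 q1] : ur X1 = 0 /\ uq X1 = 0.
  by rewrite /X1 -(Eb1 0 0); apply: ccomp_stab st1 pl1.
have [r2 q2] : ur X2 = 0 /\ uq X2 = 0.
  by rewrite /X2 -(Eb2 0 0); apply: ccomp_stab st2 pl2.
have -> : surf x y (g1 + g2) (B1 ++ B2) = us (mU X1 X2).
  rewrite /surf bprod_cat // wpowD // /X1 /X2 !mUA; congr (us (mU _ _)).
  by rewrite -!mUA; congr mU; exact: mU_comm0 (wpow_hom _) hB1.
rewrite -(us_snake mu om f r1 q1 r2 q2) !big_seq; apply: eq_bigr => e /copairing_hom[a [h1 h2]].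
have [D [hD Dl Du Dv]] := cctr_homog (inl_neq_inr u v) h h1 h2.
rewrite -/(y1 e.1 e.2) -/(y2 e.1 e.2) -/x1 -/x2; congr (_ * _).
  have hl := homog_left hD.
  have -> : flat b1 ++ [:: inr u] = flat (b1 ++ [:: inr u]) by rewrite flat_cat.
  rewrite (Phi_evl _ hl (mcsim_refl _)); last first.
    rewrite /b1 -catA perm_cat2l -[[:: inr u]]/(map inr [:: u]) -map_cat perm_map //.
    by apply: perm_trans pl1; rewrite cats1 perm_rcons.
  rewrite /surf bprod_cat // -/x1 -/(y1 e.1 e.2) Eb1 /= mU1r -/X1 -mUA -/X1.
  by rewrite -y1E ext2_u.
have hr := homog_right hD.
have -> : inr v :: flat b2 = flat (inr v :: b2) by [].
rewrite (Phi_evl _ hr (mcsim_refl _)); last first.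
  rewrite /b2 -cat1s perm_catCA perm_cat2l.
  exact: (perm_map inr pl2).
rewrite /surf /= -/x2 -/(y2 e.1 e.2) Eb2 -y2E ext2_v // -!mUA.
rewrite (mU_comm0 (wpow_hom g2) (homU_iB h2)) mUA -/X2.
by [].
Qed.

End Compositions.
End Surfaces.

(** * The algebra over the modular hybrid defined by surfaces *)

Lemma generated_stable (O : finType) (M : multicycle O) (C : finType) n (x : QOC O M C n) :
  generated (H := QOC) OC_KP x -> stable #|O| #|C| n.
Proof.
elim=> {O M C n x}.
- by move=> O M C n x /and3P[].
- move=> O O' M M' C C' n h k x _.
  by rewrite (card_bijection h) (card_bijection k).
(* The number 2(G - 1) + |O| + |C| is additive under gluing, open or closed, and unchanged by
   contractions. *)
- move=> O1 O2 M1 M2 C1 C2 n1 n2 u v x y _ s1 _ s2; move: s1 s2; rewrite /stable.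
  have := card_without2 (inl_neq_inr u v); rewrite !card_sum => E s1 s2.
  move: E s1 s2; set k := #|without2 _ _|; lia.
- move=> O1 O2 M1 M2 C1 C2 n1 n2 u v x y _ s1 _ s2; move: s1 s2; rewrite /stable.
  have := card_without2 (inl_neq_inr u v); rewrite !card_sum => E s1 s2.
  move: E s1 s2; set k := #|without2 _ _|; lia.
- move=> O M C n u v uv x _; rewrite /stable (card_without2 uv).
  set k := #|without2 _ _|; lia.
- move=> O M C n u v uv x _; rewrite /stable (card_without2 uv).
  set k := #|without2 _ _|; lia.
Qed.

Lemma qoc_stab (O : finType) (M : multicycle O) (C : finType) n (x : QOC_KP O M C n) :
  stab C M (sval (sval x)).
Proof.
have := generated_stable (svalP x); have /eqP := svalP (sval x); rewrite /stab /stable.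
set g := sval _; lia.
Qed.

Section SurfaceAlgebra.
Variables (K : fieldType) (A B : form_space K).
Variables (mu : 'Hom(A, 'Hom(A, A))) (om : 'Hom(B, 'Hom(B, B))) (f : 'Hom(B, A)).
Hypotheses (HA : is_frobenius mu) (HB : is_commutative_frobenius om).
Hypotheses (Hf : is_central_morphism mu om f) (Hc : cardy_condition mu f).
Local Notation Phi := (Phi HA HB Hf).

(** Built transparently, so that its value on an element reduces to [Phi] when it is evaluated on
    the three generators. *)
Definition surface_algebra : KP_algebra A B.
Proof.
refine (@HybridMorphism QOC_KP (End_hybrid A B) (fun O M C n x => Phi C M (sval (sval x))) _ _ _ _
  _).
- by move=> O O' M M' C C' n h k x; apply: Phi_relabel.
- move=> O1 O2 M1 M2 C1 C2 n1 n2 u v x y; symmetry; apply: Phi_ocomp => //; exact: qoc_stab.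
- move=> O1 O2 M1 M2 C1 C2 n1 n2 u v x y; symmetry; apply: Phi_ccomp => //; exact: qoc_stab.
- by move=> O M C n u v uv x; symmetry; apply: Phi_octr.
- by move=> O M C n u v uv x; symmetry; apply: Phi_cctr.
Defined.

Lemma enum_void : enum {: void} = [::].
Proof. by apply: size0nil; rewrite -cardE card_void. Qed.

End SurfaceAlgebra.

Definition bilinear_form (K : fieldType) (V W : graded_space K) (F : V -> W -> K) : Prop :=
  (forall k a a' b, F (k *: a + a') b = k * F a b + F a' b) /\
  (forall k a b b', F a (k *: b + b') = k * F a b + F a b').

Definition trilinear_form (K : fieldType) (V : graded_space K) (F : V -> V -> V -> K) : Prop :=
  (forall c, bilinear_form (fun a b => F a b c)) /\ (forall a, bilinear_form (F a)).

Lemma linear_ext (K : fieldType) (V : graded_space K) (F G : V -> K) :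
  (forall k a a', F (k *: a + a') = k * F a + F a') ->
  (forall k a a', G (k *: a + a') = k * G a + G a') ->
  (forall d a, a \in hom V d -> F a = G a) -> forall a, F a = G a.
Proof.
move=> FD GD H a.
have lin0 (h : V -> K) : (forall k a a', h (k *: a + a') = k * h a + h a') -> h 0 = 0.
  by move=> hD; have := hD (-1) 0 0; rewrite scaler0 addr0 mulN1r addNr.
elim/hom_ind: a => [|d a a' ha IH]; first by rewrite !lin0.
by rewrite -[a]scale1r FD GD IH (H _ _ ha).
Qed.

Lemma bilinear_ext (K : fieldType) (V W : graded_space K) (F G : V -> W -> K) :
  bilinear_form F -> bilinear_form G ->
  (forall d e a b, a \in hom V d -> b \in hom W e -> F a b = G a b) ->
  forall a b, F a b = G a b.
Proof.
move=> [F1 F2] [G1 G2] H a b; apply: (@linear_ext _ _ (F^~ b) (G^~ b)) => [?||d {}a ha] //.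
by apply: linear_ext => // e {}b hb; apply: H ha hb.
Qed.

Lemma trilinear_ext (K : fieldType) (V : graded_space K) (F G : V -> V -> V -> K) :
  trilinear_form F -> trilinear_form G ->
  (forall d e g a b c, a \in hom V d -> b \in hom V e -> c \in hom V g -> F a b c = G a b c) ->
  forall a b c, F a b c = G a b c.
Proof.
move=> [F1 F2] [G1 G2] H a b c.
apply: (@bilinear_ext _ _ _ (fun a b => F a b c) (fun a b => G a b c)) => // d e {}a {}b ha hb.
apply: linear_ext => [k c1 c2|k c1 c2|g {}c hc]; [exact: (F2 a).2|exact: (G2 a).2|].
exact: H ha hb hc.
Qed.

Lemma mul_trilinear (K : fieldType) (V : form_space K) (mu : 'Hom(V, 'Hom(V, V))) :
  trilinear_form (fun a b c => bil (mul mu a b) c).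
Proof. by split=> ?; split=> *; rewrite ?(mulvDl, mulvDr, mulvZl, mulvZr) (bilDl, bilDr) (bilZl,
  bilZr). Qed.

Section Tuples.
Variables (K : fieldType) (A B : form_space K).

Definition f3 (V : Type) (a1 a2 a3 : V) : {ffun 'I_3 -> V} := [ffun i => tnth [tuple a1; a2; a3] i].

Lemma f3E (V : Type) (a1 a2 a3 : V) :
  [/\ f3 a1 a2 a3 0 = a1, f3 a1 a2 a3 1 = a2 & f3 a1 a2 a3 2 = a3].
Proof. by rewrite /f3 !ffunE. Qed.

Lemma f3_upd (V : Type) (b a1 a2 a3 : V) :
  [/\ f3 a1 a2 a3 = upd (f3 b a2 a3) 0 a1, f3 a1 a2 a3 = upd (f3 a1 b a3) 1 a2
    & f3 a1 a2 a3 = upd (f3 a1 a2 b) 2 a3].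
Proof. by split; apply/ffunP => -[[|[|[|n]]] i] //; rewrite /f3 /upd !ffunE. Qed.

Lemma endo_trilinearO (C : finType) (phi : endo A B 'I_3 C) s y :
  trilinear_form (fun a b c => phi s (f3 a b c) y).
Proof.
have E1 a b c : f3 a b c = upd (f3 0 b c) 0 a by case: (f3_upd 0 a b c).
have E2 a b c : f3 a b c = upd (f3 a 0 c) 1 b by case: (f3_upd 0 a b c).
have E3 a b c : f3 a b c = upd (f3 a b 0) 2 c by case: (f3_upd 0 a b c).
by split=> d; split=> k a b c; [rewrite E1 | rewrite E2 | rewrite E2 | rewrite E3];
  rewrite ev_linO -?E1 -?E2 -?E3.
Qed.

Lemma endo_trilinearC (O : finType) (phi : endo A B O 'I_3) s x :
  trilinear_form (fun a b c => phi s x (f3 a b c)).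
Proof.
have E1 a b c : f3 a b c = upd (f3 0 b c) 0 a by case: (f3_upd 0 a b c).
have E2 a b c : f3 a b c = upd (f3 a 0 c) 1 b by case: (f3_upd 0 a b c).
have E3 a b c : f3 a b c = upd (f3 a b 0) 2 c by case: (f3_upd 0 a b c).
by split=> d; split=> k a b c; [rewrite E1 | rewrite E2 | rewrite E2 | rewrite E3];
  rewrite ev_linC -?E1 -?E2 -?E3.
Qed.

Lemma endo_bilinear (phi : endo A B unit unit) s :
  bilinear_form (fun a b => phi s [ffun=> a] [ffun=> b]).
Proof.
have E (V : Type) (c c' : V) : [ffun=> c] = upd [ffun=> c'] tt c :> {ffun unit -> V}.
  by apply/ffunP => -[]; rewrite !ffunE.
split=> k a b c.
  by rewrite (E _ (k *: a + b) 0) ev_linO -!(E _ _ 0).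
by rewrite (E _ (k *: b + c) 0) ev_linC -!(E _ _ 0).
Qed.

End Tuples.
Section Corresponds.
Variables (K : fieldType) (A B : form_space K).
Variables (mu : 'Hom(A, 'Hom(A, A))) (om : 'Hom(B, 'Hom(B, B))) (f : 'Hom(B, A)).
Hypotheses (HA : is_frobenius mu) (HB : is_commutative_frobenius om).
Hypotheses (Hf : is_central_morphism mu om f) (Hc : cardy_condition mu f).
Local Notation Phi := (Phi HA HB Hf).

Lemma surface_open a1 a2 a3 y :
  Phi void mc3 0 (mk_ordering ord_open_subproof) (f3 a1 a2 a3) y = bil (mul mu a1 a2) a3.
Proof.
move: a1 a2 a3.
apply: (trilinear_ext (endo_trilinearO _ _ _) (mul_trilinear mu)) => d e g a b c ha hb hc.
pose D (i : 'I_3 + void) := match i with inl i => tnth [tuple d; e; g] i | inr _ => 0 end.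
have h : homog D (f3 a b c) y.
  split=> [|[]]; move=> -[[|[|[|n]]] i] //; by rewrite /f3 ffunE.
rewrite evl_mk.
have := Phi_evl HA HB Hf Hc 0 h (mcsim_refl mc3) (bs := [:: inl [:: 0; 1; 2]]).
rewrite enum_void => /(_ (perm_refl _)) => ->.
have [E1 E2 E3] := f3E a b c.
rewrite /surf /= mU1l mU1r /phi !mkUE E1 E2 E3 mH1r.
by rewrite ht_mH_iAl /mH /iA !mkHE !scale0r !add0r (bil_mul HA).
Qed.

Lemma surface_closed b1 b2 b3 x :
  Phi 'I_3 mc0 0 (mk_ordering ord_closed_subproof) x (f3 b1 b2 b3) = bil (mul om b1 b2) b3.
Proof.
move: b1 b2 b3.
apply: (trilinear_ext (endo_trilinearC _ _ _) (mul_trilinear om)) => d e g a b c ha hb hc.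
pose D (i : void + 'I_3) := match i with inr i => tnth [tuple d; e; g] i | inl _ => 0 end.
have h : homog D x (f3 a b c).
  split=> [[]|]; move=> -[[|[|[|n]]] i] //; by rewrite /f3 ffunE.
rewrite evl_mk.
have pm : perm_eq [:: inr 0; inr 1; inr 2] (map (inl : seq void -> _) mc0 ++ map inr (enum 'I_3)).
  apply: uniq_perm => //; first by rewrite /= (map_inj_uniq (@inr_inj _ _)) enum_uniq.
  move=> [i|i]; rewrite !inE; first by apply/esym/mapP => -[].
  rewrite map_f ?mem_enum //; by case: i => -[|[|[|n]]].
rewrite (Phi_evl HA HB Hf Hc 0 h (mcsim_refl mc0) pm).
have [E1 E2 E3] := f3E a b c.
rewrite /surf /= mU1l mU1r E1 E2 E3.
by rewrite /mU /iB !mkUE !(mul0r, mulr0, scale0r, addr0, add0r) (bil_mul HB.1).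
Qed.

Lemma surface_mixed a b :
  Phi unit mc1 0 (mk_ordering ord_mixed_subproof) [ffun=> a] [ffun=> b] = bil a (f b).
Proof.
move: a b; apply: (bilinear_ext (endo_bilinear _ _)) => [|d e a b ha hb].
  by split=> *; rewrite ?homD ?homZ (bilDl, bilDr) (bilZl, bilZr).
pose D (i : unit + unit) := match i with inl _ => d | inr _ => e end.
have h : homog D [ffun=> a] [ffun=> b] by split=> -[]; rewrite ffunE.
rewrite evl_mk.
have pm : perm_eq [:: inl [:: tt]; inr tt] (map (inl : seq unit -> _) mc1 ++ map inr (enum {:
  unit})).
  rewrite /= perm_cons (perm_map (s := [:: tt]) inr) //.
  by apply: uniq_perm; rewrite ?enum_uniq // => -[]; rewrite mem_enum.
rewrite (Phi_evl HA HB Hf Hc 0 h (mcsim_refl mc1) pm).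
rewrite /surf /= mU1l !mU1r us_phi // mH1r ht_mH_iAl /fh /iB !mkHE !mkUE scale0r addr0.
by rewrite !ffunE.
Qed.

End Corresponds.

Lemma surface_corresponds (K : fieldType) (A B : form_space K) (S : cardy_frobenius A B) :
  exists alpha : KP_algebra A B, corresponds alpha S.
Proof.
case: S => mu om f HA HB Hf Hc; exists (surface_algebra HA HB Hf Hc); split=> /=.
- by move=> a1 a2 a3; symmetry; apply: (surface_open HA HB Hf Hc).
- by move=> a1 a2 a3; symmetry; apply: (surface_closed HA HB Hf Hc).
by move=> a b; symmetry; apply: (surface_mixed HA HB Hf Hc).
Qed.

(** * Generation by planar surfaces *)

Section Bijections.

Lemma bijection_of_lists (T T' : finType) (l : seq T) (l' : seq T') :
  perm_eq l (enum T) -> perm_eq l' (enum T') -> size l = size l' ->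
  exists h : bijection T T', map h l = l'.
Proof.
move=> pl pl' sz.
have li t : (index t l < size l')%N by rewrite -sz index_mem (perm_mem pl) mem_enum.
have li' t : (index t l' < size l)%N by rewrite sz index_mem (perm_mem pl') mem_enum.
pose h t := tnth (in_tuple l') (Ordinal (li t)).
pose h' t := tnth (in_tuple l) (Ordinal (li' t)).
have u : uniq l by rewrite (perm_uniq pl) enum_uniq.
have u' : uniq l' by rewrite (perm_uniq pl') enum_uniq.
have hE t0 t : h t = nth t0 l' (index t l) by rewrite /h (tnth_nth t0).
have hE' t0 t : h' t = nth t0 l (index t l') by rewrite /h' (tnth_nth t0).
have hK : cancel h h'.
  move=> t; rewrite (hE' t) (hE (h t)) index_uniq // nth_index //.
  by rewrite (perm_mem pl) mem_enum.
have hK' : cancel h' h.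
  move=> t; rewrite (hE t) (hE' (h' t)) index_uniq // nth_index //.
  by rewrite (perm_mem pl') mem_enum.
exists (Bijection hK hK') => /=; case: l' pl' sz li li' h h' u' hE hE' hK hK' => [|t0 l'] pl' sz li
  li' h h' u' hE hE' hK hK'.
  by rewrite (size0nil sz).
apply: (@eq_from_nth _ t0); first by rewrite size_map.
rewrite size_map => i lti.
have t1 : T by case: l lti {pl sz li li' h h' u hE hE' hK hK'}.
by rewrite (nth_map t1) // (hE t0) index_uniq.
Qed.

Lemma bijection_of_card (T T' : finType) : #|T| = #|T'| -> exists h : bijection T T', True.
Proof.
move=> E; have [|h _] := @bijection_of_lists T T' _ _ (perm_refl _) (perm_refl _).
  by rewrite -!cardE.
by exists h.
Qed.

Lemma mc_iso_of_lists (O O' : finType) (M : multicycle O) (M' : multicycle O') (h : bijection O O')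
    (Is : seq nat) :
  perm_eq Is (iota 0 (size M')) -> size Is = size M ->
  (forall i, (i < size M)%N -> exists k,
     nth [::] M' (nth 0%N Is i) = rot k (map h (nth [::] M i))) ->
  exists f : mc_iso M M', iso_elt f = h.
Proof.
move=> pI sI H.
have uI : uniq Is by rewrite (perm_uniq pI) iota_uniq.
have mI i : (i \in Is) = (i < size M')%N by rewrite (perm_mem pI) mem_iota.
have lt1 (i : 'I_(size M)) : (nth 0%N Is i < size M')%N by rewrite -mI mem_nth // sI.
have lt2 (i : 'I_(size M')) : (index (val i) Is < size M)%N by rewrite -sI index_mem mI ltn_ord.
pose c1 i := Ordinal (lt1 i); pose c2 i := Ordinal (lt2 i).
have K1 : cancel c1 c2 by move=> i; apply: val_inj; rewrite /= index_uniq ?sI.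
have K2 : cancel c2 c1 by move=> i; apply: val_inj; rewrite /= nth_index // mI.
have P i : exists k, nth [::] M' (Bijection K1 K2 i) = rot k (map h (nth [::] M i)) by apply: H.
by exists (McIso P).
Qed.

Lemma mc_iso_map (O O' : finType) (M : multicycle O) (M' : multicycle O') (h : bijection O O') :
  map (map h) M = M' -> exists f : mc_iso M M', iso_elt f = h.
Proof.
move=> E; have sz : size M' = size M by rewrite -E size_map.
apply: (@mc_iso_of_lists _ _ _ _ _ (iota 0 (size M'))).
- exact: perm_refl.
- by rewrite size_iota.
move=> i lti; exists 0%N; rewrite rot0 nth_iota ?sz // add0n -E (nth_map [::]) //.
Qed.

Lemma flatten_map_inj (T T' : Type) (h : T -> T') (cs : seq (seq T)) (cs' : seq (seq T')) :
  map h (flatten cs) = flatten cs' -> map size cs = map size cs' -> map (map h) cs = cs'.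
Proof.
elim: cs cs' => [|c cs IH] [|c' cs'] //=; rewrite map_cat => E [sc scs].
have sz : size (map h c) = size c' by rewrite size_map.
have E1 : map h c = c'.
  by move/(congr1 (take (size (map h c)))): E; rewrite take_size_cat // sz take_size_cat.
have E2 : map h (flatten cs) = flatten cs'.
  by move/(congr1 (drop (size (map h c)))): E; rewrite drop_size_cat // sz drop_size_cat.
by rewrite E1 (IH cs').
Qed.

Lemma mc_iso_shape (O O' : finType) (M : multicycle O) (M' : multicycle O') :
  perm_eq (map size M) (map size M') -> exists f : mc_iso M M', True.
Proof.
move=> p; have /(perm_iotaP 0%N)[Is pI EI] := p.
rewrite size_map in pI.
pose cs := [seq nth [::] M' i | i <- Is].
have pcs : perm_eq cs M'.
  rewrite -[X in perm_eq _ X](take_size M') -(map_nth_iota0 [::] (leqnn _)).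
  exact: perm_map.
have scs : map size M = map size cs.
  rewrite EI /cs -map_comp; apply/eq_in_map => i; rewrite (perm_mem pI) mem_iota /= => lti.
  by rewrite (nth_map [::]).
have pfl : perm_eq (flatten cs) (enum O').
  exact: perm_trans (perm_flatten pcs) (multicycleP M').
have [|h Eh] := bijection_of_lists (multicycleP M) pfl.
  by rewrite !size_flatten /shape scs.
have Ecs := flatten_map_inj Eh scs.
have sz : size Is = size M by rewrite -(size_map size M) EI size_map.
have [|f _] := mc_iso_of_lists (h := h) pI sz; last by exists f.
move=> i lti; exists 0%N; rewrite rot0.
by rewrite -(nth_map [::] [::] (map h)) // Ecs (nth_map 0%N) // sz.
Qed.

End Bijections.

Definition canon_mc_subproof (sh : seq nat) :
  perm_eq (flatten (reshape sh (enum 'I_(sumn sh)))) (enum 'I_(sumn sh)).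
Proof. by rewrite reshapeKr // size_enum_ord. Qed.

Definition canon_mc (sh : seq nat) : multicycle 'I_(sumn sh) := Multicycle (canon_mc_subproof sh).

Lemma canon_mc_shape sh : map size (canon_mc sh) = sh.
Proof. by rewrite -[LHS]/(shape _) reshapeKl // size_enum_ord. Qed.

Section SpecialCycles.
Variable T : eqType.
Implicit Types (u v : T) (P Q : seq T) (R : seq (seq T)).

Lemma open_at_head u P R : open_at (cycle_of ((u :: P) :: R) u) u = P.
Proof. by rewrite /cycle_of /= inE eqxx /= /open_at /= eqxx rot0. Qed.

Lemma filter_head u P R : uniq (flatten ((u :: P) :: R)) ->
  [seq c <- (u :: P) :: R | u \notin c] = R.
Proof.
move=> /= /andP[]; rewrite mem_cat negb_or => /andP[_ uR] _.
by rewrite inE eqxx /=; apply: filter_notin.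
Qed.

End SpecialCycles.

Lemma size_sub (T : finType) (u v : T) cs : u \notin flatten cs -> v \notin flatten cs ->
  map size (map (sub u v) cs) = map size cs.
Proof.
move=> nu nv; rewrite -{2}(map_val_sub_all nu nv) -!map_comp.
by apply: eq_map => c /=; rewrite size_map.
Qed.

Lemma merge_shape (O1 O2 : finType) (M1 : multicycle O1) (M2 : multicycle O2) u v P1 P2 R1 R2 :
  cycles M1 = (u :: P1) :: R1 -> cycles M2 = (v :: P2) :: R2 ->
  map size (mc_merge M1 M2 u v) = (size P1 + size P2)%N :: map size R1 ++ map size R2.
Proof.
move=> E1 E2; have [nu nv] := contract_notin (inl_neq_inr u v) (mc_union M1 M2).
transitivity (map size (map (sub (inl u) (inr v)) (contract_cycles (mc_union M1 M2) (inl u) (inr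
  v)))).
  by [].
rewrite size_sub // merge_cycles; last 2 first.
- by rewrite (perm_mem (multicycleP M1)) mem_enum.
- by rewrite (perm_mem (multicycleP M2)) mem_enum.
have u1 : uniq (flatten M1) by rewrite (perm_uniq (multicycleP M1)) enum_uniq.
have u2 : uniq (flatten M2) by rewrite (perm_uniq (multicycleP M2)) enum_uniq.
rewrite E1 in u1 *; rewrite E2 in u2 *.
rewrite !open_at_head !filter_head // map_cons size_cat !size_map map_cat -!map_comp.
by congr (_ :: _ ++ _); apply: eq_map => c /=; rewrite size_map.
Qed.

Definition is_generator (O : finType) (M : multicycle O) (C : finType) n (x : QOC O M C n) : Prop :=
  sval x = 0%N /\
  [\/ perm_eq (map size M) [:: 3] /\ #|C| = 0%N,
      perm_eq (map size M) [::] /\ #|C| = 3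
    | perm_eq (map size M) [:: 1] /\ #|C| = 1]%N.

Definition planar_generated (sh : seq nat) (c : nat) : Prop :=
  forall (O : finType) (M : multicycle O) (C : finType) n (x : QOC O M C n),
    perm_eq (map size M) sh -> #|C| = c -> sval x = 0%N ->
    generated (H := QOC) is_generator x.

(** Planar surfaces with the same cycle lengths and the same number of closed inputs differ by a
    relabelling, and their operadic genus is determined by these data. Generation can therefore be
    checked on one representative. *)
Lemma planar_intro sh c (O : finType) (M : multicycle O) (C : finType) n (x : QOC O M C n) :
  perm_eq (map size M) sh -> #|C| = c -> sval x = 0%N ->
  generated (H := QOC) is_generator x -> planar_generated sh c.
Proof.
move=> pM cC x0 gx O' M' C' n' x' pM' cC' x0'.
have [f _] : exists f : mc_iso M M', True.
  by apply: mc_iso_shape; apply: perm_trans pM _; rewrite perm_sym.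
have [h _] : exists h : bijection C C', True by apply: bijection_of_card; rewrite cC cC'.
have En : n' = n.
  have := svalP x; have := svalP x'; rewrite x0 x0' cC cC'.
  rewrite -(size_map size M) -(size_map size M') (perm_size pM) (perm_size pM').
  by rewrite /genus_eq => /eqP E /eqP; rewrite -E; lia.
subst n'; have -> : x' = hrelabel f h x.
  by apply: val_inj; rewrite /= x0 x0'.
exact: gen_relabel.
Qed.

Lemma planar_perm sh sh' c : perm_eq sh sh' -> planar_generated sh c -> planar_generated sh' c.
Proof.
by move=> p H O M C n x pM; apply: H; apply: perm_trans pM _; rewrite perm_sym.
Qed.

Lemma planar_base sh c : (sh = [:: 3] /\ c = 0%N) \/ (sh = [::] /\ c = 3) \/ (sh = [:: 1%N] /\ c =
  1%N) ->
  planar_generated sh c.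
Proof.
move=> H O M C n x pM cC x0; apply: gen_base; split=> //.
case: H pM cC => [[-> ->]|[[-> ->]|[-> ->]]] pM cC.
- by apply: Or31.
- by apply: Or32.
- by apply: Or33.
Qed.

(** The bound makes the truncated subtraction in 2G = 2b + c - 2 exact. *)
Lemma planar_instance sh c : (2 <= 2 * size sh + c)%N ->
  exists x : QOC _ (canon_mc sh) 'I_c (2 * size sh + c - 2)%N, sval x = 0%N.
Proof.
move=> h; have g0 : genus_eq (size (canon_mc sh)) #|'I_c| (2 * size sh + c - 2) 0.
  by rewrite /genus_eq -(size_map size) canon_mc_shape card_ord; apply/eqP; lia.
by exists (Qoc g0).
Qed.

Lemma canon_mc_head a sh : exists u P R,
  [/\ cycles (canon_mc (a.+1 :: sh)) = (u :: P) :: R, size P = a & map size R = sh].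
Proof.
have := canon_mc_shape (a.+1 :: sh); case: (cycles _) => [|[|u P] R] //= [sP sR].
by exists u, P, R.
Qed.

Lemma planar_ocomp a b s1 s2 c1 c2 :
  planar_generated (a.+1 :: s1) c1 -> planar_generated (b.+1 :: s2) c2 ->
  planar_generated ((a + b)%N :: s1 ++ s2) (c1 + c2).
Proof.
move=> H1 H2.
have [|x1 g1] := @planar_instance (a.+1 :: s1) c1; first by rewrite /=; lia.
have [|x2 g2] := @planar_instance (b.+1 :: s2) c2; first by rewrite /=; lia.
have [u [P1 [R1 [E1 sP1 sR1]]]] := canon_mc_head a s1.
have [v [P2 [R2 [E2 sP2 sR2]]]] := canon_mc_head b s2.
apply: (@planar_intro _ _ _ _ _ _ (ocomp u v x1 x2)).
- by rewrite (merge_shape E1 E2) sP1 sP2 sR1 sR2.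
- by rewrite card_sum !card_ord.
- by rewrite /= g1 g2.
apply: gen_ocomp; [apply: H1|apply: H2]; rewrite ?canon_mc_shape ?card_ord //.
Qed.

Lemma planar_ccomp s1 s2 c1 c2 : (2 <= 2 * size s1 + c1.+1)%N -> (2 <= 2 * size s2 + c2.+1)%N ->
  planar_generated s1 c1.+1 -> planar_generated s2 c2.+1 ->
  planar_generated (s1 ++ s2) (c1 + c2).
Proof.
move=> h1 h2 H1 H2.
have [x1 g1] := planar_instance h1; have [x2 g2] := planar_instance h2.
apply: (@planar_intro _ _ _ _ _ _ (ccomp (ord0 : 'I_c1.+1) (ord0 : 'I_c2.+1) x1 x2)).
- have E (T T' : Type) (h : T -> T') (cs : seq (seq T)) : map size (map (map h) cs) = map size cs.
    by rewrite -map_comp; apply: eq_map => c /=; rewrite size_map.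
  by rewrite map_cat !E !canon_mc_shape.
- have := card_without2 (inl_neq_inr (ord0 : 'I_c1.+1) (ord0 : 'I_c2.+1)).
  rewrite card_sum !card_ord; set k := #|without2 _ _|; lia.
- by rewrite /= g1 g2.
apply: gen_ccomp; [apply: H1|apply: H2]; rewrite ?canon_mc_shape ?card_ord //.
Qed.

Lemma planar_polygon n : (3 <= n)%N -> planar_generated [:: n] 0.
Proof.
elim: n => // n IH; rewrite leq_eqVlt => /orP[/eqP <-|lt].
  by apply: planar_base; left.
case: n lt IH => // n lt IH; rewrite -[n.+2]addn2.
apply: (@planar_ocomp n 2 [::] [::] 0 0); first exact: IH.
by apply: planar_base; left.
Qed.

(** Gluing in a triangle lengthens the boundary by one input; gluing in the mixed generator trades
    an open input for a closed one. The induction on [c] thus starts from a longer boundary. *)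
Lemma planar_disc n c : (0 < c)%N -> (0 < n)%N || (1 < c)%N -> planar_generated [:: n] c.
Proof.
case: c => // c _; elim: c n => [|c IH] n h.
  have {h} : (0 < n)%N by move: h; rewrite orbF.
  case: n => // n _; elim: n => [|n IH]; first by apply: planar_base; right; right.
  rewrite -[n.+2]addn2; apply: (@planar_ocomp n 2 [::] [::] 1 0) => //.
  by apply: planar_base; left.
rewrite -[c.+2]addn1 -[n]addn0; apply: (@planar_ocomp n 0 [::] [::] c.+1 1); first exact: IH.
by apply: planar_base; right; right.
Qed.

Lemma planar_sphere c : (3 <= c)%N -> planar_generated [::] c.
Proof.
elim: c => // c IH; rewrite leq_eqVlt => /orP[/eqP <-|lt].
  by apply: planar_base; right; left.
case: c lt IH => // c lt IH; rewrite -[c.+2]addn2.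
apply: (@planar_ccomp [::] [::] c 2) => //; [by rewrite /=; lia|exact: IH|].
by apply: planar_base; right; left.
Qed.

(** For at most one circle this is stability in genus 0. For two or more circles it is the
    complement of the discarded elements, where only the number of nonempty circles and of closed
    inputs matters. *)
Definition planar_ok (sh : seq nat) (c : nat) : bool :=
  if size sh is b.+2 then
    [|| 2 <= count (leq 1) sh, (count (leq 1) sh == 1) && (1 <= c) | 2 <= c]%N
  else if sh is [:: n] then (2 < n + 2 * c)%N else (2 < c)%N.

(** Induction on the number of circles: a disc around one circle is cut off along a closed curve.
    The circle has to be chosen so that both pieces are again admissible. *)
Lemma planar_all sh c : planar_ok sh c -> planar_generated sh c.
Proof.
have [b] := ubnP (size sh); elim: b sh c => // b IH sh c; rewrite ltnS => szb.
case Es : (size sh) szb => [|[|k]] szb.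
- by rewrite (size0nil Es) => /planar_sphere.
- case: sh Es => [|n []] //= _ ok; case: c ok => [|c] ok.
    by apply: planar_polygon; rewrite /planar_ok /= in ok; lia.
  by apply: planar_disc => //; rewrite /planar_ok /= in ok; lia.
rewrite {1}/planar_ok Es => ok.
have okc : (count (leq 1) sh <= size sh)%N := count_size _ _.
(* The disc takes the circle of length [a] and [c1] of the closed inputs; the cut gives each of the
   two pieces one more closed input. *)
have step a c1 : a \in sh -> planar_generated [:: a] c1.+1 ->
    (c1 <= c)%N -> planar_ok (rem a sh) (c - c1).+1 -> planar_generated sh c.
  move=> ain G1 lec okr.
  have sr : size (rem a sh) = k.+1 by rewrite size_rem // Es.
  rewrite -(subnKC lec).
  apply: (planar_perm (sh := [:: a] ++ rem a sh)); first by rewrite perm_sym perm_to_rem.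
  apply: planar_ccomp => //; first by rewrite sr; lia.
  by apply: IH => //; rewrite sr; lia.
have cr a : a \in sh -> count (leq 1) sh = ((0 < a) + count (leq 1) (rem a sh))%N.
  by move=> ain; rewrite (permP (perm_to_rem ain)).
have okI a c' : a \in sh ->
   (if k is 0 then (0 < count (leq 1) (rem a sh)) && (0 < c') || (1 < c') else
    [|| 2 <= count (leq 1) (rem a sh), (count (leq 1) (rem a sh) == 1) && (1 <= c') | 2 <= c'])%N ->
   planar_ok (rem a sh) c'.
  move=> ain; have : size (rem a sh) = k.+1 by rewrite size_rem // Es.
  rewrite /planar_ok => sr; rewrite sr; case: k sr {Es szb okc step} => [|k'] sr //.
  by case: (rem a sh) sr => [|n []] //= _; lia.
(* Without closed inputs at least two circles are nonempty. One of them is cut off, and the other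
   one remains together with the new closed input. *)
have [c0|c0] := posnP c.
  have /hasP[a ain a0] : has (leq 1) sh by rewrite has_count; move: ok; rewrite c0; lia.
  apply: (step a 0%N) => //; first by apply: planar_disc; rewrite ?a0.
  rewrite c0; apply: okI => //; have := cr a ain; rewrite a0; move: ok; rewrite c0.
  by case: k {Es szb okc step} => [|k']; lia.
(* The disc with empty boundary needs a second closed input to be stable, so it takes one along. The
   remainder gets one back from the cut and has [c] closed inputs again. *)
have [zin|nz] := boolP (0%N \in sh).
  apply: (step 0%N 1%N) => //; first exact: planar_disc.
  apply: okI => //; have := cr _ zin; move: ok.
  by case: k {Es szb okc step} => [|k']; lia.
(* All circles are nonempty, so any of them can be cut off without a closed input of the surface. *)
have /hasP[a ain _] : has predT sh by rewrite has_predT Es.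
have a0 : (0 < a)%N by case: a ain nz => // ->.
apply: (step a 0%N) => //; first by apply: planar_disc; rewrite ?a0.
apply: okI => //; have := cr _ ain; rewrite a0; move: ok.
by case: k {Es szb okc step} => [|k']; lia.
Qed.

Lemma OC_KP_generated (O : finType) (M : multicycle O) (C : finType) n (x : QOC O M C n) :
  OC_KP x -> generated (H := QOC) is_generator x.
Proof.
move=> /and3P[/eqP x0 st nd].
apply: (planar_all (sh := map size M) (c := #|C|)) => //.
have Ex := svalP x; rewrite /genus_eq x0 in Ex.
have EO : #|O| = sumn (map size M).
  by rewrite cardE -(perm_size (multicycleP M)) size_flatten.
have Ec : count (leq 1) (map size M) = count (fun c => ~~ nilp c) M.
  by rewrite count_map; apply: eq_count => c /=; rewrite /nilp -lt0n.
move: st nd Ex; rewrite /stable /KP_discarded /planar_ok Ec EO size_map.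
set k := count _ M; case Es: (size M) => [|[|b]].
- by rewrite (size0nil Es) /=; lia.
- case: (cycles M) Es @k {EO Ec} => [|c []] //= _; lia.
- have : (k <= b.+2)%N by rewrite -Es count_size.
  have : k == 0%N -> sumn (map size M) = 0%N.
    rewrite /k -Ec; elim: (map size M) => //= m sh IH.
    by rewrite addn_eq0 => /andP[m0 /IH ->]; lia.
  move: (sumn _) => s; lia.
Qed.

Lemma is_generator_KP (O : finType) (M : multicycle O) (C : finType) n (x : QOC O M C n) :
  is_generator x -> OC_KP x.
Proof.
move=> [x0 H]; have Ex := svalP x; rewrite /genus_eq x0 in Ex.
have EO : #|O| = sumn (map size M).
  by rewrite cardE -(perm_size (multicycleP M)) size_flatten.
rewrite /OC_KP x0 eqxx /= /stable /KP_discarded EO.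
rewrite -(size_map size M) in Ex.
have Ec : count (fun c => ~~ nilp c) M = count (leq 1) (map size M).
  by rewrite count_map; apply: eq_count => c /=; rewrite /nilp -lt0n.
rewrite Ec -(size_map size M); case: H => -[p cC]; rewrite (perm_size p) in Ex *;
  rewrite (permP p) (perm_sumn p) cC /= in Ex *; lia.
Qed.

(** * An algebra is determined by its values on the generators *)

Section MorphismFacts.
Variables (H H' : modular_hybrid_data) (a : hybrid_morphism H H').

Lemma hmap_relabel (O O' : finType) (M : multicycle O) (M' : multicycle O') (C C' : finType) n
    (f : mc_iso M M') (g : bijection C C') (x : H O M C n) :
  a _ _ _ _ (hrelabel f g x) = hrelabel f g (a _ _ _ _ x).
Proof. by case: a. Qed.
Lemma hmap_ocomp (O1 O2 : finType) (M1 : multicycle O1) (M2 : multicycle O2)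
    (C1 C2 : finType) n1 n2 (u : O1) (v : O2) (x : H O1 M1 C1 n1) (y : H O2 M2 C2 n2) :
  a _ _ _ _ (ocomp u v x y) = ocomp u v (a _ _ _ _ x) (a _ _ _ _ y).
Proof. by case: a. Qed.
Lemma hmap_ccomp (O1 O2 : finType) (M1 : multicycle O1) (M2 : multicycle O2)
    (C1 C2 : finType) n1 n2 (u : C1) (v : C2) (x : H O1 M1 C1 n1) (y : H O2 M2 C2 n2) :
  a _ _ _ _ (ccomp u v x y) = ccomp u v (a _ _ _ _ x) (a _ _ _ _ y).
Proof. by case: a. Qed.
Lemma hmap_octr (O : finType) (M : multicycle O) (C : finType) n (u v : O) (uv : u != v)
    (x : H O M C n) : a _ _ _ _ (octr uv x) = octr uv (a _ _ _ _ x).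
Proof. by case: a. Qed.
Lemma hmap_cctr (O : finType) (M : multicycle O) (C : finType) n (u v : C) (uv : u != v)
    (x : H O M C n) : a _ _ _ _ (cctr uv x) = cctr uv (a _ _ _ _ x).
Proof. by case: a. Qed.

Lemma hybrid_morphism_ext (b : hybrid_morphism H H') :
  (forall O M C n x, a O M C n x = b O M C n x) -> a = b.
Proof.
case: a b => f f1 f2 f3 f4 f5 [g g1 g2 g3 g4 g5] /= E.
have {}E : f = g.
  apply: functional_extensionality_dep => O; apply: functional_extensionality_dep => M.
  apply: functional_extensionality_dep => C; apply: functional_extensionality_dep => n.
  by apply/funext => x.
by case: g / E g1 g2 g3 g4 g5 => *; congr HybridMorphism; apply: Prop_irrelevance.
Qed.

End MorphismFacts.

(** An element of a component is its genus; membership is a proposition. Equations between glued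
    surfaces thus reduce to equations between natural numbers. *)
Lemma qoc_kp_inj (O : finType) (M : multicycle O) (C : finType) n (x y : QOC_KP O M C n) :
  sval (sval x) = sval (sval y) -> x = y.
Proof.
case: x y => [x Gx] [y Gy] /= E.
have {}E : x = y by apply: val_inj.
by case: y / E Gy => Gy; congr exist; apply: Prop_irrelevance.
Qed.

Section Unique.
Variables (K : fieldType) (A B : form_space K).
Variables (a b : KP_algebra A B) (S : cardy_frobenius A B).
Hypotheses (ca : corresponds a S) (cb : corresponds b S).

Lemma ffun3E (V : Type) (x : {ffun 'I_3 -> V}) : x = f3 (x 0) (x 1) (x 2).
Proof.
by apply/ffunP => -[[|[|[|n]]] i] //; rewrite /f3 ffunE /tnth /=; congr (x _); apply: val_inj.
Qed.

Lemma agree_open : a _ _ _ _ gen_open = b _ _ _ _ gen_open.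
Proof.
apply: (endo_ext_homog ord_open_subproof) => d x y _.
rewrite -!(evl_mk _ ord_open_subproof) (ffun3E x) (_ : y = [ffun=> 0]); last by apply/ffunP => -[].
by case: ca cb => [E1 _ _] [E2 _ _]; rewrite /f3 -E1 -E2.
Qed.

Lemma agree_closed : a _ _ _ _ gen_closed = b _ _ _ _ gen_closed.
Proof.
apply: (endo_ext_homog ord_closed_subproof) => d x y _.
rewrite -!(evl_mk _ ord_closed_subproof) (ffun3E y) (_ : x = [ffun=> 0]);
  last by apply/ffunP => -[].
by case: ca cb => [_ E1 _] [_ E2 _]; rewrite /f3 -E1 -E2.
Qed.

Lemma agree_mixed : a _ _ _ _ gen_mixed = b _ _ _ _ gen_mixed.
Proof.
apply: (endo_ext_homog ord_mixed_subproof) => d x y _.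
rewrite -!(evl_mk _ ord_mixed_subproof) (_ : x = [ffun=> x tt]); last by apply/ffunP => -[];
  rewrite ffunE.
rewrite (_ : y = [ffun=> y tt]); last by apply/ffunP => -[]; rewrite ffunE.
by case: ca cb => [_ _ E1] [_ _ E2]; rewrite -E1 -E2.
Qed.

Lemma agree_generator (O : finType) (M : multicycle O) (C : finType) n (x : QOC_KP O M C n) :
  is_generator (sval x) -> a _ _ _ _ x = b _ _ _ _ x.
Proof.
move=> [x0 H].
have T (O' : finType) (M' : multicycle O') (C' : finType) n' (y : QOC_KP O' M' C' n') :
    perm_eq (map size M') (map size M) -> #|C'| = #|C| -> sval (sval y) = 0%N ->
    a _ _ _ _ y = b _ _ _ _ y -> a _ _ _ _ x = b _ _ _ _ x.
  move=> pM cC y0 E.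
  have [f _] := mc_iso_shape pM; have [h _] := bijection_of_card cC.
  have En : n = n'.
    have := svalP (sval x); have := svalP (sval y); rewrite x0 y0 cC.
    rewrite -(size_map size M) -(size_map size M') (perm_size pM) /genus_eq => /eqP E1 /eqP.
    by rewrite -E1; lia.
  subst n'; have -> : x = hrelabel f h y by apply: qoc_kp_inj; rewrite /= x0 y0.
  by rewrite !hmap_relabel E.
case: H => -[pM cC].
- by apply: (T _ _ _ _ gen_open) agree_open; rewrite ?cC ?card_void // perm_sym.
- by apply: (T _ _ _ _ gen_closed) agree_closed; rewrite ?cC ?card_ord // perm_sym.
- by apply: (T _ _ _ _ gen_mixed) agree_mixed; rewrite ?cC ?card_unit // perm_sym.
Qed.

(** The proof of membership is part of the statement because the induction on [generated] has to
    construct it along the way; proof irrelevance makes the choice immaterial. *)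
Definition agree (O : finType) (M : multicycle O) (C : finType) n (x : QOC O M C n) : Prop :=
  exists G : generated (H := QOC) OC_KP x,
    a _ _ _ _ (exist _ x G : QOC_KP O M C n) = b _ _ _ _ (exist _ x G : QOC_KP O M C n).

Lemma agree_generated (P : forall (O : finType) (M : multicycle O) (C : finType) n,
    QOC O M C n -> Prop) :
  (forall O M C n (x : QOC O M C n), P _ _ _ _ x -> agree x) ->
  forall (O : finType) (M : multicycle O) (C : finType) n (x : QOC O M C n),
    generated P x -> agree x.
Proof.
move=> HP O M C n x; elim=> {O M C n x}.
- by move=> *; apply: HP.
- move=> O O' M M' C C' n f g x _ [G E]; exists (gen_relabel f g G).
  pose X : QOC_KP O M C n := exist _ x G.
  have -> : exist _ _ (gen_relabel f g G) = hrelabel f g X by apply: qoc_kp_inj.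
  by rewrite !hmap_relabel /X E.
- move=> O1 O2 M1 M2 C1 C2 n1 n2 u v x y _ [Gx Ex] _ [Gy Ey]; exists (gen_ocomp u v Gx Gy).
  pose X : QOC_KP O1 M1 C1 n1 := exist _ x Gx; pose Y : QOC_KP O2 M2 C2 n2 := exist _ y Gy.
  have -> : exist _ _ (gen_ocomp u v Gx Gy) = ocomp u v X Y by apply: qoc_kp_inj.
  by rewrite !hmap_ocomp /X /Y Ex Ey.
- move=> O1 O2 M1 M2 C1 C2 n1 n2 u v x y _ [Gx Ex] _ [Gy Ey]; exists (gen_ccomp u v Gx Gy).
  pose X : QOC_KP O1 M1 C1 n1 := exist _ x Gx; pose Y : QOC_KP O2 M2 C2 n2 := exist _ y Gy.
  have -> : exist _ _ (gen_ccomp u v Gx Gy) = ccomp u v X Y by apply: qoc_kp_inj.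
  by rewrite !hmap_ccomp /X /Y Ex Ey.
- move=> O M C n u v uv x _ [G E]; exists (gen_octr uv G).
  pose X : QOC_KP O M C n := exist _ x G.
  have -> : exist _ _ (gen_octr uv G) = octr uv X by apply: qoc_kp_inj.
  by rewrite !hmap_octr /X E.
move=> O M C n u v uv x _ [G E]; exists (gen_cctr uv G).
pose X : QOC_KP O M C n := exist _ x G.
  have -> : exist _ _ (gen_cctr uv G) = cctr uv X by apply: qoc_kp_inj.
  by rewrite !hmap_cctr /X E.
Qed.

Lemma KP_algebra_unique : a = b.
Proof.
apply: hybrid_morphism_ext => O M C n [x G].
have [G' E] : agree x.
  (* The induction is used twice: every surface is generated by the planar ones in [OC_KP], and each
     of these by the three generators. *)
  apply: (agree_generated _ G) => {O M C n x G} O M C n x /OC_KP_generated.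
  apply: agree_generated => {O M C n x} O M C n x gx.
  exists (gen_base (H := QOC) (is_generator_KP gx)); exact: agree_generator.
by rewrite (Prop_irrelevance G G').
Qed.

End Unique.

(** * Planar surfaces in an algebra *)

Lemma generated_KP (O : finType) (M : multicycle O) (C : finType) n (x : QOC O M C n) :
  generated (H := QOC) is_generator x -> generated (H := QOC) OC_KP x.
Proof.
elim=> {O M C n x}; last 5 first.
- by move=> *; apply: gen_relabel.
- by move=> *; apply: gen_ocomp.
- by move=> *; apply: gen_ccomp.
- by move=> *; apply: gen_octr.
- by move=> *; apply: gen_cctr.
by move=> O M C n x /is_generator_KP; apply: gen_base.
Qed.

Lemma planar_elem (O : finType) (M : multicycle O) (C : finType) n :
  planar_ok (map size M) #|C| -> (n + 2)%N = (2 * size M + #|C|)%N ->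
  exists x : QOC_KP O M C n, sval (sval x) = 0%N.
Proof.
move=> ok En.
have g0 : genus_eq (size M) #|C| n 0 by rewrite /genus_eq En.
have Gx : generated (H := QOC) is_generator (Qoc g0) by apply: (planar_all ok).
by exists (exist _ _ (generated_KP Gx)).
Qed.

Definition homs (K : fieldType) (V : graded_space K) (ds : seq int) (l : seq V) : bool :=
  all2 (fun d a => a \in hom V d) ds l.

Definition sumz (ds : seq int) : int := \sum_(e <- ds) e.

Lemma dg_sumz (I J : finType) (d : J -> int) (h : I -> J) l : dg d (map h l) = sumz (map (d \o h)
  l).
Proof. by rewrite /dg /sumz !big_map. Qed.

Lemma map_split2 (T U W : Type) (f : T -> U) (g : T -> W) c l1 l2 m1 m2 :
  map f c = l1 ++ l2 -> map g c = m1 ++ m2 -> size m1 = size l1 ->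
  exists c1 c2, [/\ c = c1 ++ c2, map f c1 = l1 /\ map g c1 = m1 & map f c2 = l2 /\ map g c2 = m2].
Proof.
move=> fE gE sz; exists (take (size l1) c), (drop (size l1) c); split.
- by rewrite cat_take_drop.
- by rewrite !map_take fE gE take_size_cat // -sz take_size_cat.
- by rewrite !map_drop fE gE drop_size_cat // -sz drop_size_cat.
Qed.

Lemma open_at_rcons (T : eqType) (c : seq T) u : u \notin c ->
  open_at (cycle_of [:: rcons c u] u) u = c.
Proof.
move=> nu; rewrite /cycle_of /= mem_rcons inE eqxx /= /open_at -cats1 index_cat (negPf nu) /= eqxx
  addn0.
by rewrite rot_size_cat.
Qed.

Lemma upd_notin (T : finType) (W : Type) (X : {ffun T -> W}) u a l : u \notin l ->
  map (upd X u a) l = map X l.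
Proof.
move=> nu; apply/eq_in_map => t tl; rewrite ffunE; case: eqP => // E.
by rewrite -E tl in nu.
Qed.

Section Homog.
Variables (K : fieldType) (A B : form_space K) (O C : finType).
Variables (d : O + C -> int) (X : {ffun O -> A}) (Y : {ffun C -> B}).
Hypothesis h : homog d X Y.

Definition setd (i : O + C) (f : int) : O + C -> int := fun j => if j == i then f else d j.

Lemma homog_updO u f a : a \in hom A f -> homog (setd (inl u) f) (upd X u a) Y.
Proof.
case: h => hX hY ha; split=> [o|c]; rewrite /setd ?ffunE //.
by rewrite (inj_eq (@inl_inj _ _)); case: eqP.
Qed.

Lemma homog_updC u f a : a \in hom B f -> homog (setd (inr u) f) X (upd Y u a).
Proof.
case: h => hX hY ha; split=> [o|c]; rewrite /setd ?ffunE //.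
by rewrite (inj_eq (@inr_inj _ _)); case: eqP.
Qed.

Lemma dg_setd i f l : i \notin l -> dg (setd i f) l = dg d l.
Proof.
move=> ni; apply: eq_big_seq => j jl; rewrite /setd; case: eqP => // E.
by rewrite -E jl in ni.
Qed.

End Homog.

Lemma evl_scaleC (K : fieldType) (A B : form_space K) (O C : finType) (phi : endo A B O C) l x y c
  k b :
  evl phi l x (upd y c (k *: b)) = k * evl phi l x (upd y c b).
Proof.
rewrite /evl; case: insub => [s|]; last by rewrite mulr0.
have E : phi s x (upd y c 0) = 0 by apply: (ev_zeroC _ _ _ (c := c)); rewrite ffunE eqxx.
by rewrite -[k *: b]addr0 ev_linC E addr0.
Qed.

Lemma lfun_of_linear (K : fieldType) (U W : vectType K) (g : U -> W) : linear g ->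
  exists h : 'Hom(U, W), forall a, h a = g a.
Proof.
move=> lg; pose G : {linear U -> W} := HB.pack g (GRing.isLinear.Build K U W *:%R g lg).
by exists (linfun G) => a; rewrite lfunE.
Qed.

Section FormFacts.
Variables (K : fieldType) (V : form_space K).
Implicit Types (a b c : V).

Lemma bil_inj_hom a b : (forall d c, c \in hom V d -> bil a c = bil b c) -> a = b.
Proof.
move=> H; apply: bil_inj => c; elim/hom_ind: c => [|d c c' hc IH]; first by rewrite !bil0r.
by rewrite !bilDr IH (H _ _ hc).
Qed.

Lemma bil_injr_hom a b : (forall d c, c \in hom V d -> bil c a = bil c b) -> a = b.
Proof.
move=> H; rewrite -[a]bil_snakel -[b]bil_snakel !big_seq.
by apply: eq_bigr => e /copairing_hom[d [_ h2]]; rewrite (H _ _ h2).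
Qed.

(** In the expansion of [a] along the copairing, the coefficients of the basis vectors of the wrong
    degree vanish. *)
Lemma hom_of_bil D a : (forall d c, c \in hom V d -> D + d != 0 -> bil a c = 0) -> a \in hom V D.
Proof.
move=> H; rewrite -[a]bil_snaker big_seq; apply: rpred_sum => e /copairing_hom[d [h1 h2]].
have [E|n] := eqVneq (D + d) 0; last by rewrite (H _ _ h1) // scale0r mem0v.
by rewrite (_ : D = - d); [apply: rpredZ | apply/eqP; rewrite -addr_eq0 E].
Qed.

Lemma hom_of_bilr D a : (forall d c, c \in hom V d -> D + d != 0 -> bil c a = 0) -> a \in hom V D.
Proof.
move=> H; rewrite -[a]bil_snakel big_seq; apply: rpred_sum => e /copairing_hom[d [h1 h2]].
have [E|n] := eqVneq (D - d) 0; last by rewrite (H _ _ h2) // scale0r mem0v.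
by rewrite (_ : D = d); [apply: rpredZ | apply/eqP; rewrite -subr_eq0 E].
Qed.

Lemma koszul_scale0 a : koszul_scale V 0 a = a.
Proof.
elim/hom_ind: a => [|d a a' ha IH]; first exact: hom0.
by rewrite homD IH (koszul_scaleE _ ha) scale1r.
Qed.

Lemma mul_of_form (T : V -> V -> V -> K) : trilinear_form T ->
  exists mu : 'Hom(V, 'Hom(V, V)), forall a b c, bil (mul mu a b) c = T a b c.
Proof.
move=> [T12 T23]; pose m a b := \sum_(e <- copairing V) T a b e.1 *: e.2.
have m2 a : linear (m a).
  move=> k b b'; rewrite /m scaler_sumr -big_split /=; apply: eq_bigr => e _.
  by rewrite (T12 _).2 scalerDl scalerA.
have /choice[h hE] a := lfun_of_linear (m2 a).
have lh : linear h.
  move=> k a a'; apply/lfunP => b; rewrite add_lfunE scale_lfunE !hE /m scaler_sumr -big_split /=.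
  by apply: eq_bigr => e _; rewrite (T12 _).1 scalerDl scalerA.
have [mu muE] := lfun_of_linear lh.
exists mu => a b c; rewrite /mul muE hE /m bil_suml -[in RHS](bil_snakel c).
have lT : linear (T a b : V -> K^o) by move=> k x y; apply: (T23 a).2.
by rewrite (lin_comb lT); apply: eq_bigr => e _; rewrite bilZl mulrC.
Qed.

(** Associativity is rotation invariance of a four-point function. [Q] is the pairing of a b with c
    d; rotating it gives the pairing of b c with d a, and invariance of the form turns the equality
    of the two into (a b) c = a (b c), paired with d. *)
Lemma frobenius_of_form (mu : 'Hom(V, 'Hom(V, V))) (Q : V -> V -> V -> V -> K) :
  (forall d e a b, a \in hom V d -> b \in hom V e -> mu a b \in hom V (d + e)) ->
  (forall d1 d2 d3 a1 a2 a3, a1 \in hom V d1 -> a2 \in hom V d2 -> a3 \in hom V d3 ->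
     bil (mul mu a1 a2) a3 = (-1) ^+ (oddz d1 && oddz (d2 + d3)) * bil (mul mu a2 a3) a1) ->
  (forall d1 d2 d3 d4 a b c d, a \in hom V d1 -> b \in hom V d2 -> c \in hom V d3 -> d \in hom V d4
    ->
     Q a b c d = \sum_(e <- copairing V) bil (mul mu a b) e.1 * bil (mul mu e.2 c) d) ->
  (forall d1 d2 d3 d4 a b c d, a \in hom V d1 -> b \in hom V d2 -> c \in hom V d3 -> d \in hom V d4
    ->
     Q a b c d = (-1) ^+ (oddz d1 && oddz (d2 + (d3 + d4))) * Q b c d a) ->
  is_frobenius mu.
Proof.
move=> hdeg hcyc hQ hrot; have hmul := bil_mul_cyc hdeg hcyc.
split=> // a b c; apply: bil_inj_hom => dd d hd.
have {}hQ d1 d2 d3 d4 a' b' c' d' : a' \in hom V d1 -> b' \in hom V d2 -> c' \in hom V d3 -> d' \in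
  hom V d4 ->
     Q a' b' c' d' = bil (mul mu a' b') (mul mu c' d').
  move=> h1 h2 h3 h4; rewrite (hQ _ _ _ _ _ _ _ _ h1 h2 h3 h4) -[RHS]bil_snake.
  by apply: eq_bigr => e _; rewrite (hmul e.2).
apply: (trilinear_ext (F := fun a b c => bil (mul mu (mul mu a b) c) d)
  (G := fun a b c => bil (mul mu a (mul mu b c)) d)) => {a b c} [||d1 d2 d3 a b c ha hb hc].
- by split=> ?; split=> *; rewrite !(mulvDl, mulvDr, mulvZl, mulvZr) bilDl bilZl.
- by split=> ?; split=> *; rewrite !(mulvDl, mulvDr, mulvZl, mulvZr) bilDl bilZl.
rewrite (hmul (mul mu a b)) (hmul a (mul mu b c)) -(hQ _ _ _ _ _ _ _ _ ha hb hc hd) (hrot _ _ _ _ _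
  _ _ _ ha hb hc hd).
rewrite (hQ _ _ _ _ _ _ _ _ hb hc hd ha) -hmul.
rewrite [RHS](bil_sym ha (hdeg _ _ _ _ (hdeg _ _ _ _ hb hc) hd)); by rewrite !addrA.
Qed.

End FormFacts.

Section PlanarSurfaces.
Variables (K : fieldType) (A B : form_space K) (al : KP_algebra A B).

(* The value of the algebra on the genus 0 surface with boundary words L and closed
   inputs Bs, in this order; 0 if QOC_KP has no such surface. *)
Definition planar_value (L : seq (seq A)) (Bs : seq B) : K :=
  if pselect (exists x : QOC_KP _ (canon_mc (map size L)) 'I_(size Bs) (2 * size L + size Bs - 2)%N,
                sval (sval x) = 0%N) is left ex
  then evl (al _ _ _ _ (projT1 (cid ex)))
         (map inl (enum 'I_(sumn (map size L))) ++ map inr (enum 'I_(size Bs)))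
         [ffun i => nth 0 (flatten L) (val i)] [ffun i => nth 0 Bs (val i)]
  else 0.

Lemma planar_okE sh c : planar_ok sh c -> (2 <= 2 * size sh + c)%N.
Proof. by case: sh => [|a [|b sh]] /=; rewrite /planar_ok /=; lia. Qed.

(** Equivariance reduces any labelling to the canonical one. From here on labels are replaced by the
    words and lists of vectors placed on them. *)
Lemma planar_valueE (O : finType) (M : multicycle O) (C : finType) n (x : QOC_KP O M C n)
    (X : {ffun O -> A}) (Y : {ffun C -> B}) (Cs : seq C) :
  planar_ok (map size M) #|C| -> sval (sval x) = 0%N -> perm_eq Cs (enum C) ->
  evl (al _ _ _ _ x) (map inl (flatten M) ++ map inr Cs) X Y =
  planar_value (map (map X) M) (map Y Cs).
Proof.
move=> ok x0 pC; rewrite /planar_value.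
set L := map (map X) M; set Bs := map Y Cs.
have sL : map size L = map size M.
  by rewrite -map_comp; apply: eq_map => c /=; rewrite size_map.
have sB : size Bs = #|C| by rewrite size_map (perm_size pC) -cardE.
have sL' : size L = size M by rewrite size_map.
case: pselect => [ex|[]]; last first.
  have ok' : planar_ok (map size L) (size Bs) by rewrite sL sB.
  have Esz : size (canon_mc (map size L)) = size L.
    by rewrite -[LHS](size_map size) canon_mc_shape size_map.
  apply: planar_elem; rewrite ?canon_mc_shape card_ord //.
  have := planar_okE ok'; rewrite size_map => h.
  by apply/eqP; rewrite Esz; move: h; set p := size L; set q := size Bs; lia.
case: (cid ex) => e /= e0 {ex}.
have ffl : flatten L = map X (flatten M) by rewrite map_flatten.
have [|h Eh] := bijection_of_lists (perm_refl (enum 'I_(sumn (map size L)))) (multicycleP M).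
  by rewrite size_enum_ord size_flatten /shape sL.
have [|k Ek] := bijection_of_lists (perm_refl (enum 'I_(size Bs))) pC.
  by rewrite size_enum_ord size_map.
have Ecan : map (map h) (canon_mc (map size L)) = M.
  apply: flatten_map_inj; last by rewrite canon_mc_shape.
  by rewrite /= reshapeKr // size_enum_ord.
have [f Ef] := mc_iso_map Ecan.
have En : n = (2 * size L + size Bs - 2)%N.
  have := svalP (sval x); rewrite x0 /genus_eq => /eqP; have := planar_okE ok.
  by rewrite size_map sL' sB; lia.
move: e e0; rewrite -En => e e0.
have -> : x = hrelabel f k e by apply: qoc_kp_inj; rewrite /= x0 e0.
rewrite hmap_relabel /= relabel_evl; last first.
  exact: inputs_perm (multicycleP M) pC.
rewrite Ef map_cat -Eh -Ek -!map_comp.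
congr (evl _ _ _ _).
- congr (_ ++ _); apply: eq_map => i /=; by rewrite bfunK.
- apply/ffunP => i; rewrite !ffunE ffl -Eh -(map_comp X h).
  rewrite (nth_map i) ?size_enum_ord ?ltn_ord //=.
  by congr (X (h _)); apply: val_inj; rewrite /= nth_enum_ord.
apply/ffunP => i; rewrite !ffunE.
have EB : Bs = map (Y \o k) (enum 'I_(size Bs)) by rewrite map_comp Ek.
have /= -> := congr1 (fun s => nth 0 s i) EB.
rewrite (nth_map i) ?size_enum_ord ?ltn_ord //=.
by congr (Y (k _)); apply: val_inj; rewrite /= nth_enum_ord.
Qed.

Lemma homs_nth (V : graded_space K) ds (l : seq V) i : homs ds l -> l`_i \in hom V ds`_i.
Proof.
elim: l ds i => [|a l IH] [|d ds] i //=; first by rewrite !nth_nil mem0v.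
by case: i => [|i] /andP[h1 h2] //; apply: IH.
Qed.

Lemma homs_size (V : graded_space K) ds (l : seq V) : homs ds l -> size ds = size l.
Proof. by elim: l ds => [|a l IH] [|d ds] //= /andP[_ /IH ->]. Qed.

Lemma homs_flatten (V : graded_space K) dl (L : seq (seq V)) : all2 (@homs K V) dl L ->
  homs (flatten dl) (flatten L) /\ map size dl = map size L.
Proof.
elim: L dl => [|l L IH] [|d dl] //= /andP[h /IH[h2 ->]].
split; last by rewrite (homs_size h).
by elim: l d h => [|a l IHl] [|e d] //= /andP[-> /IHl].
Qed.

(** The converse passage from words to labels: it provides a labelled surface together with a degree
    function, which the lemmas on Koszul signs require. *)
Lemma planar_labels (L : seq (seq A)) (Bs : seq B) dl db :
  planar_ok (map size L) (size Bs) -> all2 (@homs K A) dl L -> homs db Bs ->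
  exists (O C : finType) (M : multicycle O) n (x : QOC_KP O M C n)
    (X : {ffun O -> A}) (Y : {ffun C -> B}) (d : O + C -> int),
  [/\ sval (sval x) = 0%N, homog d X Y,
      map (map X) M = L /\ map Y (enum C) = Bs &
      map (map (d \o inl)) M = dl /\ map (d \o inr) (enum C) = db].
Proof.
move=> ok hL hB; have [hfl sdl] := homs_flatten hL.
have Esz : size (canon_mc (map size L)) = size L.
  by rewrite -[LHS](size_map size) canon_mc_shape size_map.
have [] := @planar_elem _ (canon_mc (map size L)) 'I_(size Bs) (2 * size L + size Bs - 2).
- by rewrite canon_mc_shape card_ord.
- have := planar_okE ok; rewrite size_map card_ord Esz.
  set p := size L; set q := size Bs; lia.
move=> x x0; exists _, _, _, _, x, [ffun i => nth 0 (flatten L) (val i)], [ffun i => nth 0 Bs (val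
  i)].
exists (fun i => match i with inl i => nth 0 (flatten dl) (val i) | inr i => nth 0 db (val i) end).
have lab (V : Type) (z : V) (l : seq V) (X : 'I_(size l) -> V) :
    (forall i, X i = nth z l i) -> map X (enum 'I_(size l)) = l.
  move=> E; apply: (@eq_from_nth _ z); first by rewrite size_map size_enum_ord.
  rewrite size_map size_enum_ord => i lti; have i0 := Ordinal lti.
  by rewrite (nth_map i0) ?size_enum_ord // E nth_enum_ord.
have lab2 (V : Type) (z : V) (l : seq (seq V)) (X : 'I_(sumn (map size L)) -> V) : map size l = map
  size L ->
    (forall i, X i = nth z (flatten l) i) -> map (map X) (canon_mc (map size L)) = l.
  move=> sl E; apply: flatten_map_inj; last by rewrite canon_mc_shape sl.
  rewrite /= reshapeKr ?size_enum_ord //.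
  move: X E; rewrite -sl -[sumn _](size_flatten l) => X E; exact: lab E.
split=> //.
- by split=> i; rewrite ffunE homs_nth.
- split; first by apply: (lab2 _ 0) => // i; rewrite ffunE.
  by apply: (lab _ 0) => i; rewrite ffunE.
split; first exact: (lab2 _ 0).
by rewrite -(homs_size hB) in x x0 *; apply: (lab _ 0).
Qed.

Notation F := planar_value.

Lemma homs_cat (V : graded_space K) d1 d2 (l1 l2 : seq V) :
  homs d1 l1 -> homs d2 l2 -> homs (d1 ++ d2) (l1 ++ l2).
Proof. by elim: l1 d1 => [|a l1 IH] [|d d1] //= /andP[-> h] /(IH _ h). Qed.

Lemma planar_ok_map (O C : finType) (M : multicycle O) (X : O -> A) (Y : C -> B) Cs L Bs :
  perm_eq Cs (enum C) -> map (map X) M = L -> map Y Cs = Bs -> planar_ok (map size L) (size Bs) ->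
  planar_ok (map size M) #|C|.
Proof.
move=> p <- <-; rewrite size_map (perm_size p) -cardE -map_comp.
by congr planar_ok; apply: eq_map => c /=; rewrite size_map.
Qed.

Lemma identity_bijection (T : Type) : exists h : bijection T T, bfun h =1 id /\ binv h =1 id.
Proof. by exists (@Bijection T T id id (fun _ => erefl) (fun _ => erefl)). Qed.

(** A rotated presentation is isomorphic to the original one over the identity of the labels, so the
    algebra assigns the same form to both. Only the order of evaluation changes, and this gives the
    sign. *)
Lemma planar_rot p1 p2 R Bs d1 d2 dR db :
  planar_ok (map size ((p1 ++ p2) :: R)) (size Bs) ->
  homs d1 p1 -> homs d2 p2 -> all2 (@homs K A) dR R -> homs db Bs ->
  F ((p1 ++ p2) :: R) Bs =
  (-1) ^+ (oddz (sumz d1) && oddz (sumz d2)) * F ((p2 ++ p1) :: R) Bs.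
Proof.
move=> ok h1 h2 hR hB.
have [|||O [C [M [n [x [X [Y [d [x0 h [EL EB] [dL dB]]]]]]]]]] := @planar_labels ((p1 ++ p2) :: R)
  Bs ((d1 ++ d2) :: dR) db.
- exact: ok.
- by rewrite /= homs_cat.
- exact: hB.
have okM := planar_ok_map (perm_refl _) EL EB ok.
case EM : (cycles M) EL dL => [|c R'] //= [Ec ER] [dc dR'].
have [c1 [c2 [Ecc [X1 D1] [X2 D2]]]] := map_split2 Ec dc (homs_size h1).
have pM' : perm_eq (flatten ((c2 ++ c1) :: R')) (enum O).
  by apply: perm_trans (multicycleP M); rewrite EM Ecc /= perm_cat2r perm_catC.
have [M' EM'] : exists M' : multicycle O, cycles M' = (c2 ++ c1) :: R' by exists (Multicycle pM').
have [h0 [h0E h0V]] := identity_bijection O; have [k [kE kV]] := identity_bijection C.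
have [f Ef] : exists f : mc_iso M M', iso_elt f = h0.
  apply: (@mc_iso_of_lists _ _ _ _ _ (iota 0 (size M'))); rewrite ?EM' //.
    by rewrite size_iota EM.
  move=> [|i]; rewrite EM /= => lti.
    by exists (size c1); rewrite (eq_map h0E) map_id Ecc rot_size_cat.
  by exists 0%N; rewrite rot0 -[1%N]addn0 iotaDl (nth_map 0%N) ?size_iota // nth_iota //= (eq_map
    h0E) map_id.
have okM' : planar_ok (map size M') #|C|.
  by move: okM; rewrite EM EM' /= Ecc !size_cat addnC.
have E1 := planar_valueE X Y okM x0 (perm_refl _).
have x0' : sval (sval (hrelabel f (k) x)) = 0%N by [].
have := planar_valueE X Y okM' x0' (perm_refl _).
rewrite EM /= Ecc in E1; rewrite EM' /=.
have EX : [ffun o => X (h0 o)] = X by apply/ffunP => o; rewrite ffunE h0E.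
have EY : [ffun o => Y (k o)] = Y by apply/ffunP => o; rewrite ffunE kE.
rewrite hmap_relabel /= relabel_evl; last exact: (inputs_perm pM').
rewrite Ef EX EY.
have E0 : sum_map (binv h0) (binv k) =1 id by move=> [o|z] /=; rewrite ?h0V ?kV.
rewrite (eq_map E0) map_id.
rewrite !map_cat ER EB X1 X2 in E1 * => <-; rewrite -E1.
rewrite -!catA.
have := evl_swap (al _ _ _ _ x) [::] (map inl c1) (map inl c2) (map inl (flatten R') ++ map inr
  (enum C)) h.
by rewrite /= !dg_sumz D1 D2.
Qed.

Lemma planar_swap L B0 B1 B2 B3 dL e0 e1 e2 e3 :
  planar_ok (map size L) (size (B0 ++ B1 ++ B2 ++ B3)) -> all2 (@homs K A) dL L ->
  homs e0 B0 -> homs e1 B1 -> homs e2 B2 -> homs e3 B3 ->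
  F L (B0 ++ B1 ++ B2 ++ B3) =
  (-1) ^+ (oddz (sumz e1) && oddz (sumz e2)) * F L (B0 ++ B2 ++ B1 ++ B3).
Proof.
move=> ok hL h0 h1 h2 h3.
have [|||O [C [M [n [x [X [Y [d [x0 h [EL EB] [dE dB]]]]]]]]]] :=
  @planar_labels L (B0 ++ B1 ++ B2 ++ B3) dL (e0 ++ e1 ++ e2 ++ e3) => //.
  by do 3!apply: homs_cat => //.
have okM := planar_ok_map (perm_refl _) EL EB ok.
have [c0 [c' [Ec [X0 D0] [EB' dB']]]] := map_split2 EB dB (homs_size h0).
have [c1 [c'' [Ec' [X1 D1] [EB'' dB'']]]] := map_split2 EB' dB' (homs_size h1).
have [c2 [c3 [Ec'' [X2 D2] [X3 D3]]]] := map_split2 EB'' dB'' (homs_size h2).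
have pC : perm_eq (c0 ++ c2 ++ c1 ++ c3) (enum C).
  by rewrite Ec Ec' Ec'' perm_cat2l; apply/permPl/perm_catCA.
have := planar_valueE X Y okM x0 pC.
have := planar_valueE X Y okM x0 (perm_refl _).
rewrite Ec Ec' Ec'' EL !map_cat X0 X1 X2 X3 => <- <-.
have := evl_swap (al _ _ _ _ x) (map inl (flatten M) ++ map inr c0) (map inr c1) (map inr c2) (map
  inr c3) h.
by rewrite !dg_sumz D1 D2 -!catA.
Qed.

(** Gluing evaluates all inputs of the first disc before those of the second: the sign in front
    comes from exchanging [B1] and [p2]. The glued input then stands behind [B1] instead of [p1],
    which accounts for [koszul_scale]. *)
Lemma planar_ocomp_value p1 p2 B1 B2 d1 d2 b1 b2 :
  planar_ok [:: (size p1).+1] (size B1) -> planar_ok [:: (size p2).+1] (size B2) ->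
  homs d1 p1 -> homs d2 p2 -> homs b1 B1 -> homs b2 B2 ->
  F [:: p1 ++ p2] (B1 ++ B2) =
  (-1) ^+ (oddz (sumz d2) && oddz (sumz b1)) *
  \sum_(e <- copairing A)
    F [:: rcons p1 (koszul_scale A (sumz b1) e.1)] B1 * F [:: e.2 :: p2] B2.
Proof.
move=> ok1 ok2 h1 h2 hB1 hB2.
(* The vector 0, which is homogeneous of every degree, holds the place of the glued input until a
   leg of the copairing is written there. *)
have [|||O1 [C1 [M1 [n1 [x [X1 [Y1 [D1 [x0 H1 [EL1 EB1] [dE1 dB1]]]]]]]]]] :=
  @planar_labels [:: rcons p1 0] B1 [:: rcons d1 0] b1 => //.
- by rewrite /= size_rcons.
- by rewrite /= andbT -!cats1 homs_cat //= mem0v.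
have [|||O2 [C2 [M2 [n2 [y [X2 [Y2 [D2 [y0 H2 [EL2 EB2] [dE2 dB2]]]]]]]]]] :=
  @planar_labels [:: 0 :: p2] B2 [:: 0 :: d2] b2 => //.
- by rewrite /= andbT mem0v.
have okM1 : planar_ok (map size M1) #|C1| by apply: planar_ok_map (perm_refl _) EL1 EB1 _;
  rewrite /= size_rcons.
have okM2 : planar_ok (map size M2) #|C2| by apply: planar_ok_map (perm_refl _) EL2 EB2 _.
case EM1 : (cycles M1) EL1 dE1 => [|c1 []] //= [Ec1] [dc1].
case EM2 : (cycles M2) EL2 dE2 => [|c2 []] //= [Ec2] [dc2].
case/lastP: c1 EM1 Ec1 dc1 => [|P1 u] EM1; first by move/(congr1 size); rewrite size_rcons.
rewrite !map_rcons => /rcons_inj[XP1 _] /rcons_inj[dP1 _].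
case: c2 EM2 Ec2 dc2 => [|v P2] // EM2 [_ XP2] [_ dP2].
have [uP1 vP2] : u \notin P1 /\ v \notin P2.
  have := enum_uniq O1; rewrite -(perm_uniq (multicycleP M1)) EM1 /= cats0 rcons_uniq => /andP[->
    _].
  by have := enum_uniq O2; rewrite -(perm_uniq (multicycleP M2)) EM2 /= cats0 => /andP[-> _].
pose l1 := map (inl : O1 -> O1 + O2) P1; pose l2 := map (inr : O2 -> O1 + O2) P2.
have Em : mc_merge M1 M2 u v = [:: sub (inl u) (inr v) (l1 ++ l2)] :> seq _.
  transitivity (map (sub (inl u) (inr v)) (contract_cycles (mc_union M1 M2) (inl u) (inr v))) => //.
  rewrite merge_cycles ?(perm_mem (multicycleP _)) ?mem_enum // EM1 EM2.
  by rewrite open_at_rcons // open_at_head /= mem_rcons !inE !eqxx.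
have [nu1 nv1 nu2 nv2] := inl_inr_notin uP1 vP2.
pose W : {ffun without2 (inl u) (inr v) -> A} :=
  [ffun z => match val z with inl o => X1 o | inr o => X2 o end].
pose Yw : {ffun C1 + C2 -> B} := [ffun c => match c with inl c => Y1 c | inr c => Y2 c end].
pose D (i : without2 (inl u) (inr v) + (C1 + C2)) : int :=
  match i with
  | inl z => match val z with inl o => D1 (inl o) | inr o => D2 (inl o) end
  | inr (inl c) => D1 (inr c) | inr (inr c) => D2 (inr c) end.
have HD : homog D W Yw.
  case: H1 H2 => [hX1 hY1] [hX2 hY2].
  by split=> [z|c]; rewrite ffunE /=; [case: (val z)|case: c].
have x0' : sval (sval (ocomp u v x y)) = 0%N by rewrite /= x0 y0.
have okM : planar_ok (map size (mc_merge M1 M2 u v)) #|{: C1 + C2}|.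
  have sz : size (sub (inl u) (inr v) (l1 ++ l2)) = (size p1 + size p2)%N.
    by rewrite -(size_map val) map_val_sub ?mem_cat ?negb_or ?nu1 ?nv1 // size_cat !size_map -XP1
      -XP2 !size_map.
  have [E1 E2] : #|C1| = size B1 /\ #|C2| = size B2 by rewrite -EB1 -EB2; split;
    rewrite [RHS]size_map cardE.
  by move: ok1 ok2; rewrite Em card_sum E1 E2 /planar_ok /= sz; lia.
have pC := perm_enum_sum C1 C2.
have := planar_valueE W Yw okM x0' pC.
rewrite hmap_ocomp Em /= cats0 sub_cat !map_cat.
have WE z : W z = match val z with inl o => X1 o | inr o => X2 o end by rewrite ffunE.
have [W1 W2] := map_sub_sum uP1 vP2 WE; rewrite XP1 in W1; rewrite XP2 in W2.
have DE2 : map (D \o inl) (sub (inl u) (inr v) l2) = d2.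
  by have [|_ ->] := @map_sub_sum _ _ _ _ _ (D1 \o inl) (D2 \o inl) (D \o inl) _ _ uP1 vP2;
    first by move=> z /=; case: (val z).
have [YE1 YE2] : map Yw (map inl (enum C1)) = B1 /\ map Yw (map inr (enum C2)) = B2.
  by rewrite -EB1 -EB2 -!map_comp; split; apply: eq_map => c; rewrite /= ffunE.
rewrite W1 W2 YE1 YE2 => <-.
rewrite -catA (evl_swap _ _ _ _ _ HD) !dg_sumz DE2.
have -> : map (D \o inr) (map inl (enum C1)) = b1 by rewrite -dB1 -map_comp.
congr (_ * _).
set S := _ ++ _ ++ _ ++ _.
have pS : perm_eq S (enum {: without2 (inl u) (inr v) + (C1 + C2)}).
  have pm := multicycleP (mc_merge M1 M2 u v); rewrite Em /= cats0 sub_cat in pm.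
  have := inputs_perm pm pC; rewrite !map_cat -catA; apply: perm_trans.
  by rewrite perm_cat2l; apply/permPl/perm_catCA.
rewrite (ocomp_evl (P1 := map inl P1 ++ map inr (enum C1)) (P2 := map inl P2 ++ map inr (enum C2))
  _ _ HD pS); last first.
  rewrite /S !map_cat -!map_comp.
  have -> : map (sum_map val id \o inl) (sub (inl u) (inr v) l1) = map inl (map val (sub (inl u)
    (inr v) l1)) :> seq ((O1 + O2) + (C1 + C2)).
    by rewrite -map_comp.
  have -> : map (sum_map val id \o inl) (sub (inl u) (inr v) l2) = map inl (map val (sub (inl u)
    (inr v) l2)) :> seq ((O1 + O2) + (C1 + C2)).
    by rewrite -map_comp.
  by rewrite !map_val_sub // -!map_comp -!catA.
rewrite !big_seq; apply: eq_bigr => e /copairing_hom[f [e1 e2]].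
have [EX1 EX2] := ext2_sum e.1 e.2 WE.
have EY1 : [ffun c => Yw (inl c)] = Y1 by apply/ffunP => c; rewrite !ffunE.
have EY2 : [ffun c => Yw (inr c)] = Y2 by apply/ffunP => c; rewrite !ffunE.
rewrite EX1 EX2 EY1 EY2; congr (_ * _).
  have := planar_valueE (upd X1 u (koszul_scale A (sumz b1) e.1)) Y1 okM1 x0 (perm_refl _).
  rewrite EM1 /= cats0 !map_rcons upd_notin // ffunE eqxx XP1 EB1 => <-.
  rewrite (koszul_scaleE _ e1) evl_scaleO -cats1 -!catA.
  have := evl_swap (al _ _ _ _ x) (map inl P1) (map inr (enum C1)) [:: inl u] [::] (homog_updO H1 u
    e1).
  rewrite cats0 => ->; congr (_ ^+ (oddz _ && oddz _) * _).
  - by rewrite dg_setd ?dg_sumz ?dB1 //; apply/mapP => -[].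
  - by rewrite dg_cons dg_nil /setd eqxx addr0.
  by rewrite cats0.
have := planar_valueE (upd X2 v e.2) Y2 okM2 y0 (perm_refl _).
by rewrite EM2 /= cats0 upd_notin // ffunE eqxx XP2 EB2 => <-.
Qed.

(** As for open gluing, with the roles of words and closed inputs exchanged: the words of [L2] pass
    the closed inputs [B1], and the glued closed input of the second surface passes these words. *)
Lemma planar_ccomp_value L1 L2 B1 B2 d1 d2 b1 b2 :
  planar_ok (map size L1) (size B1).+1 -> planar_ok (map size L2) (size B2).+1 ->
  planar_ok (map size (L1 ++ L2)) (size (B1 ++ B2)) ->
  all2 (@homs K A) d1 L1 -> all2 (@homs K A) d2 L2 -> homs b1 B1 -> homs b2 B2 ->
  F (L1 ++ L2) (B1 ++ B2) =
  (-1) ^+ (oddz (sumz (flatten d2)) && oddz (sumz b1)) *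
  \sum_(c <- copairing B)
    F L1 (rcons B1 c.1) * F L2 (koszul_scale B (sumz (flatten d2)) c.2 :: B2).
Proof.
move=> ok1 ok2 ok h1 h2 hB1 hB2.
have [|||O1 [C1 [M1 [n1 [x [X1 [Y1 [D1 [x0 H1 [EL1 EB1] [dE1 dB1]]]]]]]]]] :=
  @planar_labels L1 (rcons B1 0) d1 (rcons b1 0) => //.
- by rewrite size_rcons.
- by rewrite -!cats1 homs_cat //= mem0v.
have [|||O2 [C2 [M2 [n2 [y [X2 [Y2 [D2 [y0 H2 [EL2 EB2] [dE2 dB2]]]]]]]]]] :=
  @planar_labels L2 (0 :: B2) d2 (0 :: b2) => //.
- by rewrite /= mem0v.
have okM1 : planar_ok (map size M1) #|C1| by apply: planar_ok_map (perm_refl _) EL1 EB1 _;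
  rewrite size_rcons.
have okM2 : planar_ok (map size M2) #|C2| by apply: planar_ok_map (perm_refl _) EL2 EB2 _.
case/lastP EC1 : (enum C1) EB1 dB1 => [|Q1 u]; first by move/(congr1 size); rewrite size_rcons.
rewrite !map_rcons => /rcons_inj[YQ1 _] /rcons_inj[dQ1 _].
case EC2 : (enum C2) EB2 dB2 => [|v Q2] // [_ YQ2] [_ dQ2].
have [uQ1 vQ2] : u \notin Q1 /\ v \notin Q2.
  have := enum_uniq C1; rewrite EC1 rcons_uniq => /andP[-> _].
  by have := enum_uniq C2; rewrite EC2 => /andP[-> _].
pose l1 := map (inl : C1 -> C1 + C2) Q1; pose l2 := map (inr : C2 -> C1 + C2) Q2.
have [nu1 nv1 nu2 nv2] := inl_inr_notin uQ1 vQ2.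
pose W : {ffun O1 + O2 -> A} := [ffun o => match o with inl o => X1 o | inr o => X2 o end].
pose Yw : {ffun without2 (inl u) (inr v) -> B} :=
  [ffun z => match val z with inl c => Y1 c | inr c => Y2 c end].
pose D (i : (O1 + O2) + without2 (inl u) (inr v)) : int :=
  match i with
  | inr z => match val z with inl c => D1 (inr c) | inr c => D2 (inr c) end
  | inl (inl o) => D1 (inl o) | inl (inr o) => D2 (inl o) end.
have HD : homog D W Yw.
  case: H1 H2 => [hX1 hY1] [hX2 hY2].
  by split=> [o|z]; rewrite ffunE /=; [case: o|case: (val z)].
have x0' : sval (sval (ccomp u v x y)) = 0%N by rewrite /= x0 y0.
have pC : perm_eq (sub (inl u) (inr v) (l1 ++ l2)) (enum (without2 (inl u) (inr v))).
  apply: sub_perm; apply: perm_trans (perm_enum_sum C1 C2).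
  rewrite EC1 EC2 -cats1 map_cat /= -/l1 -/l2 -catA /=.
  exact/permPl/(perm_catCA [:: inl u; inr v]).
have YwE z : Yw z = match val z with inl c => Y1 c | inr c => Y2 c end by rewrite ffunE.
have [YE1 YE2] := map_sub_sum uQ1 vQ2 YwE; rewrite YQ1 in YE1; rewrite YQ2 in YE2.
have DE1 : map (D \o inr) (sub (inl u) (inr v) l1) = b1.
  by have [|-> _] := @map_sub_sum _ _ _ _ _ (D1 \o inr) (D2 \o inr) (D \o inr) _ _ uQ1 vQ2;
    first by move=> z /=; case: (val z).
have Em (Z : Type) (G1 : O1 -> Z) (G2 : O2 -> Z) (G : O1 + O2 -> Z) :
    (forall z, G z = match z with inl o => G1 o | inr o => G2 o end) ->
    map (map G) (mc_union M1 M2) = map (map G1) M1 ++ map (map G2) M2.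
  move=> GE; rewrite /= map_cat -!map_comp.
  by congr (_ ++ _); apply: eq_map => c /=; rewrite -map_comp; apply: eq_map => o /=; rewrite GE.
have okM : planar_ok (map size (mc_union M1 M2)) #|without2 (inl u : C1 + C2) (inr v)|.
  apply: (planar_ok_map (X := W) (Y := Yw) pC) ok.
    by rewrite (Em _ X1 X2) ?EL1 ?EL2 // => z; rewrite ffunE.
  by rewrite sub_cat map_cat YE1 YE2.
have := planar_valueE W Yw okM x0' pC.
rewrite (Em _ X1 X2) ?EL1 ?EL2; last by move=> z; rewrite ffunE.
rewrite hmap_ccomp sub_cat !map_cat YE1 YE2 => <-.
have Efl : flatten (mc_union M1 M2) = map inl (flatten M1) ++ map inr (flatten M2).
  by rewrite /= flatten_cat -!map_flatten.
rewrite Efl map_cat -catA (catA _ _ (map inr (sub _ _ l2))) catA.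
have DL : sumz (flatten d2) = dg D (map inl (map inr (flatten M2))).
  by rewrite dg_sumz -map_comp -dE2 map_flatten.
rewrite -!catA (evl_swap _ _ _ _ _ HD) -DL dg_sumz DE1; congr (_ * _).
set S := _ ++ _ ++ _ ++ _.
have pS : perm_eq S (enum {: (O1 + O2) + without2 (inl u) (inr v)}).
  have pm := multicycleP (mc_union M1 M2); rewrite Efl in pm.
  have := inputs_perm pm pC; rewrite sub_cat !map_cat -catA; apply: perm_trans.
  by rewrite perm_cat2l; apply/permPl/perm_catCA.
rewrite /= (ccomp_evl (P1 := map inl (flatten M1) ++ map inr Q1) (P2 := map inl (flatten M2) ++ map
  inr Q2) _ _ HD pS); last first.
  rewrite /S !map_cat -!map_comp.
  have -> : map (sum_map id val \o inr) (sub (inl u) (inr v) l1) = map inr (map val (sub (inl u)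
    (inr v) l1)) :> seq ((O1 + O2) + (C1 + C2)).
    by rewrite -map_comp.
  have -> : map (sum_map id val \o inr) (sub (inl u) (inr v) l2) = map inr (map val (sub (inl u)
    (inr v) l2)) :> seq ((O1 + O2) + (C1 + C2)).
    by rewrite -map_comp.
  by rewrite !map_val_sub // -!map_comp -!catA.
rewrite !big_seq; apply: eq_bigr => e /copairing_hom[f [e1 e2]].
have [EY1 EY2] := ext2_sum e.1 e.2 YwE.
have EX1 : [ffun o => W (inl o)] = X1 by apply/ffunP => o; rewrite !ffunE.
have EX2 : [ffun o => W (inr o)] = X2 by apply/ffunP => o; rewrite !ffunE.
rewrite EX1 EX2 EY1 EY2; congr (_ * _).
  have := planar_valueE X1 (upd Y1 u e.1) okM1 x0 (perm_refl _).
  by rewrite EC1 !map_rcons upd_notin // ffunE eqxx YQ1 EL1 cats1 rcons_cat => <-.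
have := planar_valueE X2 (upd Y2 v (koszul_scale B (sumz (flatten d2)) e.2)) okM2 y0 (perm_refl _).
rewrite EC2 /= upd_notin // ffunE eqxx YQ2 EL2 => <-.
rewrite (koszul_scaleE _ e2) evl_scaleC.
have := evl_swap (al _ _ _ _ y) [::] [:: inr v] (map inl (flatten M2)) (map inr Q2) (homog_updC H2
  v e2).
rewrite /= => ->; congr (_ ^+ _ * _).
rewrite andbC dg_cons dg_nil /setd eqxx addr0; congr (oddz _ && _).
rewrite dg_setd; last by apply/mapP => -[].
by rewrite dg_sumz -dE2 map_flatten.
Qed.

(** A contraction within one circle keeps the genus at 0 and turns a disc into an annulus without
    leaving the planar surfaces. It enters the Cardy condition. *)
Lemma planar_octr_value p q Bs dp dq db :
  planar_ok [:: (size p + size q).+2] (size Bs) -> planar_ok [:: size p; size q] (size Bs) ->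
  homs dp p -> homs dq q -> homs db Bs ->
  F [:: p; q] Bs =
  \sum_(e <- copairing A) F [:: koszul_scale A (sumz dp) e.1 :: p ++ e.2 :: q] Bs.
Proof.
move=> ok ok2 hp hq hB.
have sz (a b : A) : map size [:: a :: p ++ b :: q] = [:: (size p + size q).+2].
  by rewrite /= size_cat /= addnS.
have [|||O [C [M [n [x [X [Y [d [x0 h [EL EB] [dE dB]]]]]]]]]] :=
  @planar_labels [:: 0 :: p ++ 0 :: q] Bs [:: 0 :: dp ++ 0 :: dq] db => //.
- by rewrite sz.
- by rewrite /= andbT mem0v homs_cat //= mem0v.
have okM : planar_ok (map size M) #|C| by apply: planar_ok_map (perm_refl _) EL EB _; rewrite sz.
case EM : (cycles M) EL dE => [|[|u c] []] // [_ Xc] [_ dc].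
have [P [c' [Ec [XP dP] [Xc' dc']]]] := map_split2 Xc dc (homs_size hp).
case: c' Ec Xc' dc' => [|v Q] // Ec [_ XQ] [_ dQ].
rewrite {}Ec {c Xc dc} in EM.
have U : uniq (u :: P ++ v :: Q).
  by have := enum_uniq O; rewrite -(perm_uniq (multicycleP M)) EM /= cats0.
have [uv uP uQ] : [/\ u != v, u \notin P & u \notin Q].
  by move: U; rewrite /= mem_cat inE !negb_or => /andP[/and3P[-> -> ->]].
have [vP vQ] : v \notin P /\ v \notin Q.
  by move: U; rewrite cons_uniq cat_uniq /= negb_or => /and5P[_ _ /andP[-> _] ->].
have sc : same_cycle M u v by rewrite /same_cycle EM /= !(inE, mem_cat) !eqxx ?orbT.
have Em : mc_contract uv M = [:: sub u v P; sub u v Q] :> seq _.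
  transitivity (map (sub u v) (contract_cycles M u v)) => //.
  rewrite /contract_cycles sc EM open_at_head /= index_cat (negPf vP) /= eqxx addn0.
  by rewrite take_size_cat // -cat_rcons drop_size_cat ?size_rcons // inE eqxx.
have [sX sD] : (forall l, u \notin l -> v \notin l -> map [ffun z : without2 u v => X (val z)] (sub
  u v l) = map X l)
   /\ (forall l, u \notin l -> v \notin l -> map (fun z : without2 u v => d (inl (val z))) (sub u v
     l) = map (d \o inl) l).
  split=> l nu nv; last by rewrite (map_val_comp (d \o inl)).
  by rewrite -(map_val_comp X nu nv); apply: eq_map => z; rewrite ffunE.
pose D (i : without2 u v + C) : int := d (sum_map val id i).
have HD : homog D [ffun z : without2 u v => X (val z)] Y.
  by case: h => hX hY; split=> [z|c]; rewrite ?ffunE.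
have x0' : sval (sval (octr uv x)) = 0%N.
  by rewrite /= sc x0.
have okM' : planar_ok (map size (mc_contract uv M)) #|C|.
  apply: (planar_ok_map (L := [:: p; q]) (X := [ffun z : without2 u v => X (val z)]) (perm_refl _)
    _ EB ok2).
  by rewrite Em /= !sX // XP XQ.
have := planar_valueE [ffun z : without2 u v => X (val z)] Y okM' x0' (perm_refl _).
rewrite hmap_octr Em /= cats0 !sX // XP XQ EB => <-.
have pS : perm_eq (map inl (sub u v P) ++ map inl (sub u v Q) ++ map inr (enum C)) (enum {:
  without2 u v + C}).
  have pm := multicycleP (mc_contract uv M); rewrite Em /= cats0 in pm.
  by have := inputs_perm pm (perm_refl (enum C)); rewrite map_cat -catA.
rewrite map_cat -catA (octr_evl uv _ HD pS).
apply: eq_bigr => e _.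
have -> : dg D (map inl (sub u v P)) = sumz dp by rewrite dg_sumz -dP -sD.
set a := koszul_scale _ _ _.
have EX : ext2 [ffun z : without2 u v => X (val z)] a e.2 = upd (upd X u a) v e.2.
  apply/ffunP => o; rewrite !ffunE; case: eqP => [->|nu]; first by rewrite (negPf uv).
  case: eqP => // nv; case: insubP => [z _ Ez|]; first by rewrite /= ffunE Ez.
  by move/eqP: nu => ->; move/eqP: nv => ->.
have := planar_valueE (upd (upd X u a) v e.2) Y okM x0 (perm_refl _).
rewrite EM /= cats0 !map_cat /= !upd_notin // !ffunE eqxx (negPf uv) eqxx XP XQ EB => <-.
rewrite EX; congr (evl _ _ _ _).
have Es l : u \notin l -> v \notin l -> map (sum_map val id) (map inl (sub u v l)) = map inl l :>
  seq (O + C).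
  by move=> nu nv; rewrite -map_comp -{2}(map_val_sub nu nv) -map_comp.
by rewrite !Es // -map_comp -catA.
Qed.

Lemma planar_deg L Bs dL db : planar_ok (map size L) (size Bs) ->
  all2 (@homs K A) dL L -> homs db Bs -> sumz (flatten dL) + sumz db != 0 -> F L Bs = 0.
Proof.
move=> ok hL hB.
have [|||O [C [M [n [x [X [Y [d [x0 h [EL EB] [dE dB]]]]]]]]]] :=
  @planar_labels L Bs dL db => // dn.
have okM := planar_ok_map (perm_refl _) EL EB ok.
have := planar_valueE X Y okM x0 (perm_refl _); rewrite EL EB => <-.
by apply: (evl_deg _ h); rewrite dg_cat !dg_sumz dB -dE -map_flatten in dn *.
Qed.

Lemma planar_open a b c :
  F [:: [:: a; b; c]] [::] =
  al _ _ _ _ gen_open (mk_ordering ord_open_subproof) (f3 a b c) [ffun=> 0].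
Proof.
have [E1 E2 E3] := f3E a b c; rewrite evl_mk.
have ok : planar_ok (map size mc3) #|{: void}| by rewrite card_void.
have p : perm_eq [::] (enum {: void}) by rewrite enum_void.
have /= -> := planar_valueE (x := gen_open) (f3 a b c) [ffun=> 0] ok erefl p.
by rewrite E1 E2 E3.
Qed.

Lemma planar_closed a b c :
  F [::] [:: a; b; c] =
  al _ _ _ _ gen_closed (mk_ordering ord_closed_subproof) [ffun=> 0] (f3 a b c).
Proof.
have [E1 E2 E3] := f3E a b c; rewrite evl_mk.
have ok : planar_ok (map size mc0) #|'I_3| by rewrite card_ord.
have p : perm_eq [:: 0; 1; 2] (enum 'I_3) by apply: orderingP => // -[[|[|[|]]]].
have /= -> := planar_valueE (x := gen_closed) [ffun=> 0] (f3 a b c) ok erefl p.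
by rewrite E1 E2 E3.
Qed.

Lemma planar_mixed a b :
  F [:: [:: a]] [:: b] =
  al _ _ _ _ gen_mixed (mk_ordering ord_mixed_subproof) [ffun=> a] [ffun=> b].
Proof.
rewrite evl_mk.
have ok : planar_ok (map size mc1) #|{: unit}| by rewrite card_unit.
have p : perm_eq [:: tt] (enum {: unit}) by apply: orderingP => // -[].
have /= -> := planar_valueE (x := gen_mixed) [ffun=> a] [ffun=> b] ok erefl p.
by rewrite !ffunE.
Qed.

Lemma planar_mul_open : exists mu : 'Hom(A, 'Hom(A, A)),
  forall a b c, bil (mul mu a b) c = F [:: [:: a; b; c]] [::].
Proof.
have [mu E] := mul_of_form (endo_trilinearO (al _ _ _ _ gen_open) (mk_ordering ord_open_subproof)
  [ffun=> 0]).
by exists mu => a b c; rewrite planar_open E.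
Qed.

Lemma planar_mul_closed : exists om : 'Hom(B, 'Hom(B, B)),
  forall a b c, bil (mul om a b) c = F [::] [:: a; b; c].
Proof.
have [om E] := mul_of_form (endo_trilinearC (al _ _ _ _ gen_closed) (mk_ordering
  ord_closed_subproof) [ffun=> 0]).
by exists om => a b c; rewrite planar_closed E.
Qed.

Lemma planar_map_mixed : exists f : 'Hom(B, A),
  forall a b, bil a (f b) = F [:: [:: a]] [:: b].
Proof.
have [lO lC] := endo_bilinear (al _ _ _ _ gen_mixed) (mk_ordering ord_mixed_subproof).
have [|f fE] := @lfun_of_linear K B A (fun b => \sum_(e <- copairing A) F [:: [:: e.2]] [:: b] *:
  e.1).
  move=> k b b'; rewrite scaler_sumr -big_split /=; apply: eq_bigr => e _.
  by rewrite !planar_mixed lC scalerDl scalerA.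
exists f => a b; rewrite fE bil_sumr -[in RHS](bil_snaker a).
have lT : linear ((fun a => F [:: [:: a]] [:: b]) : A -> K^o).
  by move=> k x y; rewrite !planar_mixed lO.
by rewrite (lin_comb lT); apply: eq_bigr => e _; rewrite bilZr mulrC.
Qed.

(** * The axioms read off from planar surfaces *)

Section Correspondence.
Variables (mu : 'Hom(A, 'Hom(A, A))) (om : 'Hom(B, 'Hom(B, B))) (f : 'Hom(B, A)).
Hypothesis muE : forall a b c, bil (mul mu a b) c = F [:: [:: a; b; c]] [::].
Hypothesis omE : forall a b c, bil (mul om a b) c = F [::] [:: a; b; c].
Hypothesis fE : forall a b, bil a (f b) = F [:: [:: a]] [:: b].

Lemma sumz_cons d ds : sumz (d :: ds) = d + sumz ds. Proof. by rewrite /sumz big_cons. Qed.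
Lemma sumz_nil : sumz [::] = 0. Proof. by rewrite /sumz big_nil. Qed.

Lemma homs1 (V : graded_space K) d (a : V) : a \in hom V d -> homs [:: d] [:: a].
Proof. by move=> h; rewrite /homs /= h. Qed.
Lemma homs_cons (V : graded_space K) d ds (a : V) l : a \in hom V d -> homs ds l -> homs (d :: ds)
  (a :: l).
Proof. by rewrite /homs /= => -> ->. Qed.
Lemma homss1 (V : graded_space K) ds (l : seq V) : homs ds l -> all2 (@homs K V) [:: ds] [:: l].
Proof. by move=> h; rewrite /= h. Qed.

(** The four-point function is the disc with four open inputs, cut into two triangles; its rotation
    is the invariance that associativity amounts to. For [B] the sphere with four closed inputs is
    used in the same way. *)
Lemma planar_frobenius : is_frobenius mu.
Proof.
apply: (frobenius_of_form (Q := fun a b c d => F [:: [:: a; b; c; d]] [::])).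
- move=> d e a b ha hb; apply: hom_of_bil => g c hc n; rewrite -/(mul mu a b) muE.
  apply: (planar_deg (dL := [:: [:: d; e; g]]) (db := [::])) => //.
    by apply: homss1; do !apply: homs_cons => //.
  by rewrite /= !(sumz_cons, sumz_nil) !addr0 addrA.
- move=> d1 d2 d3 a b c ha hb hc; rewrite !muE.
  have := @planar_rot [:: a] [:: b; c] [::] [::] [:: d1] [:: d2; d3] [::] [::] isT.
  rewrite !(sumz_cons, sumz_nil) !addr0 => -> //; first exact: homs1.
  by do !apply: homs_cons => //.
- move=> d1 d2 d3 d4 a b c d ha hb hc hd.
  have := @planar_ocomp_value [:: a; b] [:: c; d] [::] [::] [:: d1; d2] [:: d3;
    d4] [::] [::] isT isT.
  rewrite sumz_nil andbF mul1r => -> //; last 2 first.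
  - by do !apply: homs_cons => //.
  - by do !apply: homs_cons => //.
  by apply: eq_bigr => e _; rewrite koszul_scale0 !muE.
move=> d1 d2 d3 d4 a b c d ha hb hc hd.
have := @planar_rot [:: a] [:: b; c; d] [::] [::] [:: d1] [:: d2; d3; d4] [::] [::] isT.
rewrite !(sumz_cons, sumz_nil) !addr0 => -> //; first exact: homs1.
by do !apply: homs_cons => //.
Qed.

Lemma planar_commutative_frobenius : is_commutative_frobenius om.
Proof.
split.
  apply: (frobenius_of_form (Q := fun a b c d => F [::] [:: a; b; c; d])).
  - move=> d e a b ha hb; apply: hom_of_bil => g c hc n; rewrite -/(mul om a b) omE.
    apply: (planar_deg (dL := [::]) (db := [:: d; e; g])) => //.
      by do !apply: homs_cons => //.
    by rewrite /= !(sumz_cons, sumz_nil) !addr0 add0r addrA.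
  - move=> d1 d2 d3 a b c ha hb hc; rewrite !omE.
    have := @planar_swap [::] [::] [:: a] [:: b; c] [::] [::] [::] [:: d1] [:: d2; d3] [::] isT.
    rewrite !(sumz_cons, sumz_nil) !addr0 => -> //; first exact: homs1.
    by do !apply: homs_cons => //.
  - move=> d1 d2 d3 d4 a b c d ha hb hc hd.
    have := @planar_ccomp_value [::] [::] [:: a; b] [:: c; d] [::] [::] [:: d1; d2] [:: d3;
      d4] isT isT isT.
    rewrite sumz_nil mul1r => -> //; last 2 first.
    - by do !apply: homs_cons => //.
    - by do !apply: homs_cons => //.
    by apply: eq_bigr => e _; rewrite koszul_scale0 !omE.
  move=> d1 d2 d3 d4 a b c d ha hb hc hd.
  have := @planar_swap [::] [::] [:: a] [:: b; c; d] [::] [::] [::] [:: d1] [:: d2; d3;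
    d4] [::] isT.
  rewrite !(sumz_cons, sumz_nil) !addr0 => -> //; first exact: homs1.
  by do !apply: homs_cons => //.
move=> d1 d2 d3 a b c ha hb hc; rewrite -/(bil _ _) -!/(mul om _ _) -/(bil (mul om b a) c) -/(bil
  (mul om a c) b) !omE; split.
  have := @planar_swap [::] [::] [:: a] [:: b] [:: c] [::] [::] [:: d1] [:: d2] [:: d3] isT.
  by rewrite !(sumz_cons, sumz_nil) !addr0 => -> //; apply: homs1.
have := @planar_swap [::] [:: a] [:: b] [:: c] [::] [::] [:: d1] [:: d2] [:: d3] [::] isT.
by rewrite !(sumz_cons, sumz_nil) !addr0 => -> //; apply: homs1.
Qed.

Lemma planar_mixed_disc d e g a b c : a \in hom A d -> b \in hom A e -> c \in hom B g ->
  F [:: [:: a; b]] [:: c] = bil (mul mu a b) (f c).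
Proof.
move=> ha hb hc.
have := @planar_ocomp_value [:: a; b] [::] [::] [:: c] [:: d; e] [::] [::] [:: g] isT isT.
rewrite !sumz_nil mul1r => -> //; last 2 first.
- by do !apply: homs_cons => //.
- exact: homs1.
rewrite -[RHS]bil_snake; apply: eq_bigr => x _.
by rewrite koszul_scale0 muE fE.
Qed.

Lemma planar_map_hom d b : b \in hom B d -> f b \in hom A d.
Proof.
move=> hb; apply: hom_of_bilr => e a ha n; rewrite fE.
apply: (planar_deg (dL := [:: [:: e]]) (db := [:: d])) => //.
- by apply: homss1; apply: homs1.
- exact: homs1.
by rewrite /= !(sumz_cons, sumz_nil) !addr0 addrC.
Qed.

(** On the disc with two open inputs and one closed input, rotating the boundary exchanges the open
    inputs while the closed one stays in place. By non-degeneracy this says that f(b) commutes with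
    [a]. *)
Lemma planar_map_central d e b a : b \in hom B d -> a \in hom A e ->
  mul mu (f b) a = (-1) ^+ (oddz d && oddz e) *: mul mu a (f b).
Proof.
move=> hb ha; have [_ _ hcyc] := planar_frobenius.
apply: bil_injr_hom => g c hc; rewrite bilZr -!(bil_mul planar_frobenius).
have := planar_mixed_disc hc ha hb.
have := @planar_rot [:: c] [:: a] [::] [:: b] [:: g] [:: e] [::] [:: d] isT.
rewrite !(sumz_cons, sumz_nil) !addr0 => -> //=; try exact: homs1.
rewrite (planar_mixed_disc ha hc hb) => <-.
rewrite (bil_mul planar_frobenius a) (bil_sym ha (mulv_hom planar_frobenius hc (planar_map_hom
  hb))) mulrA mulrA -!signr_addb.
rewrite -[LHS]mul1r; congr (_ * _).
by rewrite oddzD; case: (oddz d); case: (oddz e); case: (oddz g).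
Qed.

(** The disc with one open and two closed inputs is decomposed in two ways. Cutting off a sphere
    with the two closed inputs gives f(b c); cutting along an arc between them gives f(b) f(c). *)
Lemma planar_map_mul b c : f (mul om b c) = mul mu (f b) (f c).
Proof.
apply: bil_injr_hom => da a ha.
apply: (bilinear_ext (F := fun b c => bil a (f (mul om b c)))
  (G := fun b c => bil a (mul mu (f b) (f c)))) => [||d e {}b {}c hb hc].
- by split=> *; rewrite ?(mulvDl, mulvDr) ?(mulvZl, mulvZr) homD homZ bilDr bilZr.
- by split=> *; rewrite homD homZ ?(mulvDl, mulvDr) ?(mulvZl, mulvZr) bilDr bilZr.
have E1 : F [:: [:: a]] [:: b; c] = bil a (f (mul om b c)).
  have := @planar_ccomp_value [:: [:: a]] [::] [::] [:: b; c] [:: [:: da]] [::] [::] [:: d;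
    e] isT isT isT.
  rewrite sumz_nil andbF mul1r => -> //; last 2 first.
  - by apply: homss1; apply: homs1.
  - by do !apply: homs_cons => //.
  rewrite -[in RHS](bil_snakel (mul om b c)) hom_suml bil_sumr; apply: eq_bigr => x _.
  by rewrite koszul_scale0 -fE -omE homZ bilZr (bil_mul planar_commutative_frobenius.1) mulrC.
rewrite -E1.
have := @planar_ocomp_value [:: a] [::] [:: b] [:: c] [:: da] [::] [:: d] [:: e] isT isT.
rewrite sumz_nil mul1r => -> //; try exact: homs1.
rewrite -(bil_mul planar_frobenius) -[RHS]bil_snake !big_seq;
  apply: eq_bigr => x /copairing_hom[g [h1 h2]].
rewrite -fE; congr (_ * _); rewrite sumz_cons sumz_nil addr0 /=.
have hk : koszul_scale A d x.1 \in hom A g by rewrite (koszul_scaleE _ h1) rpredZ.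
rewrite (planar_mixed_disc ha hk hb) (koszul_scaleE _ h1) mulvZr bilZl !(bil_mul planar_frobenius)
  (planar_map_central hb h1) bilZr.
by [].
Qed.

Lemma planar_cardy : cardy_condition mu f.
Proof.
move=> d a b hb; rewrite -/(bil _ _).
elim/hom_ind: a => [|e a a' ha IH].
  rewrite !big1 // => x _; first by rewrite -/(bil _ _) bil0l mul0r.
  by rewrite -/(bil _ _) -/(mul mu 0 _) mulv0l bil0l.
transitivity (\sum_(x <- copairing A) bil (mul mu a (koszul_scale A d x.1)) (mul mu b x.2) +
   \sum_(x <- copairing A) bil (mul mu a' (koszul_scale A d x.1)) (mul mu b x.2)).
  by rewrite -big_split; apply: eq_bigr => x _ /=; rewrite -bilDl -mulvDl.
rewrite [X in _ + X = _]IH {IH}.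
transitivity (\sum_(c <- copairing B) bil a (f c.1) * bil (f c.2) b +
  \sum_(c <- copairing B) bil a' (f c.1) * bil (f c.2) b); last first.
  by rewrite -big_split; apply: eq_bigr => x _ /=; rewrite -mulrDl -bilDl.
congr (_ + _).
(* The annulus with one open input on each boundary, cut along a closed curve into two discs. *)
have -> : \sum_(c <- copairing B) bil a (f c.1) * bil (f c.2) b = F [:: [:: a]; [:: b]] [::].
  have := @planar_ccomp_value [:: [:: a]] [:: [:: b]] [::] [::] [:: [:: e]] [:: [:: d]] [::] [::]
    isT isT isT.
  rewrite sumz_nil andbF mul1r => -> //; try by apply: homss1; apply: homs1.
  rewrite !big_seq; apply: eq_bigr => x /copairing_hom[g [h1 h2]].
  rewrite /= -!fE; congr (_ * _).
  rewrite sumz_cons sumz_nil addr0 (koszul_scaleE _ h2) homZ bilZr.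
  by rewrite (bil_sym (planar_map_hom h2) hb) andbC.
(* The same annulus, cut along an arc joining its boundaries, is a disc with four open inputs, which
   in turn consists of two triangles. *)
have := @planar_octr_value [:: a] [:: b] [::] [:: e] [:: d] [::] isT isT.
rewrite sumz_cons sumz_nil addr0 => -> //; try exact: homs1.
pose G x y := bil (mul mu (koszul_scale A e x) a) (mul mu y b).
have -> : \sum_(x <- copairing A) F [:: [:: koszul_scale A e x.1, a & [:: x.2;
  b]]] [::] = \sum_(x <- copairing A) G x.1 x.2.
  rewrite !big_seq; apply: eq_bigr => x /copairing_hom[g [h1 h2]].
  have hk : koszul_scale A e x.1 \in hom A g by rewrite (koszul_scaleE _ h1) rpredZ.
  have := @planar_ocomp_value [:: koszul_scale A e x.1; a] [:: x.2; b] [::] [::] [:: g;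
    e] [:: - g; d] [::] [::] isT isT.
  rewrite sumz_nil andbF mul1r => -> //; last 2 first.
  - by do !apply: homs_cons => //.
  - by do !apply: homs_cons => //.
  rewrite -[RHS]bil_snake; apply: eq_bigr => y _.
  by rewrite koszul_scale0 -(bil_mul planar_frobenius) !muE.
(* The contraction places the first leg before [a], the Cardy condition behind it. Exchanging the
   legs and moving one of them around the product by the symmetry of the form brings the terms into
   the required shape. *)
rewrite (copairing_sym (Z := K^o) (G := G)); last 2 first.
- by move=> y k u v; rewrite /G homD homZ mulvDl mulvZl bilDl bilZl.
- by move=> y k u v; rewrite /G mulvDl mulvZl bilDr bilZr.
rewrite !big_seq; apply: eq_bigr => x /copairing_hom[g [h1 h2]].
have hk : koszul_scale A 1 x.2 \in hom A (- g) by rewrite (koszul_scaleE _ h2) rpredZ.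
symmetry; rewrite /G (koszul_scaleE _ hk) (koszul_scaleE _ h2) (koszul_scaleE _ h1).
rewrite -/(bil _ _) -!/(mul mu _ _) !(mulvZl, mulvZr, bilZl) -[in RHS](bil_mul planar_frobenius)
  (bil_mul planar_frobenius x.2).
have hy := mulv_hom planar_frobenius ha (mulv_hom planar_frobenius h1 hb).
rewrite (bil_sym h2 hy) -(mulvA planar_frobenius a) (bil_mul planar_frobenius) !mulrA -!signr_addb;
  congr (_ ^+ nat_of_bool _ * _).
by rewrite !oddzD !oddzN /=; case: (oddz d); case: (oddz e); case: (oddz g).
Qed.

End Correspondence.

End PlanarSurfaces.

(** * The one-to-one correspondence *)

Lemma algebra_corresponds (K : fieldType) (A B : form_space K) (alpha : KP_algebra A B) :
  exists S : cardy_frobenius A B, corresponds alpha S.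
Proof.
have [mu muE] := planar_mul_open alpha; have [om omE] := planar_mul_closed alpha.
have [f fE] := planar_map_mixed alpha.
have Hf : is_central_morphism mu om f.
  split; [exact: planar_map_hom fE | exact: (planar_map_mul muE omE fE) | exact:
    (planar_map_central muE fE)].
exists (CardyFrobenius (planar_frobenius muE) (planar_commutative_frobenius omE) Hf (planar_cardy
  muE fE)); split=> /=.
- by move=> a b c; rewrite -[LHS]/(bil (mul mu a b) c) muE planar_open.
- by move=> a b c; rewrite -[LHS]/(bil (mul om a b) c) omE planar_closed.
by move=> a b; rewrite -[LHS]/(bil a (f b)) fE planar_mixed.
Qed.

Lemma algebra_corresponds_unique (K : fieldType) (A B : form_space K) (alpha : KP_algebra A B)
    (S S' : cardy_frobenius A B) :
  corresponds alpha S -> corresponds alpha S' -> S = S'.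
Proof.
case: S S' => mu om f h1 h2 h3 h4 [mu' om' f' h1' h2' h3' h4'] [/= E1 E2 E3] [/= E1' E2' E3'].
have Em : mu = mu'.
  by apply/lfunP => a; apply/lfunP => b; apply: bil_inj => c; rewrite /bil E1 E1'.
have Eo : om = om'.
  by apply/lfunP => a; apply/lfunP => b; apply: bil_inj => c; rewrite /bil E2 E2'.
have Ef : f = f'.
  by apply/lfunP => b; apply: bil_injr_hom => d a _; rewrite /bil E3 E3'.
move: h1' h2' h3' h4' {E1' E2' E3'}; rewrite -Em -Eo -Ef => h1' h2' h3' h4'.
by congr CardyFrobenius; apply: Prop_irrelevance.
Qed.

Theorem theorem56 (K : fieldType) (A B : form_space K) :
  (forall alpha : KP_algebra A B,
     exists! S : cardy_frobenius A B, corresponds alpha S) /\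
  (forall S : cardy_frobenius A B,
     exists! alpha : KP_algebra A B, corresponds alpha S).
Proof.
split=> [alpha|S].
  have [S cS] := algebra_corresponds alpha; exists S; split=> // S'.
  exact: algebra_corresponds_unique.
have [alpha ca] := surface_corresponds S; exists alpha; split=> // alpha'.
exact: KP_algebra_unique.
Qed.
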